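(* (i) Let $Z=(Z_i)_{i=1}^\infty$ be a random element of $\Omega$ and suppose that the first and second correlation functions $r_1$ and $r_2$ of $\xi:=\Xi(Z)$ exist and satisfy $$K(z_1,z_2)\,r_2(z_1,z_2)\,P_{z_1,z_2}=F(z_1,z_2)\,r_1(z_1+z_2)\,P_{z_1+z_2}\qquad\text{for a.e. }(z_1,z_2)\in(0,\infty)^2,$$ where $P_{z_1,z_2}$ and $P_{z_1+z_2}$ are the second-order and first-order reduced Palm distributions of $\xi$ and the equality is between two measures on $\mathcal N$. Then the process generated by $L$ is reversible with respect to the law of $Z$. (ii) Let $\theta>0$ and let $H$ be a symmetric, nonnegative measurable function on $(0,\infty)^2$, homogeneous of degree $\lambda\ge0$, with $\sup_{0<u<1}H(u,1-u)\in(0,\infty)$. Let $$L^{(H,\theta)}\Phi(\mathbf z)=\frac12\sum_{i\neq j}z_iz_jH(z_i,z_j)\left(\Phi(M_{ij}\mathbf z)-\Phi(\mathbf z)\right)+\frac\theta2\sum_iz_i^2\int_0^1du\,H(uz_i,(1-u)z_i)\left(\Phi(S_i^u\mathbf z)-\Phi(\mathbf z)\right)$$ (that is, $L$ with $\widehat H=H$ and $\check H=\theta H$). Suppose that $X=(X_i)_{i=1}^\infty$ is ${\rm PD}(\theta)$-distributed. Then, for any $(0,\infty)$-valued random variable $V$ independent of $X$, the law of the $\Omega$-valued random element $(VX_i)_{i=1}^\infty$ is a reversible distribution of the process generated by $L^{(H,\theta)}$.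
   Context: Rates: fix $\lambda\ge0$. $\widehat H,\check H:(0,\infty)^2\to[0,\infty)$ are symmetric, measurable, homogeneous of degree $\lambda$ (i.e. $H(ax,ay)=a^\lambda H(x,y)$ for $a,x,y>0$), with $\widehat C:=\sup_{0<u<1}\widehat H(u,1-u)\in(0,\infty)$ and $\check C:=\int_0^1\check H(u,1-u)\,du\in(0,\infty)$; $K(x,y)=xy\,\widehat H(x,y)$ and $F(x,y)=(x+y)\check H(x,y)$. Spaces: $\Omega=\{\mathbf z=(z_i)_{i\ge1}:z_1\ge z_2\ge\cdots\ge0,\ 0<\sum_iz_i<\infty\}$ with the product topology, $|\mathbf z|=\sum_iz_i$; $\Omega_1=\{\mathbf z\in\Omega:|\mathbf z|=1\}$; $B(\Omega)$ = bounded Borel functions on $\Omega$ with the sup norm. $M_{ij}\mathbf z$ is obtained from $\mathbf z$ by merging $z_i,z_j$ into $z_i+z_j$ and reordering decreasingly; $S_i^{(y)}\mathbf z$ by splitting $z_i$ into $y$ and $z_i-y$ and reordering; $S_i^u\mathbf z=S_i^{(uz_i)}\mathbf z$. Sums over $i\ne j$ (resp. $i$) are over indices with $z_iz_j>0$ (resp. $z_i>0$). Process generated by $L$: $$L\Phi(\mathbf z)=\frac12\sum_{i\neq j}K(z_i,z_j)(\Phi(M_{ij}\mathbf z)-\Phi(\mathbf z))+\frac12\sum_i\int_0^{z_i}dy\,F(y,z_i-y)(\Phi(S_i^{(y)}\mathbf z)-\Phi(\mathbf z)).$$ The operator $\widetilde L\Phi(\mathbf z)=|\mathbf z|^{-(2+\lambda)}L\Phi(\mathbf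 z)$ is bounded on $B(\Omega)$ and generates a Markov jump process $\widetilde Z(t)$ on $\Omega$ (semigroup $e^{t\widetilde L}$) which preserves $|\cdot|$; the process generated by $L$ is $Z(t):=\widetilde Z(|\widetilde Z(0)|^{2+\lambda}t)$. The process generated by $L^{(H,\theta)}$ is defined in the same way with $\widehat H=H$, $\check H=\theta H$. It is reversible with respect to a probability measure $\pi$ ($\pi$ is a reversible distribution) if, when started from $\pi$, $(Z(t_1),\dots,Z(t_n))$ and $(Z(T-t_1),\dots,Z(T-t_n))$ have the same law for all $0<t_1<\cdots<t_n<T$. Point processes: $\mathcal N$ is the set of $\{0,1,2,\dots\}$-valued Radon measures on $(0,\infty)$ with the vague topology, $\Xi(\mathbf z)=\sum_i\mathbf 1_{\{z_i>0\}}\delta_{z_i}$. For a locally finite point process $\xi=\sum_i\delta_{Z_i}$ on $(0,\infty)$, $\xi^{[k]}=\sum_{i_1,\dots,i_k\text{ distinct}}\delta_{(Z_{i_1},\dots,Z_{i_k})}$; the $k$th correlation measure is the mean measure of $\xi^{[k]}$ and its density, if it exists, is the $k$th correlation function. The $k$th-order reduced Palm distributions $P_{z_1,\dots,z_k}$ are probability measures on $\mathcal N$, measurable in $(z_1,\dots,z_k)$ and determined up to null sets of the $k$th correlation measure $r_k(dz_1\cdots dz_k)$, such that for every bounded nonnegative Borel $G$ on $(0,\infty)^k\times\mathcal N$ $$E\Big[\int\xi^{[k]}(dz_1\cdots dz_k)\,G(z_1,\dots,z_k,\xi)\Big]=\int r_k(dz_1\cdots dz_k)\int_{\mathcal N}P_{z_1,\dots,z_k}(d\eta)\,G(z_1,\dots,z_k,\eta+\delta_{z_1}+\cdots+\delta_{z_k}).$$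 ${\rm PD}(\theta)$ is the law on $\Omega_1$ of $(Y_i/\sum_jY_j)_{i\ge1}$, where $Y_1\ge Y_2\ge\cdots$ are the ranked points of a Poisson point process on $(0,\infty)$ with mean measure $\theta y^{-1}e^{-y}dy$. *)

(* Defs.v *)
From HB Require Import structures.
From mathcomp Require Import all_boot all_order all_algebra.
From mathcomp Require Import all_classical all_reals all_analysis.

Set Implicit Arguments.
Unset Strict Implicit.
Unset Printing Implicit Defensive.
Import Order.TTheory GRing.Theory Num.Theory.
Import numFieldNormedType.Exports.

Local Open Scope classical_set_scope.
Local Open Scope ring_scope.

(* Sequences are indexed from 0: z 0 >= z 1 >= ... are the sizes usually
   written z_1 >= z_2 >= ... *)
Definition Omega_set (R : realType) : set {ptws nat -> R} :=
  [set z | [/\ forall i, z i.+1 <= z i, forall i, 0 <= z i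
             & (0 < \sum_(0 <= i <oo) (z i)%:E < +oo)%E]].
Arguments Omega_set : clear implicits.

(* [set_type] carries the subspace topology, here that of the product
   topology; measurable sets are the Borel sets of this topology. *)
Definition Omega (R : realType) : Type := set_type (Omega_set R).

Lemma Omega_set_delta (R : realType) :
  Omega_set R (fun i => (i == 0%N)%:R).
Proof.
split=> [i|i|] /=; [by rewrite ler0n|by rewrite ler0n|].
rewrite nneseries_recl//=.
by rewrite eseries0 ?adde0 ?lte_fin ?ltr01 ?ltry// => -[].
Qed.

HB.instance Definition _ (R : realType) := SubChoice.on (Omega R).
HB.instance Definition _ (R : realType) := Topological.on (Omega R).
HB.instance Definition _ (R : realType) :=
  isPointed.Build (Omega R)
    (exist (fun z => z \in Omega_set R) _ (mem_set (Omega_set_delta R))).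
HB.instance Definition _ (R : realType) :=
  @isMeasurable.Build (sigma_display (@open (Omega R))) (Omega R)
    <<s @open (Omega R) >> (@sigma_algebra0 _ setT _)
    (@sigma_algebraC _ _) (@sigma_algebra_bigcup _ setT _).

Section omega_operations.
Context {R : realType}.
Implicit Types (w : nat -> R) (z : Omega R) (i j k : nat) (x y v : R).

Definition sizes z : nat -> R := \val z.
Coercion sizes : Omega >-> Funclass.

Definition mass z : R := fine (\sum_(0 <= i <oo) (z i)%:E)%E.

Definition pos_idx z : set nat := [set i | 0 < z i].

Definition pos_pairs z : set (nat * nat) :=
  [set p | [/\ p.1 != p.2, 0 < z p.1 & 0 < z p.2]].

Definition del i w : nat -> R := fun k => if (k < i)%N then w k else w k.+1.

(* inserts [y] at its rank in the nonincreasing sequence [w] *)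
Definition ins y w : nat -> R := fun k =>
  if y <= w k then w k
  else if (k == 0%N) || (y <= w k.-1) then y else w k.-1.

(* In the four operations below, [insubd z] returns [z] if its argument is not
   in [Omega]; the lemmas [merge_subproof], etc. show that this does not happen
   for the arguments of interest. *)
Definition merge_seq i j w : nat -> R :=
  ins (w i + w j) (del (minn i j) (del (maxn i j) w)).
Definition merge i j z : Omega R := insubd z (merge_seq i j z).

Definition split_seq i y w : nat -> R := ins y (ins (w i - y) (del i w)).
Definition split i y z : Omega R := insubd z (split_seq i y z).

Definition scale v z : Omega R := insubd z (fun k => v * z k).

Definition normalize z : Omega R := insubd z (fun k => z k / mass z).

End omega_operations.

Section omega_facts.
Context {R : realType}.
Implicit Types (w : nat -> R) (z : Omega R).

Lemma OmegaP z : Omega_set R z.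
Proof. exact: set_mem (valP z). Qed.

Lemma Omega_ge0 z i : 0 <= z i. Proof. by have [_ + _] := OmegaP z; exact. Qed.

Lemma massE z : (\sum_(0 <= i <oo) (z i)%:E)%E = (mass z)%:E.
Proof.
have [_ _ /andP[z0 zoo]] := OmegaP z; rewrite /mass fineK//.
by rewrite fin_numE gt_eqF ?lt_eqF// (lt_trans _ z0)// ltNy0.
Qed.

Lemma mass_gt0 z : 0 < mass z.
Proof. by rewrite -lte_fin -massE; have [_ _ /andP[]] := OmegaP z. Qed.

Let insat N (y : R) w : nat -> R :=
  fun k => if (k < N)%N then w k else if k == N then y else w k.-1.

Let nonincr w := forall k, w k.+1 <= w k.
Let nonneg w := forall k, 0 <= w k.
Let sum w := (\sum_(0 <= k <oo) (w k)%:E)%E.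

Let eq_sum w w' : w =1 w' -> sum w = sum w'.
Proof. by move=> /funext ->. Qed.

Let sum_recl w : nonneg w -> sum w = ((w 0%N)%:E + sum (fun k => w k.+1))%E.
Proof.
move=> w0; have f0 k : (0 <= (w k)%:E)%E by rewrite lee_fin.
rewrite /sum nneseries_recl//.
rewrite -(@nneseries_addn _ (EFin \o w) 1)//.
by congr (_ + _)%E; apply: eq_sum => k; rewrite addn1.
Qed.

Let sum_insat N y w : 0 <= y -> nonneg w ->
  (sum (insat N y w) = y%:E + sum w)%E.
Proof.
move=> y0; elim: N w => [|N IH] w w0.
  have i0 : nonneg (insat 0 y w) by case=> [|k]; rewrite /insat/=.
  by rewrite (sum_recl i0); congr (_ + _)%E; exact: eq_sum.
have i0 : nonneg (insat N.+1 y w).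
  by move=> k; rewrite /insat; case: ifP => // _; case: ifP.
rewrite (sum_recl i0) (sum_recl w0) addeCA; congr (_ + _)%E.
rewrite -(IH (fun k => w k.+1)) => [|k]; last exact: w0.
apply: eq_sum => k.
rewrite /insat !ltnS eqSS /=; case: ltngtP => //.
by case: k.
Qed.

Let del_insat i w : w = insat i (w i) (del i w).
Proof.
apply/funext => k; rewrite /insat /del; case: ltngtP => [//|ik|->//].
by case: k ik => // k; rewrite ltnS/= ltnNge => ->.
Qed.

Let nonneg_del i w : nonneg w -> nonneg (del i w).
Proof. by move=> w0 k; rewrite /del; case: ifP. Qed.

Let sum_del i w : nonneg w -> (sum w = (w i)%:E + sum (del i w))%E.
Proof.
by move=> w0; rewrite {1}(del_insat i w) sum_insat//; exact: nonneg_del.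
Qed.

Let nonincr_del i w : nonincr w -> nonincr (del i w).
Proof.
move=> wd k; rewrite /del; case: (ltnP k.+1 i) => [/ltnW ->//|].
by case: ltnP => // _ _; exact: le_trans (wd _) (wd _).
Qed.

Let nonincr_le w m n : nonincr w -> (m <= n)%N -> w n <= w m.
Proof.
move=> wd /subnK <-; elim: (n - m)%N => // d; exact: le_trans (wd _).
Qed.

Let nonneg_ins y w : 0 <= y -> nonneg w -> nonneg (ins y w).
Proof. by move=> y0 w0 k; rewrite /ins; case: ifP => // _; case: ifP. Qed.

Let nonincr_ins y w : nonincr w -> nonincr (ins y w).
Proof.
move=> wd k; rewrite /ins /=; have wk := wd k.
case: (leP y (w k)) => yk; first by case: ifP.
rewrite (lt_geF (le_lt_trans wk yk))/=.
case: k wk yk => [|k] wk yk /=; first exact: ltW.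
case: ifP => _; exact: ltW || exact: wd.
Qed.

Let sum_ins y w : 0 <= y -> nonincr w -> nonneg w -> (sum w < +oo)%E ->
  (sum (ins y w) = y%:E + sum w)%E.
Proof.
move=> y0 wd w0 woo; have [y00|yn0] := eqVneq y 0.
  by rewrite y00 add0e; apply: eq_sum => k; rewrite /ins w0.
have yp : 0 < y by rewrite lt_neqAle eq_sym yn0.
have ex : exists N, w N < y.
  have /cvg_series_cvg_0 w_0 := nnseries_is_cvg w0 woo.
  have : \forall n \near \oo, `|0 - w n| < y.
    by move/cvgrPdist_lt : w_0; apply.
  case=> N _ /(_ N (leqnn N)) /=; rewrite sub0r normrN ger0_norm// => wN.
  by exists N.
case: (ex_minnP ex) => N wN mm.
have mN k : (k < N)%N -> y <= w k.
  by apply: contraTle => /mm; rewrite leqNgt.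
rewrite -(sum_insat N)//; apply: eq_sum => k; rewrite /ins /insat.
case: (ltngtP k N) => [kN|kN|->].
- by rewrite mN.
- rewrite (lt_geF (le_lt_trans (nonincr_le wd (ltnW kN)) wN))/=.
  case: k kN => // k kN /=.
  by rewrite (lt_geF (le_lt_trans (nonincr_le wd (kN : (N <= k)%N)) wN)).
- rewrite (lt_geF wN)/=; case: N wN mm mN => //= m _ _ -> //.
Qed.

Let Omega_mass w m : nonincr w -> nonneg w -> 0 < m -> sum w = m%:E ->
  Omega_set R w.
Proof.
by move=> wd w0 m0 wm; split=> //; rewrite -/(sum w) wm lte_fin m0 ltry.
Qed.

Let merge_seqP i j z : i != j ->
  [/\ nonincr (merge_seq i j z), nonneg (merge_seq i j z)
    & sum (merge_seq i j z) = (mass z)%:E].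
Proof.
move=> ij; have [zd z0 _] := OmegaP z.
have zz : merge_seq i j z = ins (z i + z j)
    (del (minn i j) (del (maxn i j) z)) by [].
have s0 : 0 <= z i + z j by rewrite addr_ge0 ?Omega_ge0.
have d0 := nonneg_del (minn i j) (nonneg_del (maxn i j) z0).
have dd := nonincr_del (minn i j) (nonincr_del (maxn i j) zd).
have E : ((mass z)%:E = (z i + z j)%:E +
    sum (del (minn i j) (del (maxn i j) z)))%E.
  rewrite -massE -/(sum z) (sum_del (maxn i j))// (sum_del (minn i j)).
    rewrite addeA -EFinD; congr (_%:E + _)%E.
    rewrite /del; move: ij; rewrite /maxn /minn.
    by case: ltngtP => // ij _; rewrite ij 1?addrC.
  exact: nonneg_del.
split; rewrite zz; [exact: nonincr_ins|exact: nonneg_ins|].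
by rewrite sum_ins// -?E//; case: (sum _) E => //= r _; rewrite ltry.
Qed.

Lemma merge_subproof i j z : i != j -> Omega_set R (merge_seq i j z).
Proof.
by move=> /(merge_seqP z)[wd w0 ws]; exact: Omega_mass wd w0 (mass_gt0 z) ws.
Qed.

Lemma mergeE i j z : i != j -> merge i j z = merge_seq i j z :> (nat -> R).
Proof. by move=> ij; apply: insubdK; exact/mem_set/merge_subproof. Qed.

Lemma mass_merge i j z : i != j -> mass (merge i j z) = mass z.
Proof.
move=> ij; apply: EFin_inj; rewrite -massE mergeE//.
by have [_ _] := merge_seqP z ij.
Qed.

Let split_seqP i y z : 0 <= y <= z i ->
  [/\ nonincr (split_seq i y z), nonneg (split_seq i y z)
    & sum (split_seq i y z) = (mass z)%:E].
Proof.
move=> /andP[y0 yz]; have [zd z0 _] := OmegaP z.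
have zz : split_seq i y z = ins y (ins (z i - y) (del i z)) by [].
have s0 : 0 <= z i - y by rewrite subr_ge0.
have d0 := nonneg_del i z0.
have dd := nonincr_del i zd.
have E : ((mass z)%:E = (z i)%:E + sum (del i z))%E.
  by rewrite -massE -/(sum z) (sum_del i).
have doo : (sum (del i z) < +oo)%E.
  by case: (sum _) E => //= r _; rewrite ltry.
split; rewrite zz.
- by do 2!apply: nonincr_ins.
- by do 2!apply: nonneg_ins => //.
- rewrite sum_ins//; [|exact: nonincr_ins|exact: nonneg_ins|].
    by rewrite sum_ins// addeA -EFinD [y + _]addrC subrK.
  by rewrite sum_ins// lte_add_pinfty// ltry.
Qed.

Lemma split_subproof i y z : 0 <= y <= z i -> Omega_set R (split_seq i y z).
Proof.
by move=> /split_seqP[wd w0 ws]; exact: Omega_mass wd w0 (mass_gt0 z) ws.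
Qed.

Lemma splitE i y z : 0 <= y <= z i ->
  split i y z = split_seq i y z :> (nat -> R).
Proof. by move=> yz; apply: insubdK; exact/mem_set/split_subproof. Qed.

Lemma mass_split i y z : 0 <= y <= z i -> mass (split i y z) = mass z.
Proof.
move=> yz; apply: EFin_inj; rewrite -massE splitE//.
by have [_ _] := split_seqP yz.
Qed.

Lemma scale_subproof v z : 0 < v -> Omega_set R (fun k => v * z k).
Proof.
move=> v0; have [zd z0 _] := OmegaP z.
apply: (@Omega_mass _ (v * mass z)) => [k|k||].
- by rewrite ler_pM2l//; exact: zd.
- by rewrite mulr_ge0 ?Omega_ge0// ltW.
- by rewrite mulr_gt0// mass_gt0.
- rewrite EFinM -massE -nneseriesZl => [|k _]; last by rewrite lee_fin Omega_ge0.
  by apply: eq_eseriesr => k _; rewrite EFinM.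
Qed.

Lemma scaleE v z : 0 < v -> scale v z = (fun k => v * z k) :> (nat -> R).
Proof. by move=> v0; apply: insubdK; exact/mem_set/scale_subproof. Qed.

Lemma normalizeE z : normalize z = (fun k => z k / mass z) :> (nat -> R).
Proof.
apply: insubdK; apply/mem_set.
rewrite [X in Omega_set R X](_ : _ = fun k => (mass z)^-1 * z k).
  by apply: scale_subproof; rewrite invr_gt0 mass_gt0.
by apply/funext => k; rewrite mulrC.
Qed.

End omega_facts.

Section configurations.
Context {R : realType}.
Local Notation RT := (measurableTypeR R).

(* Measures on (0, +oo) are represented by their extension by 0 to R. *)
Definition is_config (m : {measure set RT -> \bar R}) : Prop :=
  m `]-oo, 0]%classic = 0%E /\
  forall (A : set RT) (a b : R), measurable A -> 0 < a ->
    A `<=` `[a, b]%classic -> exists n : nat, m A = n%:R%:E.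

End configurations.

Record config (R : realType) := Config {
  config_measure :> {measure set (measurableTypeR R) -> \bar R};
  configP : is_config config_measure }.

(* continuous functions with compact support in (0, +oo), extended by 0 *)
Definition Cc_pos (R : realType) : Type :=
  {f : R -> R | continuous f /\
     exists a b : R, 0 < a /\ forall x, f x != 0 -> a <= x <= b}.

HB.instance Definition _ (R : realType) := gen_eqMixin (Cc_pos R).
HB.instance Definition _ (R : realType) := gen_choiceMixin (Cc_pos R).

Definition config_eval (R : realType) (eta : config R) :
    prod_topology (fun _ : Cc_pos R => R) :=
  fun f => \int[eta]_(x in `]0, +oo[%classic) sval f x.

HB.instance Definition _ (R : realType) := gen_eqMixin (config R).
HB.instance Definition _ (R : realType) := gen_choiceMixin (config R).
(* the vague topology and its Borel sets *)
HB.instance Definition _ (R : realType) :=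
  Topological.copy (config R) (initial_topology (@config_eval R)).

Lemma is_config0 (R : realType) : is_config (@mzero _ (measurableTypeR R) R).
Proof. by split=> // A a b _ _ _; exists 0%N. Qed.

HB.instance Definition _ (R : realType) :=
  isPointed.Build (config R) (Config (is_config0 R)).
HB.instance Definition _ (R : realType) :=
  @isMeasurable.Build (sigma_display (@open (config R))) (config R)
    <<s @open (config R) >> (@sigma_algebra0 _ setT _)
    (@sigma_algebraC _ _) (@sigma_algebra_bigcup _ setT _).

Section point_measures.
Context {R : realType}.
Local Notation RT := (measurableTypeR R).
Implicit Types (z : Omega R) (eta : config R) (x : R).

Definition atom x : {measure set RT -> \bar R} :=
  if 0 < x then \d_(x : RT) : {measure set RT -> \bar R}
  else mzero : {measure set RT -> \bar R}.

Let atomE x (A : set RT) : atom x A = ((0 < x) && (x \in A))%:R%:E.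
Proof. by rewrite /atom; case: ifP => _ //=; rewrite diracE. Qed.

Let atom_config x : is_config (atom x).
Proof.
split; last first.
  by move=> A a b _ _ _; exists ((0%R < x)%R && (x \in A)); exact: atomE.
rewrite atomE; case: ltP => //= x0; rewrite memNset//=.
by rewrite in_itv/= leNgt x0.
Qed.

Lemma Xi_subproof z : is_config (mseries (fun i => atom (z i)) 0).
Proof.
split.
  by rewrite /= /mseries eseries0// => i _ _; have [] := atom_config (z i).
move=> A a b mA a0 Aab.
have [_ z0 /andP[_ zoo]] := OmegaP z.
have /cvg_series_cvg_0 z_0 := nnseries_is_cvg z0 zoo.
have : \forall n \near \oo, `|0 - z n| < a.
  by move/cvgrPdist_lt : z_0; apply.
case=> N _ zN.
exists (\sum_(0 <= i < N) ((0%R < z i)%R && (z i \in A)))%N.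
rewrite /= /mseries (nneseries_split 0 N) => [|k _]; last exact: measure_ge0.
rewrite add0n [X in (_ + X)%E]eseries0 ?adde0 => [|i Ni _].
  by rewrite natr_sum -sumEFin; apply: eq_bigr => i _; rewrite atomE.
rewrite atomE memNset ?andbF// => /Aab/=; rewrite in_itv/= => /andP[az _].
by have := zN _ Ni; rewrite /= sub0r normrN ger0_norm// ltNge az.
Qed.

Definition Xi z : config R := Config (Xi_subproof z).

Lemma add_point_subproof eta x : is_config (measure_add eta (atom x)).
Proof.
have [eta0 etaA] := configP eta; have [x0 xA] := atom_config x.
have addE (A : set RT) : measure_add eta (atom x) A = (eta A + atom x A)%E.
  exact: measure_addE.
split=> [|A a b mA a0 Aab]; first by rewrite [LHS]addE eta0 x0 adde0.
have [n en] := etaA A a b mA a0 Aab; have [k ek] := xA A a b mA a0 Aab.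
by exists (n + k)%N; rewrite [LHS]addE en ek natrD EFinD.
Qed.

(* eta + delta_x, for x > 0 *)
Definition add_point eta x : config R := Config (add_point_subproof eta x).

End point_measures.

Definition half_line (R : realType) : set (measurableTypeR R) :=
  `]0, +oo[%classic.
Arguments half_line : clear implicits.

Definition quadrant (R : realType) :
    set (measurableTypeR R * measurableTypeR R) :=
  [set p | 0 < p.1 /\ 0 < p.2].
Arguments quadrant : clear implicits.

Section rates.
Context {R : realType}.
Local Notation RT := (measurableTypeR R).
Local Notation mu := (@lebesgue_measure R).
Implicit Types (lam x y a u : R) (H : R -> R -> R).

(* symmetric, nonnegative, measurable, homogeneous of degree lam on
   (0, +oo)^2; values elsewhere are irrelevant *)
Definition homogeneous_rate lam H : Prop :=
  [/\ measurable_fun (quadrant R) (fun p : RT * RT => H p.1 p.2),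
      forall x y, 0 < x -> 0 < y -> 0 <= H x y,
      forall x y, 0 < x -> 0 < y -> H x y = H y x
    & forall a x y, 0 < a -> 0 < x -> 0 < y ->
        H (a * x) (a * y) = a `^ lam * H x y].

Definition rate_sup H : \bar R :=
  ereal_sup [set (H u (1 - u))%:E | u in `]0, 1[].

Definition rate_int H : \bar R :=
  (\int[mu]_(u in `]0%R, 1%R[) (H u (1 - u))%:E)%E.

Definition coag_rate H x y : R := x * y * H x y.

Definition frag_rate H x y : R := (x + y) * H x y.

End rates.

Section generators.
Context {R : realType}.
Local Notation mu := (@lebesgue_measure R).
Implicit Types (lam theta t : R) (H : R -> R -> R)
  (Phi : Omega R -> R) (z : Omega R) (A : (Omega R -> R) -> Omega R -> R).

(* The (absolutely convergent) sums over indices are integrals with respect to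
   the counting measure. *)
Definition generator Hhat Hcheck Phi z : R :=
  2^-1 * \int[counting]_(p in pos_pairs z)
    (coag_rate Hhat (z p.1) (z p.2) * (Phi (merge p.1 p.2 z) - Phi z)) +
  2^-1 * \int[counting]_(i in pos_idx z) \int[mu]_(y in `]0, z i[)
    (frag_rate Hcheck y (z i - y) * (Phi (split i y z) - Phi z)).

Definition generator_theta H theta Phi z : R :=
  2^-1 * \int[counting]_(p in pos_pairs z)
    (z p.1 * z p.2 * H (z p.1) (z p.2) * (Phi (merge p.1 p.2 z) - Phi z)) +
  theta / 2 * \int[counting]_(i in pos_idx z) ((z i) ^+ 2 *
    \int[mu]_(u in `]0, 1[)
      (H (u * z i) ((1 - u) * z i) * (Phi (split i (u * z i) z) - Phi z))).

Definition normalized_generator lam A Phi z : R :=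
  mass z `^ (- (2 + lam)) * A Phi z.

(* exp (t A), as a power series in the bounded operator A *)
Definition semigroup A t Phi z : R :=
  limn (series (fun n => t ^+ n / n`!%:R * iter n A Phi z)).

End generators.

Section processes.
Context {R : realType}.

Definition bounded_borel (Phi : Omega R -> R) : Prop :=
  measurable_fun setT Phi /\ exists C, forall z, `|Phi z| <= C.

(* right-continuous step functions of t >= 0 with finitely many jumps in
   bounded time *)
Definition jump_path (x : R -> Omega R) : Prop :=
  (forall t, 0 <= t -> exists2 e, 0 < e & forall s, t <= s < t + e -> x s = x t)
  /\
  (forall t, 0 < t -> exists2 e, 0 < e &
     exists a, forall s, 0 <= s -> t - e < s < t -> x s = a).

Definition past (W : Type) (Z : R -> W -> Omega R) (s : R) : set (set W) :=
  <<s [set A | exists r B, [/\ 0 <= r <= s, measurable B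
                             & A = Z r @^-1` B]] >>.

(* Markov jump process, on some probability space, with semigroup exp (t A);
   only the values at times t >= 0 matter. *)
Definition markov_jump_process (A : (Omega R -> R) -> Omega R -> R)
    (d : measure_display) (W : measurableType d) (P : probability W R)
    (Z : R -> W -> Omega R) : Prop :=
  [/\ forall t, 0 <= t -> measurable_fun setT (Z t),
      forall w, jump_path (Z ^~ w)
    & forall s t (Phi : Omega R -> R) (E : set W), 0 <= s -> 0 <= t ->
        bounded_borel Phi -> past Z s E ->
        \int[P]_(w in E) Phi (Z (s + t) w) =
        \int[P]_(w in E) semigroup A t Phi (Z s w)].

Definition time_change (lam : R) (W : Type) (Z : R -> W -> Omega R) :
    R -> W -> Omega R :=
  fun t w => Z (mass (Z 0 w) `^ (2 + lam) * t) w.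

(* [Z] ranges over all realizations, started from [pi], of the Markov jump
   process generated by the normalized generator; the process generated by [L]
   is its time change. *)
Definition reversible (lam : R) (L : (Omega R -> R) -> Omega R -> R)
    (pi : set (Omega R) -> \bar R) : Prop :=
  forall (d : measure_display) (W : measurableType d) (P : probability W R)
    (Z : R -> W -> Omega R),
  markov_jump_process (normalized_generator lam L) P Z ->
  (forall A, measurable A -> pushforward P (Z 0) A = pi A) ->
  forall (n : nat) (t : n.-tuple R) (T : R), path <%R 0 (rcons t T) ->
  forall B : set (n.-tuple (Omega R)), measurable B ->
    P [set w | B [tuple time_change lam Z (tnth t k) w | k < n]] =
    P [set w | B [tuple time_change lam Z (T - tnth t k) w | k < n]].

End processes.

Section correlations_and_palm.
Context {R : realType} {d : measure_display} {W : measurableType d}.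
Local Notation RT := (measurableTypeR R).
Local Notation mu := (@lebesgue_measure R).
Local Notation mu2 := (mu \x mu)%E.
Variables (P : probability W R) (Z : W -> Omega R).

(* The factorial measures xi^[1] and xi^[2] of xi = Xi (Z w) are the sums of
   the Dirac masses at [Z w i] for i in [pos_idx (Z w)], resp. at
   [(Z w p.1, Z w p.2)] for p in [pos_pairs (Z w)]. *)
Definition correlation_function1 (r1 : RT -> R) : Prop :=
  [/\ measurable_fun (half_line R) r1, forall x, 0 < x -> 0 <= r1 x
    & forall A : set RT, measurable A -> A `<=` half_line R ->
      (\int[P]_w \int[counting]_(i in pos_idx (Z w)) \d_(Z w i) A
       = \int[mu]_(x in A) (r1 x)%:E)%E].

Definition correlation_function2 (r2 : RT * RT -> R) : Prop :=
  [/\ measurable_fun (quadrant R) r2,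
      forall x, 0 < x.1 -> 0 < x.2 -> 0 <= r2 x
    & forall A : set (RT * RT), measurable A ->
      A `<=` quadrant R ->
      (\int[P]_w \int[counting]_(p in pos_pairs (Z w))
         \d_((Z w p.1, Z w p.2) : RT * RT) A
       = \int[mu2]_(x in A) (r2 x)%:E)%E].

Definition palm1 (r1 : RT -> R) (P1 : R.-pker RT ~> config R) : Prop :=
  forall G : RT * config R -> R, measurable_fun setT G ->
    (forall u, 0 <= G u) -> (exists C, forall u, G u <= C) ->
    (\int[P]_w \int[counting]_(i in pos_idx (Z w)) (G (Z w i, Xi (Z w)))%:E
     = \int[mu]_(x in half_line R)
         ((r1 x)%:E * \int[P1 x]_eta (G (x, add_point eta x))%:E))%E.

Definition palm2 (r2 : RT * RT -> R)
    (P2 : R.-pker (RT * RT)%type ~> config R) : Prop :=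
  forall G : (RT * RT) * config R -> R, measurable_fun setT G ->
    (forall u, 0 <= G u) -> (exists C, forall u, G u <= C) ->
    (\int[P]_w \int[counting]_(p in pos_pairs (Z w))
       (G ((Z w p.1, Z w p.2), Xi (Z w)))%:E
     = \int[mu2]_(x in quadrant R)
         ((r2 x)%:E * \int[P2 x]_eta
            (G (x, add_point (add_point eta x.1) x.2))%:E))%E.

End correlations_and_palm.

Section poisson_dirichlet.
Context {R : realType}.
Local Notation RT := (measurableTypeR R).
Local Notation mu := (@lebesgue_measure R).

Definition poisson_process (d : measure_display) (W : measurableType d)
    (Q : probability W R) (N : W -> config R) (Lam : set RT -> \bar R) : Prop :=
  forall (n : nat) (B : 'I_n -> set RT) (k : 'I_n -> nat),
    (forall i, measurable (B i)) ->
    (forall i, B i `<=` half_line R) ->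
    trivIset setT B -> (forall i, Lam (B i) < +oo)%E ->
    Q [set w | forall i, N w (B i) = (k i)%:R%:E] =
    (\prod_(i < n)
       (expR (- fine (Lam (B i))) * fine (Lam (B i)) ^+ k i / (k i)`!%:R))%:E.

Definition PD_intensity (theta : R) (B : set RT) : \bar R :=
  (\int[mu]_(y in B) (theta * y^-1 * expR (- y))%:E)%E.

(* A random element [Y] of [Omega] is the sequence of the ranked points of the
   point process [Xi \o Y]. *)
Definition PD (theta : R) (nu : set (Omega R) -> \bar R) : Prop :=
  exists (d : measure_display) (W : measurableType d) (Q : probability W R)
    (Y : W -> Omega R),
  [/\ measurable_fun setT Y,
      poisson_process Q (Xi \o Y) (PD_intensity theta)
    & forall A, measurable A -> nu A = pushforward Q (normalize \o Y) A].

Definition independent (d d1 d2 : measure_display) (W : measurableType d)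
    (T1 : measurableType d1) (T2 : measurableType d2) (P : probability W R)
    (X1 : W -> T1) (X2 : W -> T2) : Prop :=
  forall A1 A2, measurable A1 -> measurable A2 ->
    P (X1 @^-1` A1 `&` X2 @^-1` A2) = (P (X1 @^-1` A1) * P (X2 @^-1` A2))%E.

End poisson_dirichlet.

(* Main.v *)
(* Write A = |z|^-(2+lam) L for the normalized generator.  It is bounded, so the
   semigroup is the power series of A; if A is symmetric for the law of Z and
   commutes with multiplication by functions of |z|, the same holds for exp (t A),
   and the Markov property makes the process run by A, jointly with |Z(0)|,
   reversible.  The time change has speed |Z(0)|^(2+lam), constant along the
   paths; it is approximated by dyadic speeds, using right continuity.

   Symmetry of A follows from the detailed balance
     E sum_(i <> j) c K(z_i,z_j) h(z, M_ij z)
       = E sum_i int_0^(z_i) c F(y, z_i - y) h(S_i^y z, z) dy,  c = |z|^-(2+lam),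
   for all h >= 0.  By uniqueness of finite measures it is enough to take for h
   indicators of products of sets {z | #{i | z_i > t} = k for (t, k) in l}, which
   generate the Borel sets of Omega.  The counts #{i | z_i > t} and the mass are
   functionals of Xi z, additive under adding a point, so that both sides are
   Palm integrals; these agree by hypothesis after the substitution
   (t, y) -> (t - y, y).

   For the Poisson process Y of intensity r(x) = theta e^-x / x, Mecke's formula
   says that the correlation functions are r(x) and r(x) r(y) and that the Palm
   distributions are the law of Y.  As x y H r(x) r(y) = (x + y) theta H r(x + y),
   the argument above applies to Y.  Since A commutes with dilations and only
   compares states of equal mass, symmetry passes to Y / |Y| (use test functions
   of z / |z|), and then to V X by conditioning on V. *)

(* The tools at hand are for nonnegative or bounded functions, while the generator is signed and the
   rates are unbounded. Bounded functions are therefore shifted by a bound, which turns the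
   generator into a gain minus a loss, each within reach of Tonelli's theorem.

   Palm formulas are available for bounded functionals only. The chosen points weigh at most the
   total mass m, and once this constraint is written into the functional, c K is at most m^-(2+lam)
   m^2 m^lam sup H. A configuration drawn from a Palm distribution may have infinite mass; there c
   takes the value 0 by convention, and this value makes the constraint cost nothing.

   Part (i) lives on configurations, whereas the Poisson process of part (ii) is handled directly on
   Omega; the common argument is written over an abstract space with counts, mass and addition of a
   point. For pairs of Poisson points, Mecke's formula is used twice and the diagonal is cancelled,
   which requires the diagonal to be integrable: hence the growth condition imposed on the
   functionals of two points. *)
From HB Require Import structures.
From Pilot Require Import Defs.
From mathcomp Require Import all_boot all_order all_algebra finmap.
From mathcomp Require Import all_classical all_reals all_analysis measurable_realfun.
From mathcomp Require Import ring lra.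

Set Implicit Arguments.
Unset Strict Implicit.
Unset Printing Implicit Defensive.
Import Order.TTheory GRing.Theory Num.Theory.
Import numFieldNormedType.Exports.

Local Open Scope classical_set_scope.
Local Open Scope ring_scope.

Local Notation merge := Pilot.Defs.merge.
Local Notation split := Pilot.Defs.split.

(** * Borel sets of Omega *)

Section omega_borel.
Context {R : realType}.
Local Notation RT := (measurableTypeR R).

Lemma continuous_coordinate i : continuous (fun z : Omega R => z i).
Proof.
move=> z.
have c : continuous (sizes : Omega R -> {ptws nat -> R}) by exact: (@initial_continuous _ _ (set_val : Omega_set R -> {ptws nat -> R})).
apply: (@continuous_comp (Omega R) {ptws nat -> R} R sizes (fun w => w i) z).
  exact: c.
exact: (@proj_continuous nat (fun=> R) i).
Qed.

Lemma open_measurable_Omega (U : set (Omega R)) : open U -> measurable U.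
Proof. by move=> oU; exact: sub_sigma_algebra. Qed.

Lemma measurable_coordinate i : measurable_fun setT (fun z : Omega R => z i).
Proof.
apply: (@measurability _ _ _ R setT _ (@RGenOpens.G R)).
  exact: RGenOpens.measurableE.
move=> _ [_ [x [y ->]] <-]; rewrite setTI; apply: open_measurable_Omega.
by apply: open_comp => // z _; exact: continuous_coordinate.
Qed.

(** Rational endpoints make the boxes countably many, so that an open set is a countable union of
    them. *)
Definition box (s : seq (nat * (rat * rat))) : set (nat -> R) :=
  [set w | all (fun p => (ratr p.2.1 < w p.1) && (w p.1 < ratr p.2.2)) s].

Lemma open_rat_itv (O : set R) (x : R) : open O -> O x ->
  exists q : rat * rat, [/\ ratr q.1 < x, x < ratr q.2 &
     forall y : R, ratr q.1 < y -> y < ratr q.2 -> O y].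
Proof.
move=> oO Ox.
have : nbhs x O by exact: open_nbhs_nbhs.
move=> /nbhs_ballP [e /= e0 eO].
have [q1 /[!in_itv]/= /andP[q1l q1r]] := @rat_in_itvoo R (x - e) x ltac:(lra).
have [q2 /[!in_itv]/= /andP[q2l q2r]] := @rat_in_itvoo R x (x + e) ltac:(lra).
exists (q1, q2); split => //= y y1 y2; apply: eO; rewrite /ball/=.
by rewrite ltr_norml; apply/andP; split; lra.
Qed.

Lemma open_ptws_box (V : set {ptws nat -> R}) (w : nat -> R) :
  open V -> V w -> exists2 s, box s w & box s `<=` V.
Proof.
move=> oV Vw.
(* An open set of the product topology is a union of finite intersections of preimages of open sets
   by coordinates; one rational interval is chosen for each member of the intersection that contains
   [w]. *)
case: oV => /= F Fs FV.
move: Vw; rewrite -FV => -[B FB Bw].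
have [D Dsub DB] := Fs _ FB.
have st (A : set (nat -> R)) : A \in D -> exists p : nat * (rat * rat),
   box [:: p] w /\ box [:: p] `<=` A.
  move=> AD; have := Dsub _ AD; move=> /set_mem; case=> i _; case=> O oO OA.
  move: OA => /= OA.
  have Aw : A w by move: Bw; rewrite -DB; apply.
  have Ow : O (w i) by move: Aw; rewrite -OA.
  have [q [q1 q2 qO]] := open_rat_itv oO Ow.
  exists (i, q); split; first by rewrite /box/= q1 q2.
  by move=> v; rewrite /box/= -OA andbT => /andP[v1 v2]; exact: qO.
pose g (A : set (nat -> R)) := if pselect (A \in D) is left AD then projT1 (cid (st A AD)) else (0%N, (0, 0)).
exists [seq g A | A <- enum_fset D].
- rewrite /box/=; apply/allP => p /mapP[A AD ->].
  rewrite /g; case: pselect => // AD'; case: cid => p' [/= + _].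
  by rewrite /box/= andbT.
- move=> v /allP bv; exists B => //; rewrite -DB => A AD.
  have := bv _ (map_f g AD); rewrite /g; case: pselect => // AD'.
  case: cid => p' [/= _ pA] pv; apply: pA; by rewrite /box /= pv.
Qed.

Lemma open_boxE (U : set (Omega R)) : open U ->
  exists V : set {ptws nat -> R}, open V /\ U = [set z : Omega R | V z].
Proof.
move=> [V oV <-]. by exists V; split.
Qed.

Lemma bigcup_countType_measurable d (T : measurableType d) (I : countType) (D : set I)
   (F : I -> set T) : (forall i, D i -> measurable (F i)) -> measurable (\bigcup_(i in D) F i).
Proof.
move=> mF; rewrite bigcup_mkcond; apply: countable_bigcupT_measurable => [|i].
  exact: countableP.
case: ifP => [|_]; last exact: measurable0.
by rewrite inE; exact: mF.
Qed.

(** The preimage of an open set is the union, over the countably many rational boxes contained in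
    it, of sets that involve finitely many coordinates each. *)
Lemma measurable_fun_Omega d (W : measurableType d) (D : set W) (f : W -> Omega R) :
  (forall i, measurable_fun D (fun w => f w i)) -> measurable_fun D f.
Proof.
move=> mf mD; apply: (measurability (@open (Omega R))) => // _ [U /open_boxE[V [oV ->]] <-].
rewrite [X in measurable X](_ : _ = \bigcup_(s in [set s | box s `<=` V]) (D `&` [set w | box s (f w)])).
  apply: bigcup_countType_measurable => s _.
  elim: s => [|p s IH].
    rewrite [X in measurable X](_ : _ = D) //; by apply/seteqP; split=> [x []|x Dx].
  rewrite [X in measurable X](_ : _ = (D `&` (fun w => f w p.1) @^-1` `](ratr p.2.1), (ratr p.2.2)[%classic)
     `&` (D `&` [set w | box s (f w)])).
    apply: measurableI => //; exact: mf.
  apply/seteqP; split=> x /=.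
    by rewrite /box/= in_itv/= => -[Dx] /andP[h1 h2].
  by rewrite /box/= in_itv/= => -[[Dx h1] [_ h2]]; rewrite h1 h2.
apply/seteqP; split => x /=.
  move=> [Dx Vx]; have [s sx sV] := open_ptws_box oV Vx; by exists s.
by move=> [s /= sV [Dx sx]]; split => //; exact: sV.
Qed.

End omega_borel.

(** * Additive functionals of a ranked sequence *)

Section gsum.
Context {R : realType}.
Implicit Types (w : nat -> R) (z : Omega R) (g : R -> \bar R).
Local Open Scope ereal_scope.

(** The mass, the counts above a level and the number of points in a set are all of this form, so
    their behaviour under merging, splitting and adding a point is settled once. *)
Definition gsum g w := \sum_(0 <= k <oo) g (w k).

Lemma gsum_recl g w : (forall x, 0 <= g x) ->
  gsum g w = g (w 0%N) + gsum g (fun k => w k.+1).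
Proof.
move=> g0; rewrite /gsum nneseries_recl//; congr (_ + _).
rewrite -(@nneseries_addn _ (fun k => g (w k)) 1)//.
by apply: eq_eseriesr => k _; rewrite addn1.
Qed.

Lemma gsum_ge0 g w : (forall x, 0 <= g x) -> 0 <= gsum g w.
Proof. by move=> g0; apply: nneseries_ge0. Qed.

Lemma gsum_del g i w : (forall x, 0 <= g x) ->
  gsum g w = g (w i) + gsum g (del i w).
Proof.
move=> g0; elim: i w => [|i IH] w; rewrite gsum_recl//.
rewrite [in RHS]gsum_recl// addeCA; congr (_ + _).
by rewrite (IH (fun k => w k.+1)).
Qed.

Definition nonincr w := forall k, (w k.+1 <= w k)%R.
Definition nonneg w := forall k, (0 <= w k)%R.
(** For a nonincreasing sequence this is what gives every positive [y] a finite rank in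
    [ins y w]. *)
Definition tends0 w := forall y : R, (0 < y)%R -> exists N, (w N < y)%R.

(** If [y] exceeds the head, insertion is a shift; otherwise the head stays and [y] is inserted in
    the tail, whence the induction on an index with [w N < y]. Positivity of [y] matters: 0 has no
    rank in a positive sequence and is lost by [ins]. *)
Lemma gsum_ins g y w : (forall x, 0 <= g x) -> nonincr w -> tends0 w ->
  (0 < y)%R -> gsum g (ins y w) = g y + gsum g w.
Proof.
move=> g0 wd /[apply] -[N].
have base u : nonincr u -> (u 0%N < y)%R -> gsum g (ins y u) = g y + gsum g u.
  move=> {}wd wN; rewrite gsum_recl//; congr (g _ + _).
    by rewrite /ins leNgt wN.
  apply: eq_eseriesr => k _; congr g; rewrite /ins /=.
  have wk : (u k < y)%R.
    by elim: k => // k IH; exact: le_lt_trans (wd _) IH.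
  by rewrite leNgt (le_lt_trans (wd k) wk)//= leNgt wk.
elim: N w wd => [|N IH] w wd wN; first exact: base.
have [w0y|w0y] := ltP (w 0%N) y; first exact: base.
rewrite gsum_recl// [gsum g w]gsum_recl// addeCA /ins w0y; congr (_ + _).
rewrite -(IH (fun k => w k.+1)) => [|k|//]; last exact: wd.
apply: eq_eseriesr => -[_|k _]; congr g; rewrite /ins//=.
by rewrite w0y; case: ifP.
Qed.

Lemma nonincr_del i w : nonincr w -> nonincr (del i w).
Proof.
move=> wd k; rewrite /del; case: (ltnP k.+1 i) => [/ltnW ->//|].
by case: ltnP => // _ _; exact: le_trans (wd _) (wd _).
Qed.

Lemma tends0_del i w : nonincr w -> tends0 w -> tends0 (del i w).
Proof.
move=> wd w0 y /w0[N wN]; exists N; rewrite /del; case: ifP => // _.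
exact: le_lt_trans wN.
Qed.

Lemma nonincr_ins y w : nonincr w -> nonincr (ins y w).
Proof.
move=> wd k; rewrite /ins /=; have wk := wd k.
case: (leP y (w k)) => yk; first by case: ifP.
rewrite (lt_geF (le_lt_trans wk yk))/=.
case: k wk yk => [|k] wk yk /=; first exact: ltW.
case: ifP => _; exact: ltW || exact: wd.
Qed.

Lemma nonneg_ins y w : (0 <= y)%R -> nonneg w -> nonneg (ins y w).
Proof. by move=> y0 w0 k; rewrite /ins; case: ifP => // _; case: ifP. Qed.

Lemma tends0_ins y w : nonincr w -> (0 < y)%R -> tends0 w -> tends0 (ins y w).
Proof.
move=> wd y0 w0 x x0.
have : (0 < Order.min x y)%R by rewrite lt_min x0 y0.
move=> /w0[N]; rewrite lt_min => /andP[wx wy]; exists N.+1; rewrite /ins /=.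
by rewrite leNgt (le_lt_trans (wd N) wy)/= leNgt wy.
Qed.

Lemma Omega_nonincr z : nonincr z. Proof. by have [] := OmegaP z. Qed.

Lemma Omega_nonneg z : nonneg z. Proof. exact: Omega_ge0. Qed.

Lemma Omega_le z m n : (m <= n)%N -> (z n <= z m)%R.
Proof.
move=> /subnK <-; elim: (n - m)%N => // d; exact: le_trans (Omega_nonincr _ _).
Qed.

Lemma Omega_tends0 z : tends0 z.
Proof.
move=> y y0; have [_ z0 /andP[_ zoo]] := OmegaP z.
have /cvg_series_cvg_0 z_0 := nnseries_is_cvg z0 zoo.
have : \forall n \near \oo, (`|0 - z n| < y)%R.
  by move/cvgrPdist_lt : z_0; apply.
case=> N _ /(_ N (leqnn N)) /=; rewrite sub0r normrN ger0_norm// => zN.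
by exists N.
Qed.

(** The lost terms are added on the left instead of subtracted on the right, since the sums may be
    infinite. *)
Lemma gsum_merge g i j z : (forall x, 0 <= g x) -> i != j ->
  (0 < z i)%R -> (0 < z j)%R ->
  gsum g (merge i j z) + (g (z i) + g (z j)) = gsum g z + g (z i + z j)%R.
Proof.
move=> g0 ij zi zj; rewrite mergeE// /merge_seq.
have zd := @Omega_nonincr z; have zt := @Omega_tends0 z.
rewrite gsum_ins//; last 3 first.
- by do 2!apply: nonincr_del.
- by apply: tends0_del; [exact: nonincr_del|exact: tends0_del].
- exact: addr_gt0.
rewrite (@gsum_del g (maxn i j) z)// (@gsum_del g (minn i j) (del (maxn i j) z))//.
set S := gsum g _.
have -> : del (maxn i j) z (minn i j) = z (minn i j).
  rewrite /del; move: ij; rewrite /maxn /minn.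
  by case: (ltngtP i j) => [ij|ij|->]; rewrite ?ij ?eqxx.
have -> : g (z i) + g (z j) = g (z (maxn i j)) + g (z (minn i j)).
  by rewrite /maxn /minn; case: ltngtP => [_|_|->]; rewrite 1?addeC.
by rewrite [RHS]addeC -addeA; congr (_ + _); rewrite addeC -addeA.
Qed.

Lemma gsum_split g i y z : (forall x, 0 <= g x) -> (0 < y < z i)%R ->
  gsum g (split i y z) + g (z i) = gsum g z + (g y + g (z i - y)%R).
Proof.
move=> g0 /andP[y0 yz]; rewrite splitE ?(ltW y0) ?ltW// /split_seq.
have zd := @Omega_nonincr z; have zt := @Omega_tends0 z.
have u0 : (0 < z i - y)%R by rewrite subr_gt0.
rewrite gsum_ins//; last 2 first.
- by apply: nonincr_ins; exact: nonincr_del.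
- by apply: tends0_ins => //; [exact: nonincr_del|exact: tends0_del].
rewrite gsum_ins//; [|exact: nonincr_del|exact: tends0_del].
rewrite (@gsum_del g i z)//.
by rewrite [X in X + _ = _]addeA -[LHS]addeA [LHS]addeC [X in X + _ = _]addeC.
Qed.

(** The counterpart of [add_point] on [Omega]. The explicit test decides when [insubd] succeeds,
    which makes the joint measurability in [x] and [z] elementary. *)
Definition padd (x : R) z : Omega R := if (0 <= x)%R then insubd z (ins x z) else z.

Lemma ins0 w : nonneg w -> ins 0 w = w.
Proof. by move=> w0; apply/funext => k; rewrite /ins w0. Qed.

Lemma padd_subproof x z : (0 <= x)%R -> Omega_set R (ins x z).
Proof.
have zd := @Omega_nonincr z; have zt := @Omega_tends0 z.
rewrite le_eqVlt => /predU1P[<-|x0].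
  by rewrite ins0//; [exact: OmegaP|exact: Omega_nonneg].
split.
- exact: nonincr_ins.
- by apply: nonneg_ins; [exact: ltW|exact: Omega_nonneg].
(* [gsum_ins] asks for a function nonnegative on the whole line, hence the truncation of the
   identity. *)
pose g := fun x : R => (Num.max x 0)%:E.
have g0 : forall x, 0 <= g x by move=> y; rewrite lee_fin le_max lexx orbT.
have e (w : nat -> R) : nonneg w -> \sum_(0 <= k <oo) (w k)%:E = gsum g w.
  by move=> w0; apply: eq_eseriesr => k _; rewrite /g max_l.
rewrite e; last by apply: nonneg_ins; [exact: ltW|exact: Omega_nonneg].
rewrite gsum_ins// -(e z); last exact: Omega_nonneg.
rewrite massE /g max_l; last exact: ltW.
by rewrite -EFinD ltry lte_fin addr_gt0// mass_gt0.
Qed.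

Lemma paddE x z : (0 <= x)%R -> padd x z = ins x z :> (nat -> R).
Proof.
move=> x0; rewrite /padd x0; apply: insubdK; exact/mem_set/padd_subproof.
Qed.

Lemma gsum_padd g x z : (forall x, 0 <= g x) -> (0 < x)%R ->
  gsum g (padd x z) = gsum g z + g x.
Proof.
move=> g0 x0; rewrite paddE; last exact: ltW.
by rewrite gsum_ins ?[g x + _]addeC//; [exact: Omega_nonincr|exact: Omega_tends0].
Qed.

Lemma gsum_mass z : gsum (fun x => (Num.max x 0)%:E) z = (mass z)%:E.
Proof.
rewrite -massE; apply: eq_eseriesr => k _; rewrite max_l//; exact: Omega_ge0.
Qed.

Lemma mass_padd x z : (0 < x)%R -> mass (padd x z) = (mass z + x)%R.
Proof.
move=> x0; apply: EFin_inj; rewrite -gsum_mass gsum_padd//.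
- by rewrite gsum_mass max_l// ltW.
- by move=> y; rewrite lee_fin le_max lexx orbT.
Qed.

Definition cnt (t : R) : (nat -> R) -> \bar R := gsum (fun x => (t < x)%R%:R%:E).

Lemma cntE t z N : (z N <= t)%R ->
  cnt t z = (\sum_(0 <= k < N) (t < z k)%R)%:R%:E.
Proof.
move=> zN; rewrite /cnt /gsum (nneseries_split 0 N) => [|k _]; last by rewrite lee_fin.
rewrite add0n [X in (_ + X)]eseries0 ?adde0 => [|k Nk _]; last first.
  by rewrite ltNge (le_trans (Omega_le z Nk) zN).
by rewrite natr_sum -sumEFin.
Qed.

Lemma cnt_nat t z : (0 < t)%R -> exists n : nat, cnt t z = n%:R%:E.
Proof.
by move=> /(@Omega_tends0 z)[N zN]; eexists; rewrite (@cntE t z N)// ltW.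
Qed.

(** By monotonicity the entries above [t] are the first ones, so counts and coordinates determine
    each other. The successor is due to the indexing from 0. *)
Lemma cnt_gt t z i : (t < z i)%R = (i.+1%:R%:E <= cnt t z).
Proof.
apply/idP/idP => [tz|].
  rewrite /cnt /gsum (nneseries_split 0 i.+1) => [|k _]; last by rewrite lee_fin.
  rewrite -[leLHS]adde0 add0n; apply: leeD; last first.
    by apply: nneseries_ge0 => k _ _; rewrite lee_fin.
  rewrite sumEFin lee_fin -natr_sum ler_nat.
  rewrite -[leqLHS]muln1 -[X in (X * _)%N]subn0 -sum_nat_const_nat.
  rewrite big_nat [leqRHS]big_nat; apply: leq_sum => k /andP[_ ki].
  by rewrite (lt_le_trans tz)// Omega_le.
apply: contraTT; rewrite -leNgt -ltNge => tz.
rewrite (cntE tz) lte_fin ltr_nat ltnS.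
rewrite -[leqRHS]muln1 -[X in (_ <= X * _)%N]subn0 -sum_nat_const_nat.
by apply: leq_sum => k _; exact: leq_b1.
Qed.

End gsum.

(** * Measurable operations on states, and the sets that generate the Borel sets *)

Section omega_measurable.
Context {R : realType}.
Local Notation RT := (measurableTypeR R).

Lemma measurable_gsum d (W : measurableType d) (g : RT -> \bar R) (f : W -> Omega R) :
  (forall x, 0 <= g x)%E -> measurable_fun [set: RT] g ->
  measurable_fun setT f -> measurable_fun setT (fun w => gsum g (f w)).
Proof.
move=> g0 mg mf; apply: ge0_emeasurable_sum => // k _.
apply: (measurableT_comp mg); apply: (measurableT_comp (measurable_coordinate k) mf).
Qed.

Lemma measurable_max0 : measurable_fun setT (fun x : RT => (Num.max x 0)%:E : \bar R).
Proof. by apply/measurable_EFinP; apply: measurable_maxr. Qed.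

Lemma measurable_mass : measurable_fun setT (mass : Omega R -> R).
Proof.
rewrite (_ : mass = fine \o (fun z => gsum (fun x => (Num.max x 0)%:E) z)).
  apply: measurableT_comp => //; apply: measurable_gsum => //.
    by move=> y; rewrite lee_fin le_max lexx orbT.
  exact: measurable_max0.
by apply/funext => z /=; rewrite gsum_mass.
Qed.

Lemma measurable_gtind (t : R) : measurable_fun setT (fun x : RT => (t < x)%R%:R%:E : \bar R).
Proof.
apply/measurable_EFinP; rewrite (_ : (fun _ => _) = \1_(`]t, +oo[%classic : set RT)).
  exact: measurable_indic.
by apply/funext => x; rewrite indicE; congr (_%:R); rewrite [in RHS]mem_setE in_itv/= andbT.
Qed.

Lemma measurable_cnt t : measurable_fun setT (fun z : Omega R => cnt t z).
Proof.
apply: measurable_gsum => //; exact: measurable_gtind.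
Qed.

Lemma measurable_ins d (W : measurableType d) (y : W -> R) (w : W -> nat -> R) :
  measurable_fun setT y -> (forall k, measurable_fun setT (fun x => w x k)) ->
  forall k, measurable_fun setT (fun x => ins (y x) (w x) k).
Proof.
move=> my mw k; rewrite /ins; apply: measurable_fun_ifT => //.
  exact: measurable_fun_ler.
apply: measurable_fun_ifT => //.
by case: (k == 0%N) => //=; apply: measurable_fun_ler.
Qed.

(** Outside their intended range the raw operations depend on whether [insubd] happens to succeed;
    the total versions [omerge], [osplit] and [oscale] are the identity there, with explicit
    coordinates everywhere. *)
Definition omerge i j (z : Omega R) := if i != j then merge i j z else z.

Lemma measurable_omerge i j : measurable_fun setT (omerge i j).
Proof.
rewrite /omerge; case: eqVneq => //= ij; apply: measurable_fun_Omega => k.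
under eq_fun do rewrite mergeE//.
have md i' (w : Omega R -> nat -> R) : (forall k, measurable_fun setT (fun x => w x k)) ->
   (forall k, measurable_fun setT (fun x => del i' (w x) k)).
  by move=> mw k'; rewrite /del; case: (k' < i')%N.
apply: measurable_ins.
- by apply: measurable_funD; exact: measurable_coordinate.
- exact: (md _ _ (md _ _ measurable_coordinate)).
Qed.

Definition osplit i y (z : Omega R) := if 0 <= y <= z i then split i y z else z.

Lemma measurable_osplit i : measurable_fun setT (fun p : RT * Omega R => osplit i p.1 p.2).
Proof.
apply: measurable_fun_Omega => k.
have mc k' : measurable_fun setT (fun p : RT * Omega R => p.2 k').
  exact: (measurableT_comp (measurable_coordinate k')).
have m1 : measurable_fun setT (fun p : RT * Omega R => p.1 : R).
  exact: measurable_fst.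
rewrite (_ : (fun _ => _) = fun p : RT * Omega R =>
   if 0 <= p.1 <= p.2 i then split_seq i p.1 p.2 k else p.2 k); last first.
  by apply/funext => p; rewrite /osplit; case: ifPn => // h; rewrite splitE.
apply: measurable_fun_ifT => //.
  apply: measurable_and; apply: measurable_fun_ler => //.
apply: measurable_ins => //; apply: measurable_ins.
  by apply: measurable_funB.
by move=> k'; rewrite /del; case: (k' < i)%N.
Qed.

Lemma measurable_padd : measurable_fun setT (fun p : RT * Omega R => padd p.1 p.2).
Proof.
apply: measurable_fun_Omega => k.
have mc k' : measurable_fun setT (fun p : RT * Omega R => p.2 k').
  exact: (measurableT_comp (measurable_coordinate k')).
have m1 : measurable_fun setT (fun p : RT * Omega R => p.1 : R).
  exact: measurable_fst.
rewrite (_ : (fun _ => _) = fun p : RT * Omega R =>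
   if 0 <= p.1 then ins p.1 p.2 k else p.2 k); last first.
  apply/funext => p; case: ifPn => h; first by rewrite paddE.
  by rewrite /padd (negbTE h).
apply: measurable_fun_ifT => //; first by apply: measurable_fun_ler.
exact: measurable_ins.
Qed.

Definition oscale v (z : Omega R) := if 0 < v then scale v z else z.

Lemma measurable_oscale : measurable_fun setT (fun p : RT * Omega R => oscale p.1 p.2).
Proof.
apply: measurable_fun_Omega => k.
have mc k' : measurable_fun setT (fun p : RT * Omega R => p.2 k').
  exact: (measurableT_comp (measurable_coordinate k')).
have m1 : measurable_fun setT (fun p : RT * Omega R => p.1 : R).
  exact: measurable_fst.
rewrite (_ : (fun _ => _) = fun p : RT * Omega R =>
   if 0 < p.1 then p.1 * p.2 k else p.2 k); last first.
  by apply/funext => p; rewrite /oscale; case: ifPn => h //; rewrite scaleE.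
apply: measurable_fun_ifT => //; first by apply: measurable_fun_ltr.
exact: measurable_funM.
Qed.

Definition cyl (l : seq (R * nat)) : set (Omega R) :=
  [set z | all (fun p => cnt p.1 z == p.2%:R%:E) l].

(** Only positive levels: there the counts are finite, whereas the count above 0 may be infinite. *)
Definition cylinders : set (set (Omega R)) :=
  [set cyl l | l in [set l | all (fun p : R * nat => 0 < p.1) l]].

Lemma cylI l1 l2 : cyl l1 `&` cyl l2 = cyl (l1 ++ l2).
Proof.
by apply/seteqP; split=> z /=; rewrite /cyl/= all_cat => /andP.
Qed.

Lemma cylinders_setI : setI_closed cylinders.
Proof.
move=> _ _ [l1 l1p <-] [l2 l2p <-]; rewrite cylI; exists (l1 ++ l2) => //=.
by rewrite all_cat l1p.
Qed.

Lemma cyl_nil : cyl [::] = setT. Proof. by apply/seteqP; split. Qed.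

Lemma cylinders_setT : cylinders setT.
Proof. by exists [::] => //; rewrite cyl_nil. Qed.

Lemma cylinders_measurable : cylinders `<=` measurable.
Proof.
move=> _ [l lp <-]; elim: l lp => [_|p l IH /= /andP[p0 /IH ml]].
  by rewrite cyl_nil.
rewrite [X in measurable X](_ : _ = ((fun z : Omega R => cnt p.1 z) @^-1` [set p.2%:R%:E]) `&` cyl l).
  apply: measurableI => //; rewrite -[X in measurable X]setTI.
  by apply: (@measurable_cnt p.1) => //; exact: emeasurable_set1.
apply/seteqP; split=> z /=; rewrite /cyl/=; first by move=> /andP[/eqP].
by move=> [/eqP -> ->].
Qed.

(** For [a >= 0], [z i] exceeds [a] exactly when, for some rational [q > a] and some [n > i], there
    are [n] entries above [q]. So the coordinates are measurable for the generated sigma-algebra. *)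
Lemma measurable_cylinders : @measurable _ (Omega R) = <<s cylinders >>.
Proof.
apply/seteqP; split; last first.
  apply: smallest_sub; first exact: sigma_algebra_measurable.
  exact: cylinders_measurable.
pose GT := g_sigma_algebraType cylinders.
have mid : measurable_fun setT (id : GT -> Omega R).
  apply: measurable_fun_Omega => i.
  apply: (@measurability _ _ GT R setT _ (@RGenOInfty.G R)).
    exact: RGenOInfty.measurableE.
  move=> _ [_ [a ->] <-]; rewrite setTI.
  have [a0|a0] := ltP a 0.
    rewrite [X in measurable X](_ : _ = setT) //; apply/seteqP; split => // z _ /=.
    by rewrite in_itv/= andbT; apply: lt_le_trans a0 _; exact: Omega_ge0.
  rewrite [X in measurable X](_ : _ = \bigcup_(q in [set q : rat | a < ratr q])
      \bigcup_(n in [set n : nat | (i < n)%N]) (cyl [:: (ratr q, n)] : set GT)).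
    apply: bigcup_countType_measurable => q /= aq.
    apply: bigcup_measurable => n _; apply: sub_sigma_algebra.
    by exists [:: (ratr q, n)] => //=; rewrite andbT (le_lt_trans a0 aq).
  apply/seteqP; split => z /=.
    rewrite in_itv/= andbT => az.
    have [q /[!in_itv]/= /andP[aq qz]] := rat_in_itvoo az.
    have [n zn] := @cnt_nat R (ratr q) z (le_lt_trans a0 aq).
    exists q => //; exists n; last by rewrite /cyl/= zn eqxx.
    by move: qz; rewrite cnt_gt zn lee_fin ler_nat.
  move=> [q /= aq] [n /= ni]; rewrite /cyl/= andbT => /eqP zq.
  rewrite in_itv/= andbT (lt_trans aq)// cnt_gt zq lee_fin ler_nat//.
move=> A mA; have := mid measurableT A mA; by rewrite setTI preimage_id.
Qed.

End omega_measurable.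

(** * Symmetric bounded operators and reversibility *)

Section bounded_integrals.
Context d (W : measurableType d) (R : realType) (P : probability W R).

Lemma bounded_integrable (E : set W) (f : W -> R) (C : R) : measurable E ->
  measurable_fun E f -> (forall w, `|f w| <= C) -> P.-integrable E (EFin \o f).
Proof.
move=> mE mf fC.
apply: (@le_integrable _ _ _ P E mE _ (EFin \o cst C)) => //.
- exact/measurable_EFinP.
- by move=> w _ /=; rewrite lee_fin (le_trans (fC w))// ler_norm.
by apply: finite_measure_integrable_cst.
Qed.

Lemma bounded_Rintegral_cvg (E : set W) (f : nat -> W -> R) (g : W -> R) (C : R) : measurable E ->
  (forall n, measurable_fun E (f n)) -> (forall n w, `|f n w| <= C) ->
  (forall w, f n w @[n --> \oo] --> g w) ->
  (\int[P]_(w in E) f n w) @[n --> \oo] --> \int[P]_(w in E) g w.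
Proof.
move=> mE mf fC fg.
have gC w : `|g w| <= C.
  have h : `|f n w| @[n --> \oo] --> `|g w| by apply: cvg_norm; exact: fg.
  by apply: (cvgr_to_le h); exact: nearW.
have mg : measurable_fun E g by apply: (measurable_fun_cvg mf) => w _; exact: fg.
apply: fine_cvg; rewrite fineK; last first.
  by apply: integrable_fin_num => //; exact: bounded_integrable gC.
apply: (@dominated_cvg _ _ _ P E mE (fun n w => (f n w)%:E) (EFin \o g) (EFin \o cst C)) => //=.
- by move=> n; exact/measurable_EFinP.
- by move=> w _; apply: cvg_EFin; [exact: nearW|exact: fg].
- exact: finite_measure_integrable_cst.
- by move=> n w _; rewrite lee_fin.
Qed.

Lemma Rintegral_indicr (E F : set W) (f : W -> R) : measurable E -> measurable F ->
  \int[P]_(w in E) (\1_F w * f w) = \int[P]_(w in E `&` F) f w.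
Proof.
move=> mE mF; rewrite Rintegral_mkcondr; apply: eq_Rintegral => w _.
rewrite patchE indicE; case: (w \in F); by rewrite ?mul1r ?mul0r.
Qed.

End bounded_integrals.

Section bounded_borel_theory.
Context {R : realType}.
Implicit Types Phi Psi : Omega R -> R.

Lemma bounded_borelM Phi Psi : bounded_borel Phi -> bounded_borel Psi ->
  bounded_borel (fun z => Phi z * Psi z).
Proof.
move=> [mf [C fC]] [mg [D gD]]; split; first exact: measurable_funM.
by exists (C * D) => z; rewrite normrM ler_pM.
Qed.

Lemma bounded_borel_indic (B : set (Omega R)) : measurable B -> bounded_borel (\1_B).
Proof.
move=> mB; split; first exact: measurable_indic.
exists 1 => z; rewrite indicE; case: (_ \in _); by rewrite ?normr1 ?normr0.
Qed.

Lemma bounded_borel_cst (c : R) : bounded_borel (fun=> c : R).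
Proof. by split => //; exists `|c|. Qed.

End bounded_borel_theory.

(** * The exponential of a bounded operator *)

Section bounded_operator.
Context {R : realType}.
Variables (A : (Omega R -> R) -> Omega R -> R) (M : R).
Hypothesis M0 : 0 <= M.
Hypothesis A_measurable : forall (Phi : Omega R -> R), bounded_borel Phi -> measurable_fun setT (A Phi).
Hypothesis A_bounded : forall (Phi : Omega R -> R) (C : R), measurable_fun setT Phi -> (forall z, `|Phi z| <= C) ->
  forall z, `|A Phi z| <= M * C.
Hypothesis A_mass : forall (Phi : Omega R -> R) (B : set R), bounded_borel Phi -> measurable B ->
  A (fun z => \1_B (mass z) * Phi z) = (fun z => \1_B (mass z) * A Phi z).

Let bbA (Phi : Omega R -> R) : bounded_borel Phi -> bounded_borel (A Phi).
Proof.
move=> bPhi; split; first exact: A_measurable.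
by case: bPhi => mPhi [C PhiC]; exists (M * C); exact: A_bounded.
Qed.

Lemma bounded_borel_iter n Phi : bounded_borel Phi -> bounded_borel (iter n A Phi).
Proof. by move=> bPhi; elim: n => //= n; exact: bbA. Qed.

Lemma iter_le n (Phi : Omega R -> R) (C : R) : measurable_fun setT Phi -> (forall z, `|Phi z| <= C) ->
  forall z, `|iter n A Phi z| <= M ^+ n * C.
Proof.
move=> mPhi PhiC; elim: n => [|n IH] z; first by rewrite mul1r.
rewrite exprS -mulrA; apply: A_bounded => //.
by have [] : bounded_borel (iter n A Phi) by apply: bounded_borel_iter; split => //; exists C.
Qed.

Let term (t : R) (Phi : Omega R -> R) z n : R := t ^+ n / n`!%:R * iter n A Phi z.

Let term_le (t : R) (Phi : Omega R -> R) (C : R) : 0 <= t -> measurable_fun setT Phi -> (forall z, `|Phi z| <= C) ->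
  forall z n, `|term t Phi z n| <= C * exp_coeff (t * M) n.
Proof.
move=> t0 mPhi PhiC z n; rewrite /term /exp_coeff normrM ger0_norm; last first.
  by rewrite divr_ge0// exprn_ge0.
rewrite /= exprMn.
have := @iter_le n _ _ mPhi PhiC z => /(ler_wpM2l) h.
have t1 : 0 <= t ^+ n / n`!%:R by rewrite divr_ge0// exprn_ge0.
have := h _ t1; set a := t ^+ n; set b := M ^+ n; set c := n`!%:R^-1.
move=> h'; apply: (le_trans h'); rewrite le_eqVlt; apply/orP; left; apply/eqP; ring.
Qed.

Let exp_coeff_ge0 (t : R) n : 0 <= t -> 0 <= exp_coeff (t * M) n.
Proof. by move=> t0; rewrite /exp_coeff/= divr_ge0// exprn_ge0// mulr_ge0. Qed.

(** Comparison with the exponential series of [t * M]. *)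
Lemma semigroup_cvg t Phi z : 0 <= t -> bounded_borel Phi ->
  series (term t Phi z) n @[n --> \oo] --> semigroup A t Phi z.
Proof.
move=> t0 [mPhi [C PhiC]].
have C0 : 0 <= C := le_trans (normr_ge0 _) (PhiC z).
apply: (@normed_cvg R R^o (term t Phi z)).
apply: (series_le_cvg _ _ (term_le t0 mPhi PhiC z)) => //.
  by move=> n; rewrite mulr_ge0// exp_coeff_ge0.
rewrite (_ : series _ = (fun n => C * series (exp_coeff (t * M)) n)); last first.
  by apply/funext => n; rewrite /series/= mulr_sumr.
by apply: is_cvgM; [exact: is_cvg_cst|exact: is_cvg_series_exp_coeff].
Qed.

(** A bound independent of [n] and [z]: it is the domination used to pass to the limit under the
    integral in [semigroup_sym]. *)
Lemma series_le (t : R) (Phi : Omega R -> R) (C : R) : 0 <= t -> measurable_fun setT Phi -> (forall z, `|Phi z| <= C) ->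
  forall z n, `|series (term t Phi z) n| <= C * expR (t * M).
Proof.
move=> t0 mPhi PhiC z n.
have C0 : 0 <= C := le_trans (normr_ge0 _) (PhiC z).
rewrite /series/= (le_trans (ler_norm_sum _ _ _))//.
apply: (@le_trans _ _ (\sum_(0 <= k < n) C * exp_coeff (t * M) k)).
  by apply: ler_sum => k _; exact: term_le.
rewrite -mulr_sumr ler_wpM2l// /expR.
apply: (nondecreasing_cvgn_le _ (is_cvg_series_exp_coeff _)).
apply/nondecreasing_seqP => k; rewrite /series/= big_nat_recr//= lerDl.
exact: exp_coeff_ge0.
Qed.

Lemma measurable_series_term t Phi n : bounded_borel Phi ->
  measurable_fun setT (fun z => series (term t Phi z) n).
Proof.
move=> bPhi; rewrite /series/=; apply: measurable_sum => k.
apply: measurable_funM => //.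
by have [] := bounded_borel_iter k bPhi.
Qed.

Lemma bounded_borel_semigroup t Phi : 0 <= t -> bounded_borel Phi ->
  bounded_borel (semigroup A t Phi).
Proof.
move=> t0 bPhi; split.
  apply: (@measurable_fun_cvg _ _ _ _ (fun n z => series (term t Phi z) n)).
    by move=> n; exact: measurable_series_term.
  by move=> z _; exact: semigroup_cvg.
case: (bPhi) => mPhi [C PhiC]; exists (C * expR (t * M)) => z.
have h : `|series (term t Phi z) n| @[n --> \oo] --> `|semigroup A t Phi z|.
  by apply: cvg_norm; exact: semigroup_cvg.
by apply: (cvgr_to_le h); apply: nearW => n; exact: series_le.
Qed.

Lemma semigroup_mass t (Phi : Omega R -> R) (B : set R) : 0 <= t -> bounded_borel Phi -> measurable B ->
  semigroup A t (fun z => \1_B (mass z) * Phi z) =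
  (fun z => \1_B (mass z) * semigroup A t Phi z).
Proof.
move=> t0 bPhi mB; apply/funext => z.
have e n : iter n A (fun z => \1_B (mass z) * Phi z) = (fun z => \1_B (mass z) * iter n A Phi z).
  by elim: n => //= n ->; apply: A_mass => //; exact: bounded_borel_iter.
rewrite /semigroup; apply: cvg_lim => //.
rewrite (_ : series _ = (fun n => \1_B (mass z) * series (term t Phi z) n)); last first.
  by apply/funext => n; rewrite /series/= mulr_sumr; apply: eq_bigr => k _; rewrite e mulrCA.
by apply: cvgM; [exact: cvg_cst|exact: semigroup_cvg].
Qed.

Section symmetric.
Context d (W : measurableType d) (P : probability W R) (X : W -> Omega R).
Hypothesis mX : measurable_fun setT X.
Hypothesis A_sym : forall Phi Psi : Omega R -> R, bounded_borel Phi -> bounded_borel Psi ->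
  \int[P]_w (Psi (X w) * A Phi (X w)) = \int[P]_w (Phi (X w) * A Psi (X w)).

Lemma iter_sym n Phi Psi : bounded_borel Phi -> bounded_borel Psi ->
  \int[P]_w (Psi (X w) * iter n A Phi (X w)) = \int[P]_w (Phi (X w) * iter n A Psi (X w)).
Proof.
elim: n Phi Psi => [|n IH] Phi Psi bPhi bPsi.
  by apply: eq_Rintegral => w _; rewrite mulrC.
rewrite iterS A_sym//; last exact: bounded_borel_iter.
under eq_Rintegral do rewrite mulrC.
by rewrite IH//; [rewrite -iterSr | exact: bbA].
Qed.

Lemma series_sym t n Phi Psi : bounded_borel Phi -> bounded_borel Psi ->
  \int[P]_w (Psi (X w) * series (term t Phi (X w)) n) =
  \int[P]_w (Phi (X w) * series (term t Psi (X w)) n).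
Proof.
move=> bPhi bPsi.
have int Phi' Psi' k : bounded_borel Phi' -> bounded_borel Psi' ->
    P.-integrable setT (EFin \o (fun w => (Psi' (X w) * (t ^+ k / k`!%:R * iter k A Phi' (X w))))).
  move=> b1 b2; have b3 : bounded_borel (fun z => Psi' z * (t ^+ k / k`!%:R * iter k A Phi' z)).
    apply: bounded_borelM => //; apply: (@bounded_borelM _ (fun=> _)) => //.
      exact: bounded_borel_cst.
    exact: bounded_borel_iter.
  case: b3 => m3 [C b3]; apply: (@bounded_integrable _ _ _ P setT _ C) => //.
  exact: (measurableT_comp m3 mX).
have int' Phi' Psi' k : bounded_borel Phi' -> bounded_borel Psi' ->
    P.-integrable setT (EFin \o (fun w => (Psi' (X w) * series (term t Phi' (X w)) k))).
  move=> b1 b2; elim: k => [|k IH].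
    rewrite (_ : _ \o _ = cst 0%E); first exact: integrable0.
    by apply/funext => w /=; rewrite /series/= big_geq// mulr0.
  rewrite (_ : _ \o _ = (fun w => (Psi' (X w) * series (term t Phi' (X w)) k)%:E +
       (Psi' (X w) * (t ^+ k / k`!%:R * iter k A Phi' (X w)))%:E)%E).
    apply: integrableD => //; exact: int.
  by apply/funext => w /=; rewrite /series/= big_nat_recr//= mulrDr EFinD.
elim: n => [|n IH].
  by apply: eq_Rintegral => w _; rewrite /series/= !big_geq// !mulr0.
rewrite /series/=.
under eq_Rintegral do rewrite big_nat_recr//= mulrDr.
under [RHS]eq_Rintegral do rewrite big_nat_recr//= mulrDr.
rewrite RintegralD//; [|exact: int'|exact: int].
rewrite RintegralD//; [|exact: int'|exact: int].
congr (_ + _); first exact: IH.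
have e Phi' Psi' : \int[P]_x (Psi' (X x) * term t Phi' (X x) n) =
   \int[P]_x (t ^+ n / n`!%:R * (Psi' (X x) * iter n A Phi' (X x))).
  by apply: eq_Rintegral => w _; rewrite /term mulrCA.
rewrite !e RintegralZl//; last first.
  have [m3 [C b3]] := bounded_borelM bPsi (bounded_borel_iter n bPhi).
  by apply: (@bounded_integrable _ _ _ P setT _ C) => //; exact: (measurableT_comp m3 mX).
rewrite RintegralZl//; last first.
  have [m3 [C b3]] := bounded_borelM bPhi (bounded_borel_iter n bPsi).
  by apply: (@bounded_integrable _ _ _ P setT _ C) => //; exact: (measurableT_comp m3 mX).
by congr (_ * _); exact: iter_sym.
Qed.

Lemma semigroup_sym t Phi Psi : 0 <= t -> bounded_borel Phi -> bounded_borel Psi ->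
  \int[P]_w (Psi (X w) * semigroup A t Phi (X w)) =
  \int[P]_w (Phi (X w) * semigroup A t Psi (X w)).
Proof.
move=> t0 bPhi bPsi.
have c Phi' Psi' : bounded_borel Phi' -> bounded_borel Psi' ->
  (\int[P]_w (Psi' (X w) * series (term t Phi' (X w)) n)) @[n --> \oo] -->
  \int[P]_w (Psi' (X w) * semigroup A t Phi' (X w)).
  move=> b1 b2; have [m1 [C1 bb1]] := b1; have [m2 [C2 bb2]] := b2.
  apply: (@bounded_Rintegral_cvg _ _ _ P setT _ _ (C2 * (C1 * expR (t * M)))) => //.
  - move=> n; apply: measurable_funM; first exact: (measurableT_comp m2 mX).
    exact: (measurableT_comp (measurable_series_term t n b1) mX).
  - by move=> n w; rewrite normrM ler_pM//; exact: series_le.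
  - by move=> w; apply: cvgM; [exact: cvg_cst|exact: semigroup_cvg].
rewrite -(cvg_lim _ (c _ _ bPhi bPsi))// -(cvg_lim _ (c _ _ bPsi bPhi))//.
by congr (lim (_ @ \oo)); apply/funext => n; exact: series_sym.
Qed.

End symmetric.

End bounded_operator.

(** * Finite-dimensional laws as nested semigroups *)

Section chains.
Context {R : realType}.
Variables (A : (Omega R -> R) -> Omega R -> R) (M : R).
Hypothesis M0 : 0 <= M.
Hypothesis A_measurable : forall (Phi : Omega R -> R), bounded_borel Phi -> measurable_fun setT (A Phi).
Hypothesis A_bounded : forall (Phi : Omega R -> R) (C : R), measurable_fun setT Phi -> (forall z, `|Phi z| <= C) ->
  forall z, `|A Phi z| <= M * C.
Hypothesis A_mass : forall (Phi : Omega R -> R) (B : set R), bounded_borel Phi -> measurable B ->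
  A (fun z => \1_B (mass z) * Phi z) = (fun z => \1_B (mass z) * A Phi z).

Implicit Types (l : seq (R * set (Omega R))) (a T : R) (f g : Omega R -> R).

(** For a Markov process at [z] at time [a], this is the expectation of [g] at time [T] on the event
    that the process is in [B] at time [t] for each [(t, B)] of the list. *)
Fixpoint forward a l T g : Omega R -> R :=
  if l is (t, B) :: l' then semigroup A (t - a) (fun z => \1_B z * forward t l' T g z)
  else semigroup A (T - a) g.

(** The adjoint of [forward] when the semigroup is symmetric: [f], given at time [a], is carried
    along the list up to [T]. *)
Fixpoint backward f a l T : Omega R -> R :=
  if l is (t, B) :: l' then backward (fun z => \1_B z * semigroup A (t - a) f z) t l' T
  else semigroup A (T - a) f.

Definition ordered_times a l T := path <=%R a (rcons [seq p.1 | p <- l] T).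

Definition measurable_sets l := forall p, p \in [seq p.2 | p <- l] -> @measurable _ (Omega R) p.

Lemma measurable_sets_cons t B l : measurable_sets ((t, B) :: l) ->
  measurable B /\ measurable_sets l.
Proof.
move=> h; split; first by apply: h; rewrite /= inE eqxx.
by move=> p pl; apply: h; rewrite /= inE pl orbT.
Qed.

Let bbS t f : 0 <= t -> bounded_borel f -> bounded_borel (semigroup A t f).
Proof. exact: (bounded_borel_semigroup M0). Qed.

Lemma bounded_borel_forward a l T g : ordered_times a l T -> measurable_sets l ->
  bounded_borel g -> bounded_borel (forward a l T g).
Proof.
elim: l a => [a|[t B] l IH a] /=.
  by rewrite /ordered_times/= andbT => aT _ bg; apply: bbS => //; rewrite subr_ge0.
rewrite /ordered_times/= => /andP[at' o] /measurable_sets_cons[mB ml] bg.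
apply: bbS; first by rewrite subr_ge0.
by apply: bounded_borelM; [exact: bounded_borel_indic|exact: IH].
Qed.

Lemma forward_rcons a l t B T g :
  forward a (rcons l (t, B)) T g = forward a l t (fun z => \1_B z * semigroup A (T - t) g z).
Proof. by elim: l a => [a|[t' B'] l IH a] //=; rewrite IH. Qed.

(** Unrolling [backward] from the front of the list is unrolling [forward] from the back of the
    reflected list, where [forward_rcons] applies. *)
Lemma backwardE f a l T : backward f a l T =
  forward 0 (rev [seq (T - p.1, p.2) | p <- l]) (T - a) f.
Proof.
elim: l f a => [f a|[t B] l IH f a] /=; first by rewrite subr0.
rewrite IH rev_cons forward_rcons; congr forward; apply/funext => z.
congr (_ * semigroup A _ f z); ring.
Qed.

(** The mass is conserved, so an event on it may be read at the initial instead of the final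
    time. *)
Lemma forward_mass a l T g (D : set R) : ordered_times a l T -> measurable_sets l ->
  bounded_borel g -> measurable D ->
  forward a l T (fun z => \1_D (mass z) * g z) = (fun z => \1_D (mass z) * forward a l T g z).
Proof.
move=> + + bg mD; elim: l a => [a|[t B] l IH a] /=.
  rewrite /ordered_times/= andbT => aT _.
  by rewrite (semigroup_mass M0)// subr_ge0.
rewrite /ordered_times/= => /andP[at' o] /measurable_sets_cons[mB ml].
rewrite IH// -(semigroup_mass M0) ?subr_ge0//.
  by congr semigroup; apply/funext => z; rewrite mulrCA.
apply: bounded_borelM; first exact: bounded_borel_indic.
exact: bounded_borel_forward.
Qed.

Section symmetric.
Context d (W : measurableType d) (P : probability W R) (X : W -> Omega R).
Hypothesis mX : measurable_fun setT X.
Hypothesis A_sym : forall Phi Psi : Omega R -> R, bounded_borel Phi -> bounded_borel Psi ->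
  \int[P]_w (Psi (X w) * A Phi (X w)) = \int[P]_w (Phi (X w) * A Psi (X w)).

(** Symmetry moves the semigroups one at a time from [g] to [f]. *)
Lemma forward_sym a l T f g : ordered_times a l T -> measurable_sets l ->
  bounded_borel f -> bounded_borel g ->
  \int[P]_w (f (X w) * forward a l T g (X w)) =
  \int[P]_w (g (X w) * backward f a l T (X w)).
Proof.
elim: l a f => [a f|[t B] l IH a f] /=.
  rewrite /ordered_times/= andbT => aT _ bf bg.
  by rewrite (semigroup_sym M0) ?subr_ge0.
rewrite /ordered_times/= => /andP[at' o] /measurable_sets_cons[mB ml] bf bg.
have bB := @bounded_borel_indic R B mB.
have t0 : 0 <= t - a by rewrite subr_ge0.
rewrite (semigroup_sym M0)//; last first.
  by apply: bounded_borelM => //; exact: bounded_borel_forward.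
rewrite -IH//; last by apply: bounded_borelM => //; exact: bbS.
by apply: eq_Rintegral => w _; rewrite mulrAC.
Qed.

End symmetric.

Section markov.
Context d (W : measurableType d) (P : probability W R) (Z : R -> W -> Omega R).
Hypothesis mZ : forall t, 0 <= t -> measurable_fun setT (Z t).
Hypothesis markov : forall s t (Phi : Omega R -> R) (E : set W), 0 <= s -> 0 <= t ->
        bounded_borel Phi -> past Z s E ->
        \int[P]_(w in E) Phi (Z (s + t) w) =
        \int[P]_(w in E) semigroup A t Phi (Z s w).

Definition visits l : set W := [set w | forall p, p \in l -> p.2 (Z p.1 w)].

Lemma past_measurable s E : past Z s E -> measurable E.
Proof.
apply: smallest_sub; first exact: sigma_algebra_measurable.
move=> _ [r [B [/andP[r0 _] mB ->]]]; rewrite -[X in measurable X]setTI.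
exact: mZ.
Qed.

Lemma past_le s t E : s <= t -> past Z s E -> past Z t E.
Proof.
move=> st; apply: sub_sigma_algebra2 => {}E [r [B [/andP[r0 rs] mB ->]]].
by exists r, B; rewrite r0 (le_trans rs).
Qed.

Lemma pastI s E F : past Z s E -> past Z s F -> past Z s (E `&` F).
Proof. exact: (@measurableI _ (g_sigma_algebraType _)). Qed.

Lemma past_visit s t B : 0 <= s <= t -> measurable B -> past Z t (Z s @^-1` B).
Proof. by move=> st mB; apply: sub_sigma_algebra; exists s, B. Qed.

Lemma visits_cons t B l : visits ((t, B) :: l) = Z t @^-1` B `&` visits l.
Proof.
apply/seteqP; split => w /=.
  move=> h; split; first by apply: (h (t, B)); rewrite inE eqxx.
  by move=> p pl; apply: h; rewrite inE pl orbT.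
by move=> [h1 h2] p; rewrite inE => /predU1P[->//|]; exact: h2.
Qed.

Lemma visits_measurable a l T : 0 <= a -> ordered_times a l T -> measurable_sets l ->
  measurable (visits l).
Proof.
elim: l a => [a _ _ _|[t B] l IH a a0].
  by rewrite [X in measurable X](_ : _ = setT)//; apply/seteqP; split.
rewrite /ordered_times/= => /andP[at' o] /measurable_sets_cons[mB ml].
rewrite visits_cons; apply: measurableI; last by apply: (IH t) => //; exact: le_trans at'.
by rewrite -[X in measurable X]setTI; apply: mZ => //; exact: le_trans at'.
Qed.

(** The event [E] varies in the induction: the visit at time [t], once reached, is absorbed into the
    past. *)
Lemma markov_visits a l T E : 0 <= a -> ordered_times a l T -> measurable_sets l ->
  past Z a E ->
  fine (P (E `&` visits l)) = \int[P]_(w in E) forward a l T (fun=> 1) (Z a w).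
Proof.
elim: l a E => [a E a0|[t B] l IH a E a0].
  rewrite /ordered_times/= andbT => aT _ pE.
  rewrite -markov ?subr_ge0//; last exact: bounded_borel_cst.
  rewrite Rintegral_cst ?mul1r//; last exact: past_measurable pE.
  by rewrite (_ : visits _ = setT) ?setIT//; apply/seteqP; split.
rewrite /ordered_times/= => /andP[at' o] /measurable_sets_cons[mB ml] pE.
have t0 : 0 <= t by exact: le_trans at'.
have mE := past_measurable pE.
have mB' : measurable (Z t @^-1` B) by rewrite -[X in measurable X]setTI; apply: mZ.
rewrite visits_cons setIA (IH t)//; last first.
  by apply: pastI; [exact: past_le pE|apply: past_visit => //; rewrite t0 lexx].
rewrite -Rintegral_indicr//.
rewrite -markov ?subr_ge0//; last first.
  apply: bounded_borelM; first exact: bounded_borel_indic.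
  exact: bounded_borel_forward (bounded_borel_cst _).
by rewrite [a + _]addrC subrK; apply: eq_Rintegral => w _.
Qed.

Hypothesis A_sym : forall Phi Psi : Omega R -> R, bounded_borel Phi -> bounded_borel Psi ->
  \int[P]_w (Psi (Z 0 w) * A Phi (Z 0 w)) = \int[P]_w (Phi (Z 0 w) * A Psi (Z 0 w)).

Lemma ordered_times_rev l T : ordered_times 0 l T ->
  ordered_times 0 (rev [seq (T - p.1, p.2) | p <- l]) T.
Proof.
rewrite /ordered_times => h.
have -> : rcons [seq p.1 | p <- rev [seq (T - p.1, p.2) | p <- l]] T =
   rev (T :: [seq T - x | x <- [seq p.1 | p <- l]]).
  by rewrite rev_cons map_rev -!map_comp.
have : sorted <=%R (0 :: rcons [seq p.1 | p <- l] T) by [].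
move=> s; suff : sorted <=%R (0 :: rev (T :: [seq T - x | x <- [seq p.1 | p <- l]])) by [].
have -> : 0 :: rev (T :: [seq T - x | x <- [seq p.1 | p <- l]]) =
   rev [seq T - x | x <- 0 :: rcons [seq p.1 | p <- l] T].
  by rewrite /= map_rcons !rev_cons rev_rcons subr0 subrr.
rewrite rev_sorted sorted_map; apply: sub_sorted s => x y /= xy.
by rewrite lerD2l lerN2.
Qed.

Lemma measurable_sets_rev l T : measurable_sets l ->
  measurable_sets (rev [seq (T - p.1, p.2) | p <- l]).
Proof.
move=> h p; rewrite map_rev mem_rev -map_comp => pl; apply: h.
by rewrite -(eq_map (_ : snd =1 (snd \o (fun p => (T - p.1, p.2))))) in pl.
Qed.

(** The event on the mass enters as the initial function. Symmetry turns it into the final function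
    of the reversed chain, and conservation of mass brings it back to time 0. *)
Lemma visits_reversible l T (D : set R) : 0 <= T -> ordered_times 0 l T -> measurable_sets l ->
  measurable D ->
  P ((mass \o Z 0) @^-1` D `&` visits l) =
  P ((mass \o Z 0) @^-1` D `&` visits [seq (T - p.1, p.2) | p <- l]).
Proof.
move=> T0 o ml mD.
have -> : visits [seq (T - p.1, p.2) | p <- l] = visits (rev [seq (T - p.1, p.2) | p <- l]).
  by apply/seteqP; split => w h p pl; apply: h; move: pl; rewrite mem_rev.
set l' := rev _.
have o' : ordered_times 0 l' T by exact: ordered_times_rev.
have ml' : measurable_sets l' by exact: measurable_sets_rev.
have mass_m := @measurable_mass R.
have pD : past Z 0 ((mass \o Z 0) @^-1` D).
  rewrite comp_preimage; apply: past_visit; first by rewrite lexx.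
  by rewrite -[X in measurable X]setTI; exact: mass_m.
have mD' := past_measurable pD.
have bD : bounded_borel (fun z : Omega R => \1_D (mass z) : R).
  split; first by apply: measurableT_comp => //; exact: measurable_indic.
  by exists 1 => z; rewrite indicE; case: (_ \in _); rewrite ?normr1 ?normr0.
have m0 : measurable_fun setT (Z 0) by exact: mZ.
have b1 := @bounded_borel_cst R 1.
rewrite -[LHS]fineK ?fin_num_measure//; last first.
  by apply: measurableI => //; exact: visits_measurable o ml.
rewrite -[RHS]fineK ?fin_num_measure//; last first.
  by apply: measurableI => //; exact: visits_measurable o' ml'.
congr (_%:E); rewrite !(@markov_visits 0 _ T)//.
have e (h : Omega R -> R) : \int[P]_(w in (mass \o Z 0) @^-1` D) h (Z 0 w) =
    \int[P]_w (\1_D (mass (Z 0 w)) * h (Z 0 w)).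
  rewrite -[in LHS](setTI (_ @^-1` _)) -Rintegral_indicr//.
rewrite !e; have h := forward_sym m0 A_sym o ml bD b1.
apply: (etrans h); rewrite backwardE subr0 -/l'.
transitivity (\int[P]_w forward 0 l' T (fun z => \1_D (mass z) * 1) (Z 0 w)).
  apply: eq_Rintegral => w _; rewrite mul1r.
  by congr (forward _ _ _ _ _); apply/funext => z; rewrite mulr1.
by rewrite forward_mass.
Qed.

End markov.
End chains.

Section finite_measure_unique.
Context d (T : measurableType d) (R : realType).

Lemma finite_measure_unique (G : set (set T)) (m1 m2 : {measure set T -> \bar R}) :
  @measurable _ T = <<s G >> -> setI_closed G -> G setT ->
  (m1 setT < +oo)%E -> (forall A, G A -> m1 A = m2 A) ->
  forall A, measurable A -> m1 A = m2 A.
Proof.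
move=> mG GI GT m1oo m12 A; rewrite mG.
apply: (@g_sigma_algebra_measure_unique _ _ _ G _ (fun=> setT)) => //.
- by rewrite mG; exact: sub_sigma_algebra.
- by rewrite bigcup_const//; exists 0%N.
Qed.

End finite_measure_unique.

Lemma measurable_forall_ord d (T : measurableType d) n (F : 'I_n -> set T) :
  (forall k, measurable (F k)) -> measurable [set x | forall k, F k x].
Proof.
move=> mF; rewrite [X in measurable X](_ : _ = ~` (\bigcup_k ~` F k)).
  apply: measurableC; apply: countable_bigcupT_measurable => // k.
  exact: measurableC.
rewrite setC_bigcup; apply/seteqP; split => x /= h k; rewrite ?setCK; first by move=> _; exact: h.
by have := h k I; rewrite setCK.
Qed.

Section tuple_law.
Context d (T : measurableType d) (R : realType) (n : nat).

Definition rectangle (B : 'I_n -> set T) : set (n.-tuple T) :=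
  [set x | forall k, B k (tnth x k)].

Lemma tuple_law_unique (m1 m2 : {measure set (n.-tuple T) -> \bar R}) :
  (m1 setT < +oo)%E ->
  (forall B : 'I_n -> set T, (forall k, measurable (B k)) -> m1 (rectangle B) = m2 (rectangle B)) ->
  forall A, measurable A -> m1 A = m2 A.
Proof.
move=> m1oo m12.
pose G := [set A | exists2 B : 'I_n -> set T, (forall k, measurable (B k)) & A = rectangle B].
have mrect B : (forall k, measurable (B k)) -> measurable (rectangle B).
  move=> mB; apply: (@measurable_forall_ord _ _ _ (fun k => (fun x => tnth x k) @^-1` B k)) => k.
  by rewrite -[X in measurable X]setTI; exact: measurable_tnth.
apply: (@finite_measure_unique _ _ _ G) => //.
- apply/seteqP; split.
    apply: smallest_sub; first exact: smallest_sigma_algebra.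
    elim/big_ind : _ => [//|X Y XG YG|i _]; first by rewrite subUset.
    move=> A [B mB <-]; apply: sub_sigma_algebra.
    exists (fun k => if k == i then B else setT); first by move=> k; case: ifP.
    apply/seteqP; split => x /=; first by move=> [_ Bx] k; case: eqP => // ->.
    by move=> /(_ i); rewrite eqxx.
  apply: smallest_sub; first exact: sigma_algebra_measurable.
  by move=> _ [B mB ->]; exact: mrect.
- move=> _ _ [B mB ->] [C mC ->]; exists (fun k => B k `&` C k).
    by move=> k; exact: measurableI.
  apply/seteqP; split=> x /=; first by move=> [h1 h2] k; split.
  by move=> h; split => k; have [] := h k.
- exists (fun=> setT) => //; by apply/seteqP; split.
- by move=> _ [B mB ->]; exact: m12.
Qed.

End tuple_law.

(** * Reversal under a random but conserved speed *)

Section time_change.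
Context {R : realType} (lam : R).
Context d (W : measurableType d) (P : probability W R) (Z : R -> W -> Omega R).
Hypothesis mZ : forall t, 0 <= t -> measurable_fun setT (Z t).
Hypothesis jZ : forall w, jump_path (Z ^~ w).

Let speed w : R := mass (Z 0 w) `^ (2 + lam).

(* The speed rounded up to the grid 2^-N Z: the paths being right-continuous
   step functions, the values along the grid are eventually equal to the limit. *)
Let grid N w : R := (Num.truncn (2 ^+ N * speed w)).+1%:R / 2 ^+ N.

Let speed_gt0 w : 0 < speed w.
Proof. by rewrite powR_gt0// mass_gt0. Qed.

(** Masses for which the rounded speed is [i.+1 / 2 ^+ N]. As a condition on the mass at time 0, a
    cell is compatible with the reversal at a fixed speed. *)
Let cell N i : set R := [set m | i%:R <= 2 ^+ N * m `^ (2 + lam) < i.+1%:R].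

Let measurable_cell N i : measurable (cell N i).
Proof.
rewrite (_ : cell N i = (fun m => 2 ^+ N * m `^ (2 + lam)) @^-1` `[i%:R, i.+1%:R[%classic).
  rewrite -[X in measurable X]setTI; apply: measurable_funM => //.
by apply/seteqP; split => x /=; rewrite in_itv.
Qed.

Let cellP N i w : cell N i (mass (Z 0 w)) <-> Num.truncn (2 ^+ N * speed w) = i.
Proof.
have s0 : 0 <= 2 ^+ N * speed w by rewrite mulr_ge0// ?exprn_ge0// ltW.
split; first by move=> /truncn_def.
by move=> <-; rewrite /cell/=; exact: truncn_itv.
Qed.

(** Rounding up delays the time by at most [s / 2 ^+ N], so for large [N] it stays in the interval
    to the right of [speed w * s] on which the path is constant. *)
Lemma grid_near s w : 0 <= s -> \forall N \near \oo, Z (grid N w * s) w = Z (speed w * s) w.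
Proof.
move=> s0; have [rc _] := jZ w.
have [e e0 eZ] := rc (speed w * s) ltac:(by rewrite mulr_ge0// ltW).
have c : (s / 2 ^+ N) @[N --> \oo] --> (s * 0 : R).
  apply: cvgM; first exact: cvg_cst.
  by under eq_fun do rewrite -exprVn; apply: cvg_expr; rewrite ger0_norm ?invr_ge0//; lra.
rewrite mulr0 in c.
have : \forall N \near \oo, `|0 - s / 2 ^+ N| < e by move/cvgrPdist_lt : c; exact.
apply: filterS => N; rewrite sub0r normrN ger0_norm ?divr_ge0 ?exprn_ge0// => sN.
have p0 : 0 < 2 ^+ N :> R by exact: exprn_gt0.
have s1 : 0 <= 2 ^+ N * speed w by rewrite mulr_ge0// ltW.
have /andP[g1 g2] := truncn_itv s1.
apply: eZ; apply/andP; split.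
  rewrite ler_wpM2r// /grid ler_pdivlMr// mulrC ltW//.
have h : grid N w <= speed w + (2 ^+ N)^-1.
  rewrite /grid ler_pdivrMr// mulrDl mulVf ?gt_eqF// [speed w * _]mulrC.
  by rewrite -addn1 natrD lerD2r.
apply: (@le_lt_trans _ _ ((speed w + (2 ^+ N)^-1) * s)); first by rewrite ler_wpM2r.
by rewrite mulrDl ltrD2l mulrC.
Qed.

Let hits n (B : 'I_n -> set (Omega R)) (v : R) (s : 'I_n -> R) : set W :=
  [set w | forall k, B k (Z (v * s k) w)].

Let hitsN N n (B : 'I_n -> set (Omega R)) (s : 'I_n -> R) : set W :=
  [set w | forall k, B k (Z (grid N w * s k) w)].

Let grid_hits n (B : 'I_n -> set (Omega R)) s N : hitsN N B s =
  \bigcup_i ((mass \o Z 0) @^-1` cell N i `&` hits B (i.+1%:R / 2 ^+ N) s).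
Proof.
apply/seteqP; split => w /=.
  move=> h; exists (Num.truncn (2 ^+ N * speed w)); first exact: I.
  split; first exact: (proj2 (@cellP N _ w) erefl).
  by move=> k; have := h k; rewrite /grid.
move=> [i _ [/= ci h]] k; have := h k; rewrite /grid.
by rewrite (proj1 (@cellP N i w) ci).
Qed.

Let measurable_hits n (B : 'I_n -> set (Omega R)) v s : (forall k, measurable (B k)) ->
  0 <= v -> (forall k, 0 <= s k) -> measurable (hits B v s).
Proof.
move=> mB v0 s0.
apply: (@measurable_forall_ord _ _ _ (fun k => Z (v * s k) @^-1` B k)) => k.
by rewrite -[X in measurable X]setTI; apply: mZ => //; rewrite mulr_ge0.
Qed.

Let measurable_massZ D : measurable D -> measurable ((mass \o Z 0) @^-1` D).
Proof.
move=> mD; rewrite -[X in measurable X]setTI.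
apply: (measurableT_comp measurable_mass) => //; exact: mZ.
Qed.

Let trivIset_cell n (B : 'I_n -> set (Omega R)) s N : trivIset setT
  (fun i => (mass \o Z 0) @^-1` cell N i `&` hits B (i.+1%:R / 2 ^+ N) s).
Proof.
by apply/trivIsetP => i j _ _ ij; apply/seteqP; split => // w [[/= /cellP hi _] [/= /cellP hj _]];
  move: ij; rewrite -hi -hj eqxx.
Qed.

Let measurable_grid_hits n (B : 'I_n -> set (Omega R)) s N : (forall k, measurable (B k)) ->
  (forall k, 0 <= s k) -> measurable (hitsN N B s).
Proof.
move=> mB s0; rewrite grid_hits; apply: bigcupT_measurable => i; apply: measurableI.
  exact: measurable_massZ.
by apply: measurable_hits => //; rewrite divr_ge0.
Qed.

(** The evaluation at a random time is a pointwise limit of evaluations at grid speeds, each a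
    countable patchwork of fixed times. Coordinates are used because the limit theorem is about real
    functions. *)
Lemma measurable_time_change s : 0 <= s -> measurable_fun setT (time_change lam Z s).
Proof.
move=> s0; apply: measurable_fun_Omega => i.
apply: (@measurable_fun_cvg _ _ _ _ (fun N w => Z (grid N w * s) w i)); last first.
  move=> w _; apply: cvg_near_cst; apply: filterS (grid_near w s0) => N h.
  by rewrite h /time_change.
move=> N; apply: (measurableT_comp (measurable_coordinate i)) => _ B mB.
have := @measurable_grid_hits 1 (fun=> B) (fun=> s) N (fun=> mB) (fun=> s0).
rewrite setTI; congr measurable; apply/seteqP; split => w /=; last by move=> h k.
by apply; exact: ord0.
Qed.

Let visits_hits n (B : 'I_n -> set (Omega R)) v s :
  visits Z [seq (v * s k, B k) | k <- enum 'I_n] = hits B v s.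
Proof.
apply/seteqP; split => w /=.
  move=> h k; apply: (h (v * s k, B k)); apply/mapP; exists k => //.
  by rewrite mem_enum.
by move=> h p /mapP[k _ ->]; exact: h.
Qed.

Variables (n : nat) (t : n.-tuple R) (T : R).
Hypothesis tT : path <%R 0 (rcons t T).
Hypothesis Z_rev : forall l T (D : set R), 0 <= T -> ordered_times 0 l T -> measurable_sets l ->
  measurable D ->
  P ((mass \o Z 0) @^-1` D `&` visits Z l) =
  P ((mass \o Z 0) @^-1` D `&` visits Z [seq (T - p.1, p.2) | p <- l]).

Let T0 : 0 < T.
Proof.
have := order_path_min (@lt_trans _ R) tT => /allP/(_ T); apply.
by rewrite mem_rcons inE eqxx.
Qed.

Let t0 k : 0 < tnth t k.
Proof.
have := order_path_min (@lt_trans _ R) tT => /allP; apply.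
by rewrite mem_rcons inE mem_tnth orbT.
Qed.

Let tltT k : tnth t k < T.
Proof.
have : sorted <%R (rcons t T) by exact: path_sorted tT.
rewrite -cats1 sorted_pairwise; last exact: lt_trans.
rewrite pairwise_cat => /and3P[/allrelP h _ _].
by apply: h; rewrite ?mem_tnth// inE.
Qed.

Let hits_rev (B : 'I_n -> set (Omega R)) (D : set R) v : (forall k, measurable (B k)) ->
  0 <= v -> measurable D ->
  P ((mass \o Z 0) @^-1` D `&` hits B v (tnth t)) =
  P ((mass \o Z 0) @^-1` D `&` hits B v (fun k => T - tnth t k)).
Proof.
move=> mB v0 mD; rewrite -visits_hits (@Z_rev _ (v * T))//.
- congr (P (_ `&` _)); rewrite -visits_hits -map_comp; congr visits.
  by apply: eq_map => k /=; rewrite mulrBr.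
- by rewrite mulr_ge0// ltW.
- rewrite /ordered_times -map_comp.
  have -> : rcons [seq (fst \o (fun k => (v * tnth t k, B k))) i | i <- enum 'I_n] (v * T) =
      [seq v * x | x <- rcons t T].
    rewrite map_rcons; congr rcons; rewrite -[in RHS](map_tnth_enum t) -[RHS]map_comp.
    exact: eq_map.
  suff : sorted <=%R [seq v * x | x <- 0 :: rcons t T] by rewrite /= mulr0.
  rewrite sorted_map; have : sorted <%R (0 :: rcons t T) by exact: tT.
  by apply: sub_sorted => x y /= xy; rewrite ler_wpM2l// ltW.
- by move=> p; rewrite -map_comp => /mapP[k _ ->]; exact: mB.
Qed.

Let grid_rev (B : 'I_n -> set (Omega R)) N : (forall k, measurable (B k)) ->
  P (hitsN N B (tnth t)) = P (hitsN N B (fun k => T - tnth t k)).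
Proof.
move=> mB.
have H s : (forall k, 0 <= s k) -> P (hitsN N B s) =
    (\sum_(0 <= i <oo) P ((mass \o Z 0) @^-1` cell N i `&` hits B (i.+1%:R / 2 ^+ N) s))%E.
  move=> s0; have mh i : measurable ((mass \o Z 0) @^-1` cell N i `&` hits B (i.+1%:R / 2 ^+ N) s).
    apply: measurableI; first exact: measurable_massZ.
    by apply: measurable_hits => //; rewrite divr_ge0.
  rewrite grid_hits (measure_bigcup P _ _ (fun i _ => mh i) (@trivIset_cell n B s N)).
  by apply: eq_eseriesl => i; rewrite in_setT.
rewrite !H; [|by move=> k; rewrite subr_ge0 ltW|by move=> k; rewrite ltW].
by apply: eq_eseriesr => i _; apply: hits_rev => //; rewrite divr_ge0.
Qed.

Let measurable_tc_hits (B : 'I_n -> set (Omega R)) (s : 'I_n -> R) : (forall k, measurable (B k)) ->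
  (forall k, 0 <= s k) -> measurable [set w | forall k, B k (time_change lam Z (s k) w)].
Proof.
move=> mB s0; apply: (@measurable_forall_ord _ _ _ (fun k => time_change lam Z (s k) @^-1` B k)) => k.
by rewrite -[X in measurable X]setTI; exact: measurable_time_change.
Qed.

Let grid_cvg (B : 'I_n -> set (Omega R)) (s : 'I_n -> R) : (forall k, measurable (B k)) ->
  (forall k, 0 <= s k) ->
  fine (P (hitsN N B s)) @[N --> \oo] -->
  fine (P [set w | forall k, B k (time_change lam Z (s k) w)]).
Proof.
move=> mB s0.
have e (E : set W) : measurable E -> fine (P E) = \int[P]_w \1_E w.
  move=> mE; have -> : \int[P]_w \1_E w = \int[P]_w (\1_E w * 1) by apply: eq_Rintegral => w _; rewrite mulr1.
  by rewrite Rintegral_indicr// Rintegral_cst ?mul1r// setTI.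
have mE : measurable [set w | forall k, B k (time_change lam Z (s k) w)].
  exact: measurable_tc_hits.
rewrite e// (_ : (fun N => fine (P (hitsN N B s))) = (fun N => \int[P]_w \1_(hitsN N B s) w)); last first.
  by apply/funext => N; rewrite e//; exact: measurable_grid_hits.
apply: (@bounded_Rintegral_cvg _ _ _ P setT _ _ 1) => //.
- by move=> N; apply: measurable_indic; exact: measurable_grid_hits.
- by move=> N w; rewrite indicE; case: (_ \in _); rewrite ?normr1 ?normr0.
move=> w; apply: cvg_near_cst.
(* There are finitely many times, so one rank serves for all of them. *)
have : \forall N \near \oo, forall k : 'I_n, Z (grid N w * s k) w = Z (speed w * s k) w.
  by apply: filter_forall => k; exact: grid_near.
apply: filterS => N h; rewrite !indicE.
congr (nat_of_bool _)%:R; apply/idP/idP => /set_mem h'; apply/mem_set => k /=.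
  by have := h' k; rewrite h.
by rewrite h; exact: h'.
Qed.

Lemma time_change_reversible (C : set (n.-tuple (Omega R))) : measurable C ->
  P [set w | C [tuple time_change lam Z (tnth t k) w | k < n]] =
  P [set w | C [tuple time_change lam Z (T - tnth t k) w | k < n]].
Proof.
move=> mC.
have mt (s : 'I_n -> R) : (forall k, 0 <= s k) ->
   measurable_fun setT (fun w => [tuple time_change lam Z (s k) w | k < n]).
  move=> s0; apply/measurable_fun_tnthP => k.
  rewrite (_ : _ \o _ = time_change lam Z (s k)); first exact: measurable_time_change.
  by apply/funext => w /=; rewrite tnth_mktuple.
have m1 := mt (tnth t) (fun k => ltW (t0 k)).
have s0 k : 0 <= T - tnth t k by rewrite subr_ge0 ltW.
have m2 := mt (fun k => T - tnth t k) s0.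
pose f1 : {mfun W >-> n.-tuple (Omega R)} := HB.pack (fun w => [tuple time_change lam Z (tnth t k) w | k < n]) (isMeasurableFun.Build _ _ _ _ _ m1).
pose f2 : {mfun W >-> n.-tuple (Omega R)} := HB.pack (fun w => [tuple time_change lam Z (T - tnth t k) w | k < n]) (isMeasurableFun.Build _ _ _ _ _ m2).
apply: (@tuple_law_unique _ _ R n (pushforward P f1) (pushforward P f2)) => //.
  rewrite [X in (X < _)%E](_ : _ = 1%E) ?ltry//; exact: probability_setT.
move=> B mB.
have e (s : 'I_n -> R) : (fun w => [tuple time_change lam Z (s k) w | k < n]) @^-1` rectangle B =
   [set w | forall k, B k (time_change lam Z (s k) w)].
  by apply/seteqP; split => w /= h k; have := h k; rewrite tnth_mktuple.
change (P ((fun w => [tuple time_change lam Z (tnth t k) w | k < n]) @^-1` rectangle B) =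
  P ((fun w => [tuple time_change lam Z (T - tnth t k) w | k < n]) @^-1` rectangle B)).
rewrite !e.
have E1 := grid_cvg mB (fun k => ltW (t0 k)).
have E2 := grid_cvg mB s0.
have mE := @measurable_tc_hits B _ mB.
rewrite -[LHS]fineK ?fin_num_measure//; last by apply: mE => k; rewrite ltW.
rewrite -[RHS]fineK ?fin_num_measure//; last exact: mE.
congr (_%:E); rewrite -(cvg_lim _ E1)// -(cvg_lim _ E2)//.
by congr (lim (_ @ \oo)); apply/funext => N; rewrite grid_rev.
Qed.

End time_change.

Section reversibility.
Context {R : realType}.

(** Symmetry of the operator is a property of the initial law alone, so it carries over from [X0] to
    any process started from [pi]. *)
Lemma reversible_of_symmetric (lam : R) (L : (Omega R -> R) -> Omega R -> R)
    (M : R) d0 (W0 : measurableType d0) (P0 : probability W0 R) (X0 : W0 -> Omega R)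
    (pi : set (Omega R) -> \bar R) :
  let A := normalized_generator lam L in
  0 <= M ->
  (forall (Phi : Omega R -> R), bounded_borel Phi -> measurable_fun setT (A Phi)) ->
  (forall (Phi : Omega R -> R) (C : R), measurable_fun setT Phi -> (forall z, `|Phi z| <= C) ->
    forall z, `|A Phi z| <= M * C) ->
  (forall (Phi : Omega R -> R) (B : set R), bounded_borel Phi -> measurable B ->
    A (fun z => \1_B (mass z) * Phi z) = (fun z => \1_B (mass z) * A Phi z)) ->
  measurable_fun setT X0 ->
  (forall B, measurable B -> pi B = pushforward P0 X0 B) ->
  (forall Phi Psi : Omega R -> R, bounded_borel Phi -> bounded_borel Psi ->
    \int[P0]_w (Psi (X0 w) * A Phi (X0 w)) = \int[P0]_w (Phi (X0 w) * A Psi (X0 w))) ->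
  reversible lam L pi.
Proof.
move=> A M0 A_m A_b A_mass mX0 piE A_sym d W P Z [mZ jZ markov] Zpi n t T tT B mB.
have mZ0 : measurable_fun setT (Z 0) by exact: mZ.
have law (h : Omega R -> R) : bounded_borel h -> \int[P]_w h (Z 0 w) = \int[P0]_w h (X0 w).
  move=> [mh [C hC]].
  have i1 : P.-integrable setT (EFin \o (h \o Z 0)).
    exact: (@bounded_integrable _ _ _ P setT (h \o Z 0) C measurableT (measurableT_comp mh mZ0) (fun w => hC _)).
  have i2 : P0.-integrable setT (EFin \o (h \o X0)).
    exact: (@bounded_integrable _ _ _ P0 setT (h \o X0) C measurableT (measurableT_comp mh mX0) (fun w => hC _)).
  have mE : measurable_fun setT (EFin \o h) by exact/measurable_EFinP.
  have e1 := @integral_pushforward _ _ _ _ R (Z 0) mZ0 P setT (EFin \o h) mE i1 measurableT.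
  have e2 := @integral_pushforward _ _ _ _ R X0 mX0 P0 setT (EFin \o h) mE i2 measurableT.
  rewrite /Rintegral; congr fine; rewrite preimage_setT in e1 e2.
  apply: (etrans (esym e1)); apply: (etrans _ e2).
  apply: eq_measure_integral => C' mC' _; apply: (etrans (Zpi _ mC')).
  exact: piE.
have A_sym' : forall Phi Psi : Omega R -> R, bounded_borel Phi -> bounded_borel Psi ->
    \int[P]_w (Psi (Z 0 w) * A Phi (Z 0 w)) = \int[P]_w (Phi (Z 0 w) * A Psi (Z 0 w)).
  move=> Phi Psi bPhi bPsi.
  have bA F : bounded_borel F -> bounded_borel (A F).
    by move=> bF; split; [exact: A_m|case: bF => mF [C FC]; exists (M * C); exact: A_b].
  rewrite (law (fun z => Psi z * A Phi z)); last by apply: bounded_borelM => //; exact: bA.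
  rewrite (law (fun z => Phi z * A Psi z)); last by apply: bounded_borelM => //; exact: bA.
  exact: A_sym.
apply: time_change_reversible => // l T' D T'0 o ml mD.
exact: (@visits_reversible _ A M).
Qed.

End reversibility.

(** * The generator and detailed balance *)

HB.instance Definition _ (R : realType) := @Measure_isSigmaFinite.Build _ _ R
  (@counting nat R) (sigma_finite_counting R).

Section counting_pairs.
Context {R : realType}.

Lemma measurable_natnat (A : set (nat * nat)) : measurable A.
Proof.
rewrite (_ : A = \bigcup_(p in A) ([set p.1] `*` [set p.2])).
  by apply: bigcup_countType_measurable => p _; exact: measurableX.
apply/seteqP; split => [p Ap|[a b] [[a' b'] Ap [/= -> ->]]//].
by exists p.
Qed.

Lemma sigma_finite_counting_pairs :
  sigma_finite [set: nat * nat] (@counting (nat * nat)%type R).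
Proof.
exists (fun n => [set p | (p.1 <= n)%N /\ (p.2 <= n)%N]).
  apply/seteqP; split=> // -[a b] _; exists (maxn a b) => //=.
  by rewrite leq_maxl leq_maxr.
move=> n; split; first exact: measurable_natnat.
have fin : finite_set [set p : nat * nat | (p.1 <= n)%N /\ (p.2 <= n)%N].
  apply: (@sub_finite_set _ _ (`I_n.+1 `*` `I_n.+1)); first by move=> [a b] /= [].
  by apply: finite_setX; exact: finite_II.
by rewrite /counting/= asboolT// ltry.
Qed.



Lemma measurable_fun_countable_snd d d' (W : measurableType d) d2 (C : measurableType d2)
  (T : measurableType d') (f : W * C -> T) : countable [set: C] ->
  (forall c : C, measurable [set c]) ->
  (forall c, measurable_fun setT (fun w => f (w, c))) -> measurable_fun setT f.
Proof.
move=> cC mC mf _ B mB; rewrite setTI.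
rewrite (_ : f @^-1` B = \bigcup_c (((fun w => f (w, c)) @^-1` B) `*` [set c])).
  apply: countable_bigcupT_measurable => // c.
  by apply: measurableX => //; rewrite -[X in measurable X]setTI; exact: mf.
apply/seteqP; split => [[w c] fB|[w c] [c' _ [/= fB ->]]//].
by exists c.
Qed.

Lemma measurable_fun_pairs d d' (W : measurableType d) (T : measurableType d')
  (f : W * (nat * nat) -> T) :
  (forall p, measurable_fun setT (fun w => f (w, p))) -> measurable_fun setT f.
Proof.
move=> mf; apply: (@measurable_fun_countable_snd _ _ W _ (nat * nat)%type) => //.
  exact: countableP.
by move=> c; exact: measurable_natnat.
Qed.

Lemma measurable_fun_natr d d' (W : measurableType d) (T : measurableType d')
  (f : W * nat -> T) :
  (forall p, measurable_fun setT (fun w => f (w, p))) -> measurable_fun setT f.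
Proof.
by move=> mf; apply: (@measurable_fun_countable_snd _ _ W _ nat) => //; exact: countableP.
Qed.

End counting_pairs.

(* The structure on [counting] can be canonical for one index type only, and
   this is [nat]. *)
Definition counting_pairs (R : realType) : set (nat * nat)%type -> \bar R :=
  @counting (nat * nat)%type R.

HB.instance Definition _ (R : realType) :=
  Measure.copy (counting_pairs R) (@counting (nat * nat)%type R).

HB.instance Definition _ (R : realType) := @Measure_isSigmaFinite.Build _ _ R
  (counting_pairs R) (@sigma_finite_counting_pairs R).

(** * Images of measures with densities *)

Section weighted_pushforward.
Import HBNNSimple.
Context d d' (X : measurableType d) (T : measurableType d') (R : realType).
Variables (m : {measure set X -> \bar R}) (k : X -> R) (phi : X -> T).
Hypothesis k0 : forall x, 0 <= k x.
Hypothesis mk : measurable_fun setT k.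
Hypothesis mphi : measurable_fun setT phi.
Local Open Scope ereal_scope.

(** The image under [phi] of the measure with density [k]. The proofs are arguments so that the term
    itself carries the measure structure. Both sides of the identities below are integrals against
    such measures, which brings them under uniqueness theorems. *)
Definition wpush (_ : forall x, (0 <= k x)%R) (_ : measurable_fun setT k)
   (_ : measurable_fun setT phi) (B : set T) : \bar R :=
  \int[m]_x ((k x)%:E * (\1_B (phi x))%:E).

Local Notation nu := (wpush k0 mk mphi).

Let mterm B : measurable B -> measurable_fun setT (fun x => (k x)%:E * (\1_B (phi x))%:E).
Proof.
move=> mB; apply/measurable_EFinP; apply: measurable_funM => //.
by apply: measurableT_comp mphi; exact: measurable_indic.
Qed.

Let wpush0 : nu set0 = 0.
Proof. by rewrite /wpush integral0_eq// => x _; rewrite indic0 mule0. Qed.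

Let wpush_ge0 B : 0 <= nu B.
Proof. by apply: integral_ge0 => x _; rewrite mule_ge0 ?lee_fin//. Qed.

Let wpush_sigma_additive : semi_sigma_additive nu.
Proof.
move=> F mF tF mUF.
have -> : nu (\bigcup_n F n) = \sum_(0 <= n <oo) nu (F n).
  rewrite /wpush -integral_nneseries//; last 2 first.
  - by move=> n; exact: mterm.
  - by move=> n x _; rewrite mule_ge0 ?lee_fin//.
  apply: eq_integral => x _.
  rewrite nneseriesZl; last by move=> n _; rewrite lee_fin.
  by rewrite indic_bigcup.
apply: is_cvg_nneseries => n _ _; exact: wpush_ge0.
Qed.

HB.instance Definition _ := isMeasure.Build _ _ _ nu wpush0 wpush_ge0 wpush_sigma_additive.

Lemma ge0_integral_wpush (f : T -> \bar R) : (forall y, 0 <= f y) -> measurable_fun setT f ->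
  \int[nu]_y f y = \int[m]_x ((k x)%:E * f (phi x)).
Proof.
move=> f0 mf.
have mkE : measurable_fun setT (EFin \o k) by exact/measurable_EFinP.
pose g := nnsfun_approx measurableT mf.
have gE n : \int[nu]_y (g n y)%:E = \int[m]_x ((k x)%:E * (g n (phi x))%:E).
  rewrite integralT_nnsfun sintegralE.
  have e x : (k x)%:E * (g n (phi x))%:E = (\sum_(r \in range (g n))
      ((k x)%:E * (r * \1_(g n @^-1` [set r]) (phi x))%:E)%E)%R.
    rewrite {1}(fimfunE (g n)) -fsumEFin// ge0_mule_fsumr// => r.
    exact: nnfun_muleindic_ge0.
  under [RHS]eq_integral do rewrite e.
  rewrite ge0_integral_fsum//; last 2 first.
  - by move=> r; apply: emeasurable_funM => //; apply/measurable_EFinP;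
      apply: measurable_funM => //; apply: measurableT_comp mphi; exact: measurable_indic.
  - move=> r x _; apply: mule_ge0; first by rewrite lee_fin.
    by have := nnfun_muleindic_ge0 (g n) r (phi x); rewrite -EFinM.
  apply: eq_fsbigr => r _.
  have [r0|r0] := leP 0%R r.
    under eq_integral do rewrite EFinM muleCA.
    by rewrite ge0_integralZl//; [exact: mterm|move=> x _; rewrite mule_ge0 ?lee_fin//].
  rewrite preimage_nnfun0// measure0 mule0 integral0_eq// => x _.
  by rewrite indic0 mulr0 mule0.
have gf y : (g n y)%:E @[n --> \oo] --> f y by apply: cvg_nnsfun_approx => // ? _.
have nd y : {homo (fun n => (g n y)%:E) : a b / (a <= b)%N >-> a <= b}.
  by move=> a b ab; rewrite lee_fin; exact/lefP/nd_nnsfun_approx.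
have l1 := @cvg_monotone_convergence _ _ _ nu setT measurableT (fun n y => (g n y)%:E).
have l2 := @cvg_monotone_convergence _ _ _ m setT measurableT (fun n x => (k x)%:E * (g n (phi x))%:E).
transitivity (limn (fun n => \int[nu]_y (g n y)%:E)).
  rewrite (cvg_lim _ (l1 _ _ _))//.
  - by apply: eq_integral => y _; apply/esym/cvg_lim.
  - by move=> n; exact/measurable_EFinP.
  - by move=> n y _; rewrite lee_fin.
under eq_fun do rewrite gE.
rewrite (cvg_lim _ (l2 _ _ _))//.
- apply: eq_integral => x _; apply/cvg_lim => //.
  by apply: cvgeZl.
- move=> n; apply: emeasurable_funM => //; apply/measurable_EFinP.
  exact: measurableT_comp mphi.
- by move=> n x _; rewrite mule_ge0 ?lee_fin//.
- by move=> x _ a b ab; rewrite lee_wpmul2l ?lee_fin//; have := nd (phi x) a b ab; rewrite lee_fin.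
Qed.

End weighted_pushforward.

(** * Lebesgue measure under translations and dilations *)

Section lebesgue_affine.
Context {R : realType}.
Local Notation RT := (measurableTypeR R).
Local Notation mu := (@lebesgue_measure R).
Local Open Scope ereal_scope.

Lemma lebesgue_measure_translation (a : R) (A : set RT) : measurable A ->
  pushforward mu (fun x : RT => (x + a)%R : RT) A = mu A.
Proof.
have mf : measurable_fun [set: RT] (fun x : RT => (x + a)%R : RT).
  by apply: (@measurable_funD _ _ R) => //; exact: measurable_id.
move=> mA; apply/esym/lebesgue_measure_unique => //= _ [[x y] /= xy <-].
rewrite /pushforward/= (_ : _ @^-1` _ = `](x - a)%R, (y - a)%R]%classic).
  rewrite !lebesgue_measure_itv/= !lte_fin ltrD2r -!EFinB.
  by case: ifP => // _; congr (_%:E); ring.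
by apply/seteqP; split => z /=; rewrite !in_itv/= ltrBlDr lerBrDr.
Qed.

Lemma ge0_integral_translation (a : R) (f : RT -> \bar R) : measurable_fun setT f ->
  (forall x, 0 <= f x) -> \int[mu]_x f x = \int[mu]_x f (x + a)%R.
Proof.
move=> mfun f0.
have mf : measurable_fun [set: RT] (fun x : RT => (x + a)%R : RT).
  by apply: (@measurable_funD _ _ R) => //; exact: measurable_id.
have := @ge0_integral_pushforward _ _ _ _ R _ mf mu setT f measurableT mfun (fun x _ => f0 x).
rewrite preimage_setT => /= <-.
by apply: eq_measure_integral => //= A mA _; rewrite -(lebesgue_measure_translation a mA).
Qed.

Lemma ge0_integral_dilation (a : R) (f : RT -> \bar R) : (0 < a)%R -> measurable_fun setT f ->
  (forall x, 0 <= f x) -> \int[mu]_x f x = a%:E * \int[mu]_x f (a * x)%R.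
Proof.
move=> a0 mfun f0.
have mf : measurable_fun [set: RT] (fun x : RT => (a * x)%R : RT).
  by apply: (@measurable_funM _ _ R) => //; exact: measurable_id.
have := @ge0_integral_pushforward _ _ _ _ R _ mf mu setT f measurableT mfun (fun x _ => f0 x).
rewrite preimage_setT => /= <-.
rewrite -(ge0_integral_mscale _ measurableT (NngNum (ltW a0)))//.
apply: eq_measure_integral => //= A mA _.
apply: lebesgue_measure_unique => //= _ [[x y] /= xy <-].
rewrite /mscale/= /pushforward/= (_ : _ @^-1` _ = `](x / a)%R, (y / a)%R]%classic).
  rewrite !lebesgue_measure_itv/= !lte_fin ltr_pM2r ?invr_gt0// -!EFinB.
  case: ifP => // _; last by rewrite mule0.
  by rewrite -EFinM; congr (_%:E); rewrite mulrBr !mulrA ![(a * _)%R]mulrC !mulfK ?gt_eqF.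
by apply/seteqP; split => z /=; rewrite !in_itv/= ltr_pdivrMr// ler_pdivlMr// mulrC.
Qed.

Lemma ge0_integral_itv_dilation (z : R) (f : RT -> \bar R) : (0 < z)%R ->
  measurable_fun (`]0%R, z[ : set RT) f -> (forall x, (0 < x < z)%R -> 0 <= f x) ->
  \int[mu]_(y in `]0%R, z[) f y = z%:E * \int[mu]_(u in `]0%R, 1%R[) f (z * u)%R.
Proof.
move=> z0 mf f0.
rewrite integral_mkcond (ge0_integral_dilation z0); last 2 first.
- by apply/(measurable_restrictT _ _).1.
- by move=> x; rewrite patchE; case: ifPn => // /set_mem /=; rewrite in_itv/=; exact: f0.
congr (_ * _); rewrite [RHS]integral_mkcond; apply: eq_integral => x _.
rewrite !patchE (_ : (z * x \in `]0%R, z[%classic)%R = (x \in `]0%R, 1%R[%classic))//.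
by apply/idP/idP => /set_mem h; apply/mem_set; move: h; rewrite /= !in_itv/= pmulr_rgt0// gtr_pMr.
Qed.

End lebesgue_affine.

(** * Consequences of homogeneity for the rates *)

Section rate_bounds.
Context {R : realType}.
Local Notation RT := (measurableTypeR R).
Local Notation mu := (@lebesgue_measure R).
Variables (lam : R) (H : R -> R -> R).
Hypothesis lam0 : 0 <= lam.
Hypothesis homH : homogeneous_rate lam H.

Lemma rate_ge0 x y : 0 < x -> 0 < y -> 0 <= H x y.
Proof. by case: homH => _ + _ _; apply. Qed.

(** Homogeneity with factor [x + y] reduces the value at [(x, y)] to one at a point [(u, 1 - u)]. *)
Lemma rate_sup_bound x y : (rate_sup H < +oo)%E -> 0 < x -> 0 < y ->
  H x y <= (x + y) `^ lam * fine (rate_sup H).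
Proof.
move=> supH x0 y0; have [_ H0 _ hom] := homH.
have s0 : 0 < x + y by exact: addr_gt0.
have e : x = (x + y) * (x / (x + y)) by rewrite mulrC divfK ?gt_eqF.
have e' : y = (x + y) * (1 - x / (x + y)).
  by rewrite mulrBr mulr1 -e addrAC subrr add0r.
have u0 : 0 < x / (x + y) by rewrite divr_gt0.
have u1 : x / (x + y) < 1 by rewrite ltr_pdivrMr// mul1r ltrDl.
have := hom (x + y) (x / (x + y)) (1 - x / (x + y)) s0 u0; rewrite subr_gt0 -e -e' => -> //.
rewrite ler_wpM2l ?powR_ge0//.
have h : ((H (x / (x + y)) (1 - x / (x + y)))%:E <= rate_sup H)%E.
  by apply: ereal_sup_ubound; exists (x / (x + y)) => //=; rewrite in_itv/= u0.
rewrite -lee_fin fineK// ge0_fin_numE//; apply: le_trans h.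
by rewrite lee_fin H0// subr_gt0.
Qed.

Lemma rate_sup_ge0 : (rate_sup H < +oo)%E -> 0 <= fine (rate_sup H).
Proof.
move=> supH; have := rate_sup_bound supH (@ltr01 R) (@ltr01 R).
have := rate_ge0 (@ltr01 R) (@ltr01 R) => h1 h2.
have : 0 < (1 + 1 : R) `^ lam by rewrite powR_gt0.
by move=> p; rewrite -(pmulr_rge0 _ p); exact: le_trans h2.
Qed.

Lemma measurable_rate_split z : measurable_fun (`]0, z[ : set RT) (fun y : RT => H y (z - y)).
Proof.
have [mH _ _ _] := homH.
apply: (@measurable_comp _ _ _ _ _ _ (quadrant R) (fun p : RT * RT => H p.1 p.2) _ (fun y : RT => (y, z - y) : RT * RT)) => //.
- rewrite (_ : quadrant R = `]0, +oo[%classic `*` `]0, +oo[%classic).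
    by apply: measurableX; exact: measurable_itv.
  by apply/seteqP; split => -[a b] /=; rewrite /quadrant/= !in_itv/= !andbT.
- by move=> _ [y /= + <-]; rewrite in_itv/= /quadrant/= subr_gt0 => /andP[].
apply: measurable_funTS; apply: measurable_fun_pair; first exact: measurable_id.
by apply: (@measurable_funB _ _ R) => //; exact: measurable_id.
Qed.

(** In the substitution [y = z * u] the length element gives the exponent 1, homogeneity gives
    [lam]. *)
Lemma rate_int_scale z : 0 < z ->
  (\int[mu]_(y in `]0%R, z[) (H y (z - y))%:E = (z `^ (1 + lam))%:E * rate_int H)%E.
Proof.
move=> z0; have [_ H0 _ hom] := homH.
rewrite ge0_integral_itv_dilation//; last 2 first.
- by apply/measurable_EFinP; exact: measurable_rate_split.
- by move=> x /andP[x0 xz]; rewrite lee_fin H0// subr_gt0.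
rewrite powRD ?(gt_eqF z0) ?implybT// powRr1 ?ltW// EFinM -muleA; congr (_ * _)%E.
rewrite /rate_int -ge0_integralZl//; last 3 first.
- by apply/measurable_EFinP; exact: measurable_rate_split.
- by move=> x /=; rewrite in_itv/= => /andP[x0 x1]; rewrite lee_fin H0// subr_gt0.
- by rewrite lee_fin powR_ge0.
apply: eq_integral => u /set_mem /=; rewrite in_itv/= => /andP[u0 u1].
by rewrite -EFinM; congr (_%:E); rewrite -hom ?subr_gt0// mulrBr mulr1.
Qed.

End rate_bounds.

Section integral_tools.
Context {R : realType}.

(** Counting measure on pairs is the product of the counting measures; it is enough to compare them
    on rectangles. *)
Lemma integral_counting_pairs (f : nat * nat -> \bar R) : (forall p, 0 <= f p)%E ->
  (\int[counting]_p f p = \int[counting]_i \int[counting]_j f (i, j))%E.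
Proof.
move=> f0; have mf : measurable_fun setT f by move=> _ B _; exact: measurable_natnat.
transitivity (\int[(@counting nat R : {sigma_finite_measure set nat -> \bar R}) \x
    (@counting nat R : {sigma_finite_measure set nat -> \bar R})]_p f p)%E; last first.
  exact: fubini_tonelli1.
apply: eq_measure_integral => A mA _.
apply/esym; apply: product_measure_unique => // B C _ _.
(* A point in each side is kept: with it, one infinite side makes the rectangle infinite. *)
have [->|/set0P[c Cc]] := eqVneq C set0; first by rewrite setX0 !measure0 mule0.
have [->|/set0P[b Bb]] := eqVneq B set0; first by rewrite set0X !measure0 mul0e.
rewrite -[LHS]/(@counting (nat * nat)%type R (B `*` C)).
rewrite -[RHS]/(@counting nat R B * @counting nat R C)%E.
rewrite /counting; case: (pselect (finite_set B)) => fB; last first.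
  rewrite !(asboolF fB) asboolF; last first.
    move=> fBC; apply: fB; apply: (@sub_finite_set _ _ (fst @` (B `*` C))).
      by move=> b' Bb'; exists (b', c).
    exact: finite_image.
  case: asboolP => fC; last by rewrite mulyy.
  rewrite gt0_mulye// lte_fin ltr0n cardfs_gt0; apply/fset0Pn.
  by exists c; rewrite in_fset_set// inE.
case: (pselect (finite_set C)) => fC; last first.
  rewrite !(asboolF fC) asboolF; last first.
    move=> fBC; apply: fC; apply: (@sub_finite_set _ _ (snd @` (B `*` C))).
      by move=> c' Cc'; exists (b, c').
    exact: finite_image.
  rewrite asboolT// gt0_muley// lte_fin ltr0n cardfs_gt0; apply/fset0Pn.
  by exists b; rewrite in_fset_set// inE.
rewrite !asboolT//; last exact: finite_setX.
rewrite -EFinM -natrM; congr (_%:R%:E).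
rewrite -(size_allpairs pair); apply/perm_size/uniq_perm; first exact: fset_uniq.
  by apply: allpairs_uniq; [exact: fset_uniq|exact: fset_uniq|move=> [x1 x2] [y1 y2]].
move=> [x1 x2]; rewrite in_fset_set; last exact: finite_setX.
apply/idP/allpairsP => [/set_mem[/= Bx Cx]|[[y1 y2] [/= + + [-> ->]]]].
  by exists (x1, x2); split => //=; rewrite in_fset_set// inE.
by rewrite !in_fset_set// !inE; split.
Qed.

(** When [c] is at least [C], the function [b + c] is nonnegative: an integral of a signed function
    against the weight [a] becomes a difference of two integrals of nonnegative functions. *)
Lemma Rintegral_shift d (X : measurableType d) (m : {measure set X -> \bar R})
    (a b : X -> R) (beta c C : R) : measurable_fun setT a -> measurable_fun setT b ->
  (forall x, 0 <= a x) -> (\int[m]_x (a x)%:E < +oo)%E -> (forall x, `|b x| <= C) ->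
  \int[m]_x (a x * (b x - beta)) =
  fine (\int[m]_x (a x * (b x + c))%:E)%E - (beta + c) * fine (\int[m]_x (a x)%:E)%E.
Proof.
move=> ma mb a0 aoo bC.
have ia : m.-integrable setT (EFin \o a).
  apply/integrableP; split; first exact/measurable_EFinP.
  by under eq_integral => x _ do rewrite /= ger0_norm//.
have iab : m.-integrable setT (EFin \o (fun x => a x * (b x + c))).
  have i1 : m.-integrable setT (EFin \o (fun x => (C + `|c|) * a x)).
    by have := integrableZl measurableT (C + `|c|) ia.
  apply: (le_integrable measurableT _ _ i1).
    by apply/measurable_EFinP; apply: measurable_funM => //; exact: measurable_funD.
  move=> x _ /=; rewrite lee_fin !normrM mulrC (ger0_norm (a0 x)) ler_wpM2r//.
  rewrite (le_trans (ler_normD _ _))// (le_trans _ (ler_norm _))// lerD2r//.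
have ica : m.-integrable setT (EFin \o (fun x => (beta + c) * a x)).
  by have := integrableZl measurableT (beta + c) ia.
rewrite -[X in _ - _ * X]/(\int[m]_x a x) -RintegralZl//.
rewrite -[X in X - _]/(\int[m]_x (a x * (b x + c))) -RintegralB//.
by apply: eq_Rintegral => x _; ring.
Qed.

End integral_tools.

(** * Normalized jump rates and their sums *)

Section weights.
Context {R : realType}.
Local Notation RT := (measurableTypeR R).
Local Notation mu := (@lebesgue_measure R).
Variables (lam : R) (H : R -> R -> R).
Implicit Types z : Omega R.

Definition norm_rate z : R := mass z `^ (- (2 + lam)).

(** The jump rates, here and in [frag_weight], are extended by 0 so that sums and integrals have a
    domain independent of the state, as Tonelli's theorem requires. *)
Definition coag_weight z (p : nat * nat) : R :=
  if [&& p.1 != p.2, 0 < z p.1 & 0 < z p.2]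
  then norm_rate z * coag_rate H (z p.1) (z p.2) else 0.

Definition frag_weight z i y : R :=
  if 0 < y < z i then norm_rate z * frag_rate H y (z i - y) else 0.

Hypothesis lam0 : 0 <= lam.
Hypothesis homH : homogeneous_rate lam H.

Lemma norm_rate_gt0 z : 0 < norm_rate z.
Proof. by rewrite powR_gt0// mass_gt0. Qed.

Lemma norm_rateK z : norm_rate z * mass z `^ (2 + lam) = 1.
Proof.
by rewrite /norm_rate powRN mulVf// gt_eqF// powR_gt0// mass_gt0.
Qed.

Lemma measurable_norm_rate : measurable_fun setT norm_rate.
Proof.
exact: (measurableT_comp (measurable_powR _) measurable_mass).
Qed.

Lemma coag_weight_ge0 z p : 0 <= coag_weight z p.
Proof.
rewrite /coag_weight; case: ifPn => // /and3P[_ p1 p2].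
rewrite mulr_ge0 ?(ltW (norm_rate_gt0 z))// /coag_rate.
by apply: mulr_ge0; [rewrite mulr_ge0// ltW|exact: (rate_ge0 homH)].
Qed.

Lemma frag_weight_ge0 z i y : 0 <= frag_weight z i y.
Proof.
rewrite /frag_weight; case: ifPn => // /andP[y0 yz].
have u0 : 0 < z i - y by rewrite subr_gt0.
rewrite mulr_ge0 ?(ltW (norm_rate_gt0 z))// /frag_rate.
by rewrite !mulr_ge0 ?(ltW (addr_gt0 _ _))// (rate_ge0 homH).
Qed.

(** [H] is known to be measurable on the quadrant only, so the composition is confined to a set
    where both arguments are positive. *)
Lemma measurable_rate_comp d (W : measurableType d) (D : set W) (f g : W -> RT) :
  measurable D -> (forall w, D w -> 0 < f w /\ 0 < g w) ->
  measurable_fun D f -> measurable_fun D g -> measurable_fun D (fun w => H (f w) (g w)).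
Proof.
move=> mD fg mf mg; have [mH _ _ _] := homH.
apply: (@measurable_comp _ _ _ _ _ _ (quadrant R) (fun p : RT * RT => H p.1 p.2) _ (fun w => (f w, g w))) => //.
- rewrite (_ : quadrant R = `]0, +oo[%classic `*` `]0, +oo[%classic).
    by apply: measurableX; exact: measurable_itv.
  by apply/seteqP; split => -[a b] /=; rewrite /quadrant/= !in_itv/= !andbT.
- by move=> _ [w Dw <-]; exact: fg.
- apply/(measurable_restrictT (fun w => (f w, g w)) mD).
  have -> : (fun w => (f w, g w)) \_ D = (fun w => ((f \_ D) w, (g \_ D) w)).
    by apply/funext => w; rewrite !patchE; case: ifP.
  by apply: measurable_fun_pair; apply/(measurable_restrictT _ mD).
Qed.

Lemma measurable_coag_weight p : measurable_fun setT (coag_weight ^~ p).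
Proof.
have m1 := @measurable_coordinate R p.1; have m2 := @measurable_coordinate R p.2.
rewrite /coag_weight.
have mc : measurable_fun setT (fun z : Omega R => [&& p.1 != p.2, 0 < z p.1 & 0 < z p.2]).
  by apply: measurable_and => //; apply: measurable_and; apply: measurable_fun_ltr.
apply: measurable_fun_if => //.
set D := _ `&` _; have mD : measurable D by apply: mc.
have D0 (w : Omega R) : D w -> 0 < w p.1 /\ 0 < w p.2 by move=> [_ /= /and3P[]].
apply: measurable_funM; first exact: measurable_funTS measurable_norm_rate.
apply: measurable_funM; first by apply: measurable_funM; exact: measurable_funTS.
by apply: measurable_rate_comp => //; apply: measurable_funTS.
Qed.

Lemma measurable_fun_nat_mid d d' d2 (W : measurableType d) (Y : measurableType d2)
    (T : measurableType d') (f : (W * nat) * Y -> T) :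
  (forall i, measurable_fun setT (fun q : W * Y => f ((q.1, i), q.2))) -> measurable_fun setT f.
Proof.
move=> mf.
rewrite (_ : f = (fun r : (W * Y) * nat => f ((r.1.1, r.2), r.1.2)) \o
    (fun r : (W * nat) * Y => ((r.1.1, r.2), r.1.2))).
  apply: measurableT_comp; first exact: measurable_fun_natr.
  apply: measurable_fun_pair; last first.
    exact: (measurableT_comp measurable_snd measurable_fst).
  apply: measurable_fun_pair; last exact: measurable_snd.
  exact: (measurableT_comp measurable_fst measurable_fst).
by apply/funext => -[[a b] c].
Qed.

Lemma measurable_frag_weight : measurable_fun setT
  (fun q : (Omega R * nat) * RT => frag_weight q.1.1 q.1.2 q.2).
Proof.
apply: measurable_fun_nat_mid => i /=; rewrite /frag_weight.
have mz : measurable_fun setT (fun q : Omega R * RT => q.1 i).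
  exact: (measurableT_comp (measurable_coordinate i) measurable_fst).
have my : measurable_fun setT (fun q : Omega R * RT => q.2 : R) by exact: measurable_snd.
have mc : measurable_fun setT (fun q : Omega R * RT => 0 < q.2 < q.1 i).
  by apply: measurable_and; apply: measurable_fun_ltr.
apply: measurable_fun_if => //.
set D := _ `&` _; have mD : measurable D by apply: mc.
have D0 (q : Omega R * RT) : D q -> 0 < q.2 /\ 0 < q.1 i - q.2.
  by move=> [_ /= /andP[h1 h2]]; rewrite subr_gt0.
apply: measurable_funM.
  by apply: measurable_funTS; exact: (measurableT_comp measurable_norm_rate measurable_fst).
apply: measurable_funM.
  by apply: measurable_funTS; apply: measurable_funD => //; exact: measurable_funB.
apply: measurable_rate_comp => //; apply: measurable_funTS => //; exact: measurable_funB.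
Qed.

Lemma le_mass z i : z i <= mass z.
Proof.
have g0 : forall x : R, (0 <= (Num.max x 0)%:E)%E by move=> x; rewrite lee_fin le_max lexx orbT.
rewrite -lee_fin -gsum_mass (gsum_del i)// max_l ?Omega_ge0//.
by rewrite leeDl// gsum_ge0.
Qed.

Lemma le_mass2 z i j : i != j -> z i + z j <= mass z.
Proof.
have g0 : forall x : R, (0 <= (Num.max x 0)%:E)%E by move=> x; rewrite lee_fin le_max lexx orbT.
wlog ij : i j / (i < j)%N.
  move=> h; rewrite neq_ltn => /orP[ij|ji]; first by apply: h; rewrite // neq_ltn ij.
  by rewrite addrC; apply: h; rewrite // neq_ltn ji.
move=> _; rewrite -lee_fin -gsum_mass (gsum_del j)// (gsum_del i)//.
rewrite /del ij !max_l ?Omega_ge0// addeA -EFinD addrC.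
by rewrite leeDl// gsum_ge0.
Qed.

(** Two distinct entries have sum at most [mass z], so [H] contributes at most [mass z] to the power
    [lam] times its supremum; the products of entries add up to at most the square of the mass. The
    normalization cancels exactly this power. *)
Lemma integral_coag_weight z : (rate_sup H < +oo)%E ->
  (\int[counting]_p (coag_weight z p)%:E <= (fine (rate_sup H))%:E)%E.
Proof.
move=> supH; have C0 := rate_sup_ge0 homH supH.
set C := fine _ in C0 *.
pose k := norm_rate z * mass z `^ lam * C.
have k0 : 0 <= k by rewrite !mulr_ge0 ?powR_ge0.
have kzz i j : 0 <= k * (z i * z j) by rewrite mulr_ge0// mulr_ge0 ?Omega_ge0.
apply: (@le_trans _ _ (\int[counting]_p (k * (z p.1 * z p.2))%:E)%E).
  apply: ge0_le_integral => //; try by move=> _ B _; exact: measurable_natnat.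
  - by move=> p _; rewrite lee_fin coag_weight_ge0.
  - move=> p _; rewrite lee_fin /coag_weight; case: ifPn => [/and3P[p12 p1 p2]|_]; last first.
      exact: kzz.
    rewrite /k -!mulrA ler_wpM2l ?powR_ge0// /coag_rate.
    rewrite [leLHS]mulrC mulrA ler_wpM2r ?mulr_ge0 ?Omega_ge0//.
    apply: (le_trans (rate_sup_bound homH supH p1 p2)).
    rewrite ler_wpM2r// ge0_ler_powR// ?nnegrE ?addr_ge0 ?(ltW (mass_gt0 z)) ?(ltW p1) ?(ltW p2)//.
    exact: le_mass2.
rewrite integral_counting_pairs; last first.
  by move=> p; rewrite lee_fin kzz.
rewrite ge0_integral_count; last first.
  by move=> i; apply: integral_ge0 => j _; rewrite lee_fin kzz.
have inner i : (\int[counting]_j (k * (z i * z j))%:E = (k * mass z)%:E * (z i)%:E)%E.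
  rewrite ge0_integral_count; last by move=> j; rewrite lee_fin kzz.
  rewrite (@eq_eseriesr _ _ (fun j => (k * z i)%:E * (z j)%:E)%E); last first.
    by move=> j _; rewrite -EFinM mulrA.
  by rewrite nneseriesZl ?massE -?EFinM 1?mulrAC// => j _; rewrite lee_fin Omega_ge0.
under eq_eseriesr do rewrite inner.
rewrite nneseriesZl ?massE; last by move=> j _; rewrite lee_fin Omega_ge0.
rewrite -EFinM lee_fin /k.
have -> : norm_rate z * mass z `^ lam * C * mass z * mass z =
   C * (norm_rate z * mass z `^ (2 + lam)).
  rewrite powRD ?(gt_eqF (mass_gt0 z)) ?implybT// powR_mulrn ?ltW ?mass_gt0//.
  by rewrite expr2; ring.
by rewrite norm_rateK mulr1.
Qed.

Lemma integral_frag_weight1 z i :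
  (\int[mu]_y (frag_weight z i y)%:E =
   (norm_rate z * z i * z i `^ (1 + lam))%:E * rate_int H)%E.
Proof.
have [zi|] := ltP 0 (z i); last first.
  rewrite le_eqVlt ltNge Omega_ge0 orbF => /eqP zi.
  rewrite zi mulr0 mul0r mul0e integral0_eq// => y _; rewrite /frag_weight zi.
  by case: ifPn => // /andP[y0 /(lt_trans y0)]; rewrite ltxx.
rewrite EFinM -muleA -(rate_int_scale homH zi) -ge0_integralZl//; last 3 first.
- by apply/measurable_EFinP; exact: (measurable_rate_split homH).
- by move=> y /=; rewrite in_itv/= => /andP[y0 yz]; rewrite lee_fin (rate_ge0 homH)// subr_gt0.
- by rewrite lee_fin mulr_ge0 ?powR_ge0// Omega_ge0.
rewrite [RHS]integral_mkcond; apply: eq_integral => y _; rewrite patchE /frag_weight /frag_rate.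
have -> : (y \in `]0, z i[%classic) = (0 < y < z i).
  by apply/idP/idP => [/set_mem/=|h]; [|apply/mem_set => /=]; rewrite in_itv.
case: ifP => // _; rewrite -EFinM; congr (_%:E); ring.
Qed.

(** The entry [z i] splits at a rate of order [z i] to the power [2 + lam]; all but one factor is
    bounded by the mass, and the remaining factors [z i] add up to the mass. *)
Lemma integral_frag_weight z : (rate_int H < +oo)%E ->
  (\int[counting]_i \int[mu]_y (frag_weight z i y)%:E <= rate_int H)%E.
Proof.
move=> intH.
have r0 : (0 <= rate_int H)%E.
  apply: integral_ge0 => u; rewrite /= in_itv/= => /andP[u0 u1].
  by rewrite lee_fin (rate_ge0 homH)// subr_gt0.
rewrite ge0_integral_count; last first.
  by move=> i; apply: integral_ge0 => y _; rewrite lee_fin frag_weight_ge0.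
have rf : rate_int H \is a fin_num by rewrite ge0_fin_numE.
pose k := norm_rate z * mass z `^ (1 + lam) * fine (rate_int H).
have k0 : 0 <= k by rewrite !mulr_ge0 ?powR_ge0// fine_ge0.
apply: (@le_trans _ _ (\sum_(0 <= i <oo) k%:E * (z i)%:E)%E).
  apply: lee_nneseries => i _.
    by move=> _; apply: integral_ge0 => y _; rewrite lee_fin frag_weight_ge0.
  rewrite integral_frag_weight1 -[in leLHS](fineK rf) -!EFinM lee_fin /k.
  have -> : norm_rate z * z i * z i `^ (1 + lam) * fine (rate_int H) =
      (norm_rate z * fine (rate_int H) * z i) * z i `^ (1 + lam) by ring.
  have -> : norm_rate z * mass z `^ (1 + lam) * fine (rate_int H) * z i =
      (norm_rate z * fine (rate_int H) * z i) * mass z `^ (1 + lam) by ring.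
  rewrite ler_wpM2l ?mulr_ge0 ?powR_ge0 ?fine_ge0 ?Omega_ge0//.
  rewrite ge0_ler_powR ?nnegrE ?addr_ge0 ?Omega_ge0 ?(ltW (mass_gt0 z))//.
  exact: le_mass.
rewrite nneseriesZl ?massE; last by move=> j _; rewrite lee_fin Omega_ge0.
rewrite -EFinM /k.
have -> : norm_rate z * mass z `^ (1 + lam) * fine (rate_int H) * mass z =
   fine (rate_int H) * (norm_rate z * mass z `^ (2 + lam)).
  rewrite (_ : 2 + lam = 1 + (1 + lam)); last by ring.
  by rewrite [in RHS]powRD ?(gt_eqF (mass_gt0 z)) ?implybT// powRr1 ?ltW ?mass_gt0//; ring.
by rewrite norm_rateK mulr1 fineK.
Qed.

End weights.

(** * The normalized generator as gain minus loss *)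

Section generator.
Context {R : realType}.
Local Notation RT := (measurableTypeR R).
Local Notation mu := (@lebesgue_measure R).
Variables (lam : R) (H1 H2 : R -> R -> R).
Hypothesis lam0 : 0 <= lam.
Hypothesis hom1 : homogeneous_rate lam H1.
Hypothesis sup1 : (rate_sup H1 < +oo)%E.
Hypothesis hom2 : homogeneous_rate lam H2.
Hypothesis int2 : (rate_int H2 < +oo)%E.
Implicit Types (z : Omega R) (Phi f g : Omega R -> R).

Local Notation A := (normalized_generator lam (generator H1 H2)).
Local Notation cw := (coag_weight lam H1).
Local Notation fw := (frag_weight lam H2).

(** Gain terms, here and in [frag_part], with values in the extended reals as suits Tonelli's
    theorem; for [f = 1] they are the total jump rates. *)
Definition coag_part f z : \bar R :=
  (\int[counting]_p (cw z p * f (omerge p.1 p.2 z))%:E)%E.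

Definition frag_part f z : \bar R :=
  (\int[counting]_i \int[mu]_y (fw z i y * f (osplit i y z))%:E)%E.

Lemma measurable_coag_term f : measurable_fun setT f ->
  measurable_fun setT (fun q : Omega R * (nat * nat) =>
    (cw q.1 q.2 * f (omerge q.2.1 q.2.2 q.1))%:E).
Proof.
move=> mf; apply: measurable_fun_pairs => p /=; apply/measurable_EFinP.
apply: measurable_funM; first exact: measurable_coag_weight hom1 p.
exact: (measurableT_comp mf (measurable_omerge _ _)).
Qed.

Lemma measurable_osplit_mid : measurable_fun setT
  (fun q : (Omega R * nat) * RT => osplit q.1.2 q.2 q.1.1).
Proof.
apply: measurable_fun_nat_mid => i /=.
apply: (measurableT_comp (measurable_osplit i) (_ : measurable_fun setT (fun q : Omega R * RT => (q.2, q.1)))).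
by apply: measurable_fun_pair; [exact: measurable_snd|exact: measurable_fst].
Qed.

Lemma measurable_frag_term f : measurable_fun setT f ->
  measurable_fun setT (fun q : (Omega R * nat) * RT =>
    (fw q.1.1 q.1.2 q.2 * f (osplit q.1.2 q.2 q.1.1))%:E).
Proof.
move=> mf; apply/measurable_EFinP; apply: measurable_funM.
  exact: measurable_frag_weight hom2.
exact: (measurableT_comp mf measurable_osplit_mid).
Qed.

Let cw0 z p : 0 <= cw z p. Proof. exact: coag_weight_ge0 hom1 z p. Qed.
Let fw0 z i y : 0 <= fw z i y. Proof. exact: frag_weight_ge0 hom2 z i y. Qed.

Lemma measurable_coag_part f : measurable_fun setT f -> (forall z, 0 <= f z) ->
  measurable_fun setT (coag_part f).
Proof.
move=> mf f0.
apply: (measurable_fun_fubini_tonelli_F (m2 := counting_pairs R)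
  (fun q : Omega R * (nat * nat) => (cw q.1 q.2 * f (omerge q.2.1 q.2.2 q.1))%:E)).
  exact: measurable_coag_term.
by move=> q; rewrite lee_fin mulr_ge0.
Qed.

Lemma measurable_frag_part f : measurable_fun setT f -> (forall z, 0 <= f z) ->
  measurable_fun setT (frag_part f).
Proof.
move=> mf f0.
have m1 := measurable_fun_fubini_tonelli_F (m2 := mu) _ (measurable_frag_term mf)
  (fun q => (_ : 0 <= (fw q.1.1 q.1.2 q.2 * f (osplit q.1.2 q.2 q.1.1))%:E)%E).
apply: (measurable_fun_fubini_tonelli_F (m2 := @counting nat R)
  (fun q : Omega R * nat => \int[mu]_y (fw q.1 q.2 y * f (osplit q.2 y q.1))%:E)%E).
  by apply: m1 => q; rewrite lee_fin mulr_ge0.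
by move=> q; apply: integral_ge0 => y _; rewrite lee_fin mulr_ge0.
Qed.

Lemma coag_part_ge0 f z : (forall z, 0 <= f z) -> (0 <= coag_part f z)%E.
Proof. by move=> f0; apply: integral_ge0 => p _; rewrite lee_fin mulr_ge0. Qed.

Lemma frag_part_ge0 f z : (forall z, 0 <= f z) -> (0 <= frag_part f z)%E.
Proof.
move=> f0; apply: integral_ge0 => i _; apply: integral_ge0 => y _.
by rewrite lee_fin mulr_ge0.
Qed.

Let mS z i : measurable_fun setT (fun y : RT => osplit i y z).
Proof.
apply: (measurableT_comp (measurable_osplit i) (_ : measurable_fun setT (fun y : RT => (y, z)))).
exact: measurable_fun_pair.
Qed.

Let mfw z i : measurable_fun setT (fun y : RT => fw z i y).
Proof.
apply: (measurableT_comp (measurable_frag_weight hom2) (_ : measurable_fun setT (fun y : RT => ((z, i), y)))).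
exact: measurable_fun_pair.
Qed.

Lemma coag_part_le f z (C : R) : measurable_fun setT f -> (forall z, 0 <= f z <= C) ->
  (coag_part f z <= (C * fine (rate_sup H1))%:E)%E.
Proof.
move=> mf fC.
have C0 : 0 <= C by have /andP[h] := fC z; exact: le_trans.
apply: (@le_trans _ _ (C%:E * \int[counting]_p (cw z p)%:E)%E); last first.
  by rewrite EFinM lee_wpmul2l ?lee_fin// integral_coag_weight.
have mm (h : nat * nat -> R) : measurable_fun setT (fun p => (h p)%:E).
  by move=> _ B _; exact: measurable_natnat.
rewrite -ge0_integralZl ?lee_fin//; last by move=> p _; rewrite lee_fin.
apply: ge0_le_integral => //.
- by move=> p _; rewrite lee_fin mulr_ge0//; have /andP[] := fC (omerge p.1 p.2 z).
- exact: (mm (fun p => C * cw z p)).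
- move=> p _; rewrite -EFinM lee_fin mulrC ler_wpM2r//.
  by have /andP[] := fC (omerge p.1 p.2 z).
Qed.

Lemma frag_part_le f z (C : R) : measurable_fun setT f -> (forall z, 0 <= f z <= C) ->
  (frag_part f z <= (C * fine (rate_int H2))%:E)%E.
Proof.
move=> mf fC.
have C0 : 0 <= C by have /andP[h] := fC z; exact: le_trans.
have r0 : (0 <= rate_int H2)%E.
  apply: integral_ge0 => u; rewrite /= in_itv/= => /andP[u0 u1].
  by rewrite lee_fin (rate_ge0 hom2)// subr_gt0.
apply: (@le_trans _ _ (C%:E * \int[counting]_i \int[mu]_y (fw z i y)%:E)%E); last first.
  by rewrite EFinM fineK ?ge0_fin_numE// lee_wpmul2l ?lee_fin// integral_frag_weight.
rewrite -ge0_integralZl ?lee_fin//; last first.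
  by move=> i _; apply: integral_ge0 => y _; rewrite lee_fin.
apply: ge0_le_integral => //.
- by move=> i _; apply: integral_ge0 => y _; rewrite lee_fin mulr_ge0//; have /andP[] := fC (osplit i y z).
- move=> i _; rewrite -ge0_integralZl ?lee_fin//; last 2 first.
    by apply/measurable_EFinP; exact: mfw.
    by move=> y _; rewrite lee_fin.
  apply: ge0_le_integral => //.
  + by move=> y _; rewrite lee_fin mulr_ge0//; have /andP[] := fC (osplit i y z).
  + apply/measurable_EFinP; apply: measurable_funM; first exact: mfw.
    exact: (measurableT_comp mf (mS z i)).
  + by apply/measurable_EFinP; apply: measurable_funM => //; exact: mfw.
  + move=> y _; rewrite -EFinM lee_fin mulrC ler_wpM2r//.
    by have /andP[] := fC (osplit i y z).
Qed.

Lemma coag_part_fin f z (C : R) : measurable_fun setT f -> (forall z, 0 <= f z <= C) ->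
  coag_part f z \is a fin_num.
Proof.
move=> mf fC; rewrite ge0_fin_numE; first exact: le_lt_trans (coag_part_le z mf fC) (ltry _).
by apply: coag_part_ge0 => z'; have /andP[] := fC z'.
Qed.

Lemma frag_part_fin f z (C : R) : measurable_fun setT f -> (forall z, 0 <= f z <= C) ->
  frag_part f z \is a fin_num.
Proof.
move=> mf fC; rewrite ge0_fin_numE; first exact: le_lt_trans (frag_part_le z mf fC) (ltry _).
by apply: frag_part_ge0 => z'; have /andP[] := fC z'.
Qed.

(** The shift [c] cancels between gain and loss. For [c = C] the shifted function is nonnegative. *)
Lemma generator_coagE Phi z (c C : R) : measurable_fun setT Phi -> (forall z, `|Phi z| <= C) ->
  norm_rate lam z * \int[counting]_(p in pos_pairs z)
    (coag_rate H1 (z p.1) (z p.2) * (Phi (merge p.1 p.2 z) - Phi z)) =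
  fine (coag_part (fun z => Phi z + c) z) - (Phi z + c) * fine (coag_part (fun=> 1) z).
Proof.
move=> mPhi PhiC.
have mm (h : nat * nat -> R) : measurable_fun setT h.
  by move=> _ B _; exact: measurable_natnat.
have woo : (\int[counting]_p (cw z p)%:E < +oo)%E.
  by apply: le_lt_trans (ltry _); exact: integral_coag_weight.
rewrite [X in _ - _ * fine X](_ : _ = \int[counting]_p (cw z p)%:E)%E; last first.
  by apply: eq_integral => p _; rewrite mulr1.
rewrite -(@Rintegral_shift _ _ _ counting (cw z) (fun p => Phi (omerge p.1 p.2 z)) (Phi z) c C)//.
have D x : x \in pos_pairs z -> cw z x * (Phi (omerge x.1 x.2 z) - Phi z) =
   norm_rate lam z * (coag_rate H1 (z x.1) (z x.2) * (Phi (merge x.1 x.2 z) - Phi z)).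
  move=> /set_mem [/= x12 x1 x2]; rewrite /coag_weight x12 x1 x2/= /omerge x12.
  by rewrite mulrA.
transitivity (\int[counting]_(p in pos_pairs z) (cw z p * (Phi (omerge p.1 p.2 z) - Phi z))).
  rewrite -RintegralZl.
  - by apply/esym; apply: eq_Rintegral => x xz; exact: D.
  - exact: measurable_natnat.
  (* The dominating function: [2 * C] bounds a difference of two values of [Phi], and the inverse of
     [norm_rate] undoes the normalization contained in the weight. *)
  - have i1 : (@counting (nat * nat)%type R).-integrable setT (EFin \o (fun x => (norm_rate lam z)^-1 * (2 * C) * cw z x)).
      have ia : (@counting (nat * nat)%type R).-integrable setT (EFin \o cw z).
        apply/integrableP; split; first exact/measurable_EFinP.
        by under eq_integral => x _ do rewrite /= ger0_norm//.
      by have := integrableZl measurableT ((norm_rate lam z)^-1 * (2 * C)) ia.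
    apply: (@le_integrable _ _ _ counting _ (@measurable_natnat _) _ (EFin \o (fun x => (norm_rate lam z)^-1 * (2 * C) * cw z x))).
    + by apply: measurable_funTS; apply/measurable_EFinP; exact: mm.
    + move=> x xz /=; rewrite lee_fin.
      have n0 := norm_rate_gt0 lam z.
      have -> : coag_rate H1 (z x.1) (z x.2) * (Phi (merge x.1 x.2 z) - Phi z) =
         (norm_rate lam z)^-1 * (cw z x * (Phi (omerge x.1 x.2 z) - Phi z)).
        by rewrite D ?inE// mulKf// gt_eqF.
      rewrite !normrM -!mulrA ler_wpM2l// mulrC [leRHS]mulrA ler_wpM2r//.
      rewrite -normrM (le_trans (ler_normB _ _))// (le_trans _ (ler_norm _))//.
      by rewrite mulr_natl mulr2n lerD.
    + apply: integrableS i1 => //; exact: measurable_natnat.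
rewrite Rintegral_mkcond; apply: eq_Rintegral => x _; rewrite patchE.
case: ifPn => // /negP xz; rewrite /coag_weight; case: ifPn => [/and3P[x12 x1 x2]|]; last by rewrite mul0r.
by exfalso; apply: xz; apply/mem_set.
Qed.

Lemma generator_fragE1 Phi z (c C : R) i : measurable_fun setT Phi -> (forall z, `|Phi z| <= C) ->
  0 < z i ->
  norm_rate lam z * \int[mu]_(y in `]0, z i[)
    (frag_rate H2 y (z i - y) * (Phi (split i y z) - Phi z)) =
  fine (\int[mu]_y (fw z i y * (Phi (osplit i y z) + c))%:E)%E -
  (Phi z + c) * fine (\int[mu]_y (fw z i y)%:E)%E.
Proof.
move=> mPhi PhiC zi.
have woo : (\int[mu]_y (fw z i y)%:E < +oo)%E.
  rewrite (integral_frag_weight1 hom2) muleC.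
  have r0 : (0 <= rate_int H2)%E.
    apply: integral_ge0 => u; rewrite /= in_itv/= => /andP[u0 u1].
    by rewrite lee_fin (rate_ge0 hom2)// subr_gt0.
  by rewrite -(@fineK _ (rate_int H2)) ?ge0_fin_numE// -EFinM ltry.
have mPS : measurable_fun setT (fun y : RT => Phi (osplit i y z)).
  exact: (measurableT_comp mPhi (mS z i)).
rewrite -(@Rintegral_shift _ _ _ mu (fw z i) (fun y => Phi (osplit i y z)) (Phi z) c C)//.
have D (x : RT) : x \in `]0, z i[%classic -> fw z i x * (Phi (osplit i x z) - Phi z) =
   norm_rate lam z * (frag_rate H2 x (z i - x) * (Phi (split i x z) - Phi z)).
  move=> /set_mem /=; rewrite in_itv/= => /[dup] h /andP[x0 xz].
  by rewrite /frag_weight h /osplit (ltW x0) (ltW xz)/= mulrA.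
transitivity (\int[mu]_(y in `]0, z i[) (fw z i y * (Phi (osplit i y z) - Phi z))).
  rewrite -RintegralZl.
  - by apply/esym; apply: eq_Rintegral => x xz; exact: D.
  - exact: measurable_itv.
  - have i1 : mu.-integrable setT (EFin \o (fun x => (norm_rate lam z)^-1 * (2 * C) * fw z i x)).
      have ia : mu.-integrable setT (EFin \o fw z i).
        apply/integrableP; split; first exact/measurable_EFinP.
        by under eq_integral => x _ do rewrite /= ger0_norm//.
      by have := integrableZl measurableT ((norm_rate lam z)^-1 * (2 * C)) ia.
    have i2 : mu.-integrable `]0, z i[ (EFin \o (fun x => (norm_rate lam z)^-1 * (fw z i x * (Phi (osplit i x z) - Phi z)))).
      apply: (@le_integrable _ _ _ mu _ (measurable_itv _) _ (EFin \o (fun x => (norm_rate lam z)^-1 * (2 * C) * fw z i x))).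
      + apply: measurable_funTS; apply/measurable_EFinP.
        by apply: measurable_funM => //; apply: measurable_funM => //; exact: measurable_funB.
      + move=> x xz /=; rewrite lee_fin.
        rewrite !normrM -!mulrA ler_wpM2l// mulrC [leRHS]mulrA ler_wpM2r//.
        rewrite -normrM (le_trans (ler_normB _ _))// (le_trans _ (ler_norm _))//.
        by rewrite mulr_natl mulr2n lerD.
      + by apply: integrableS i1 => //; exact: measurable_itv.
    apply: eq_integrable i2; first exact: measurable_itv.
    by move=> x xz /=; rewrite D// mulKf// gt_eqF// norm_rate_gt0.
rewrite Rintegral_mkcond; apply: eq_Rintegral => x _; rewrite patchE.
case: ifPn => // /negP xz; rewrite /frag_weight; case: ifPn => [h|]; last by rewrite mul0r.
by exfalso; apply: xz; apply/mem_set; rewrite /= in_itv.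
Qed.

End generator.

Lemma norm_half_diff (R : realFieldType) (u t K : R) :
  0 <= u -> u <= K + K -> 0 <= t -> t <= K + K -> `|2^-1 * (u - t)| <= K.
Proof. by move=> *; rewrite ler_norml; apply/andP; split; lra. Qed.

Section generator_symmetry.
Context {R : realType}.
Local Notation RT := (measurableTypeR R).
Local Notation mu := (@lebesgue_measure R).
Variables (lam : R) (H1 H2 : R -> R -> R).
Hypothesis lam0 : 0 <= lam.
Hypothesis hom1 : homogeneous_rate lam H1.
Hypothesis sup1 : (rate_sup H1 < +oo)%E.
Hypothesis hom2 : homogeneous_rate lam H2.
Hypothesis int2 : (rate_int H2 < +oo)%E.
Implicit Types (z : Omega R) (Phi Psi f g : Omega R -> R).

Local Notation A := (normalized_generator lam (generator H1 H2)).
Local Notation cw := (coag_weight lam H1).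
Local Notation fw := (frag_weight lam H2).
Local Notation coag f := (coag_part lam H1 f).
Local Notation frag f := (frag_part lam H2 f).

Let cw0 z p : 0 <= cw z p. Proof. exact: coag_weight_ge0 hom1 z p. Qed.
Let fw0 z i y : 0 <= fw z i y. Proof. exact: frag_weight_ge0 hom2 z i y. Qed.

Let mfw z i : measurable_fun setT (fun y : RT => fw z i y).
Proof.
apply: (measurableT_comp (measurable_frag_weight hom2) (_ : measurable_fun setT (fun y : RT => ((z, i), y)))).
exact: measurable_fun_pair.
Qed.

Let mS z i : measurable_fun setT (fun y : RT => osplit i y z).
Proof.
apply: (measurableT_comp (measurable_osplit i) (_ : measurable_fun setT (fun y : RT => (y, z)))).
exact: measurable_fun_pair.
Qed.

Let b1 z : 0 <= (fun=> 1 : R) z <= (1 : R). Proof. by rewrite ler01 lexx. Qed.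

(** The generator sums real-valued inner integrals over [i]. Their finiteness is what allows [fine]
    to be moved outside the sum. *)
Let integrable_frag_term f z (C : R) : measurable_fun setT f -> (forall z, 0 <= f z <= C) ->
  let F i := (\int[mu]_y (fw z i y * f (osplit i y z))%:E)%E in
  (forall i, F i \is a fin_num) /\
  (@counting nat R).-integrable setT (fun i => (fine (F i))%:E).
Proof.
move=> mf fC F.
have F0 i : (0 <= F i)%E.
  by apply: integral_ge0 => y _; rewrite lee_fin mulr_ge0//; have /andP[] := fC (osplit i y z).
have Foo : (\int[counting]_i F i < +oo)%E.
  by rewrite -ge0_fin_numE; [exact: frag_part_fin fC|exact: integral_ge0].
have Ffin i : F i \is a fin_num.
  rewrite ge0_fin_numE//; apply: le_lt_trans Foo.
  rewrite ge0_integral_count// (@nneseriesD1 _ F i xpredT)//; first by rewrite leeDl// nneseries_ge0.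
split => //; apply/integrableP; split; first by [].
under eq_integral => i _ do rewrite /= ger0_norm ?fine_ge0// fineK//.
by [].
Qed.

Lemma generator_fragE Phi z (C : R) : measurable_fun setT Phi -> (forall z, `|Phi z| <= C) ->
  norm_rate lam z * \int[counting]_(i in pos_idx z) \int[mu]_(y in `]0, z i[)
    (frag_rate H2 y (z i - y) * (Phi (split i y z) - Phi z)) =
  fine (frag (fun z => Phi z + C) z) - (Phi z + C) * fine (frag (fun=> 1) z).
Proof.
move=> mPhi PhiC.
have bf z' : 0 <= Phi z' + C <= C + C.
  by have := PhiC z'; rewrite ler_norml lerD2r => /andP[h1 ->]; rewrite -lerBlDr sub0r h1.
have mf : measurable_fun setT (fun z => Phi z + C) by exact: measurable_funD.
have [aF ia] := integrable_frag_term z mf bf.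
have [bF ib] := integrable_frag_term z (measurable_cst (1 : R)) b1.
pose a i := fine (\int[mu]_y (fw z i y * (Phi (osplit i y z) + C))%:E)%E.
pose b i := fine (\int[mu]_y (fw z i y * 1)%:E)%E.
have ib' : (@counting nat R).-integrable setT (EFin \o b) by exact: ib.
have ikb : (@counting nat R).-integrable setT (EFin \o (fun i => (Phi z + C) * b i)).
  by have := integrableZl measurableT (Phi z + C) ib'.
have n0 := norm_rate_gt0 lam z.
have bE i : b i = fine (\int[mu]_y (fw z i y)%:E)%E.
  by rewrite /b; congr fine; apply: eq_integral => y _; rewrite mulr1.
have iab : (@counting nat R).-integrable setT (EFin \o (fun i => a i - (Phi z + C) * b i)).
  exact: (integrableB measurableT ia ikb).
transitivity (\int[counting]_i (a i - (Phi z + C) * b i)); last first.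
  rewrite RintegralB// RintegralZl//.
  by congr (_ - _ * _); congr fine; apply: eq_integral => i _; rewrite fineK//; exact: aF || exact: bF.
transitivity (norm_rate lam z *
    \int[counting]_(i in pos_idx z) ((norm_rate lam z)^-1 * (a i - (Phi z + C) * b i))).
  congr (_ * _); apply: eq_Rintegral => i /set_mem/= zi.
  rewrite bE -(generator_fragE1 hom2 int2 C mPhi PhiC zi) mulKf//.
  by rewrite gt_eqF.
rewrite RintegralZl//; last exact: integrableS iab.
rewrite mulrA mulfV ?gt_eqF// mul1r Rintegral_mkcond.
apply: eq_Rintegral => i _; rewrite patchE; case: ifPn => // /negP zi.
have zi0 : (0 < z i) = false.
  by apply/negbTE/negP => zi'; apply: zi; apply/mem_set.
have fwz y : fw z i y = 0.
  rewrite /frag_weight; case: ifPn => // /andP[y0 /(lt_trans y0)].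
  by rewrite zi0.
rewrite /a /b; under eq_integral do rewrite fwz mul0r.
rewrite integral0; under eq_integral do rewrite fwz mul0r.
by rewrite integral0 /= mulr0 subr0.
Qed.

Let gpart f z := fine (coag f z) + fine (frag f z).

Lemma normalized_generatorE Phi z (C : R) :
  measurable_fun setT Phi -> (forall z, `|Phi z| <= C) ->
  A Phi z = 2^-1 * (gpart (fun z => Phi z + C) z - (Phi z + C) * gpart (fun=> 1) z).
Proof.
move=> mPhi PhiC.
have e1 := generator_coagE lam0 hom1 sup1 z C mPhi PhiC.
have e2 := generator_fragE z mPhi PhiC.
have E (n x1 x2 a b k p q : R) : n * x1 = a - k * p -> n * x2 = b - k * q ->
    n * (2^-1 * x1 + 2^-1 * x2) = 2^-1 * ((a + b) - k * (p + q)).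
  by move=> h1 h2; rewrite mulrDr !(mulrCA n) h1 h2; ring.
exact: E e1 e2.
Qed.

Let measurable_gpart f : measurable_fun setT f -> (forall z, 0 <= f z) ->
  measurable_fun setT (gpart f).
Proof.
move=> mf f0; apply: measurable_funD.
  apply: (measurableT_comp (fine_measurable measurableT)).
  exact: measurable_coag_part.
apply: (measurableT_comp (fine_measurable measurableT)).
exact: measurable_frag_part.
Qed.

Let M := fine (rate_sup H1) + fine (rate_int H2).

Let gpart_bound f z (C : R) : measurable_fun setT f -> (forall z, 0 <= f z <= C) ->
  0 <= gpart f z <= C * M.
Proof.
move=> mf fC.
have f0 z' : 0 <= f z' by have /andP[] := fC z'.
have c0 := coag_part_ge0 hom1 z f0; have r0 := frag_part_ge0 hom2 z f0.
rewrite /gpart addr_ge0 ?fine_ge0//= /M mulrDr lerD// -lee_fin fineK.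
- exact: coag_part_le.
- exact: coag_part_fin fC.
- exact: frag_part_le.
- exact: frag_part_fin fC.
Qed.

Let bshift Phi (C : R) : (forall z, `|Phi z| <= C) -> forall z, 0 <= Phi z + C <= C + C.
Proof.
move=> PhiC z; have := PhiC z; rewrite ler_norml lerD2r => /andP[h1 ->].
by rewrite -lerBlDr sub0r h1.
Qed.

Lemma normalized_generator_measurable Phi : bounded_borel Phi -> measurable_fun setT (A Phi).
Proof.
move=> [mPhi [C PhiC]].
have mf : measurable_fun setT (fun z => Phi z + C) by exact: measurable_funD.
rewrite (_ : A Phi = fun z => 2^-1 * (gpart (fun z => Phi z + C) z - (Phi z + C) * gpart (fun=> 1) z)).
  apply: measurable_funM => //; apply: measurable_funB.
    by apply: measurable_gpart => // z; have /andP[] := bshift PhiC z.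
  apply: measurable_funM => //; apply: measurable_gpart => // z; exact: ler01.
by apply/funext => z; exact: normalized_generatorE.
Qed.

(** Gain and loss of the shifted function lie between 0 and [2 * C * M]; the factor one half of the
    generator compensates for the doubling. *)
Lemma normalized_generator_bound Phi (C : R) : measurable_fun setT Phi ->
  (forall z, `|Phi z| <= C) -> forall z, `|A Phi z| <= M * C.
Proof.
move=> mPhi PhiC z; rewrite (normalized_generatorE z mPhi PhiC).
have mf : measurable_fun setT (fun z => Phi z + C) by exact: measurable_funD.
have /andP[x0 x1] := gpart_bound z mf (bshift PhiC).
have /andP[y0 y1] := gpart_bound z (measurable_cst (1 : R)) b1.
have /andP[c0 c1] := bshift PhiC z.
rewrite mul1r in y1.
have t0 : 0 <= (Phi z + C) * gpart (fun=> 1) z by rewrite mulr_ge0.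
have t1 : (Phi z + C) * gpart (fun=> 1) z <= (C + C) * M by rewrite ler_pM.
by apply: norm_half_diff; rewrite ?[M * C]mulrC -?mulrDl.
Qed.

Lemma rate_bound_ge0 : 0 <= M.
Proof.
(* Applied to the zero function with [C = 1], the bound says that an absolute value is at most
   [M]. *)
have := normalized_generator_bound (measurable_cst (0 : R)) (fun=> (_ : `|0 : R| <= 1)) (point : Omega R).
rewrite mulr1 => h; apply: le_trans (h _) => //; by rewrite normr0 ler01.
Qed.

Lemma normalized_generator_mass Phi (B : set R) :
  A (fun z => \1_B (mass z) * Phi z) = (fun z => \1_B (mass z) * A Phi z).
Proof.
apply/funext => z; rewrite /normalized_generator /generator.
(* Jumps preserve the mass, so the indicator has the same value [b] at [z] and at every state
   reached from it. Cases on [b] take it out of the integrals without any integrability of [Phi]. *)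
have [b [bE]] : exists b : bool, \1_B (mass z) = b%:R :> R.
  by exists (mass z \in B); rewrite indicE.
transitivity (norm_rate lam z * (2^-1 * \int[counting]_(p in pos_pairs z)
    (b%:R * (coag_rate H1 (z p.1) (z p.2) * (Phi (merge p.1 p.2 z) - Phi z))) +
  2^-1 * \int[counting]_(i in pos_idx z) (b%:R * \int[mu]_(y in `]0, z i[)
    (frag_rate H2 y (z i - y) * (Phi (split i y z) - Phi z))))).
  congr (_ * (_ * _ + _ * _)).
    apply: eq_Rintegral => p /set_mem[/= p12 p1 p2].
    by rewrite mass_merge// bE; ring.
  apply: eq_Rintegral => i /set_mem/= zi.
  transitivity (\int[mu]_(y in `]0, z i[) (b%:R *
     (frag_rate H2 y (z i - y) * (Phi (split i y z) - Phi z)))).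
    apply: eq_Rintegral => y /set_mem /=; rewrite in_itv/= => /andP[y0 yz].
    by rewrite mass_split ?(ltW y0) ?(ltW yz)// bE; ring.
  case: b {bE} => /=.
    by rewrite mul1r; apply: eq_Rintegral => y _; rewrite mul1r.
  by rewrite mul0r; under eq_Rintegral do rewrite mul0r; rewrite /Rintegral integral0.
rewrite bE; case: b {bE} => /=.
  rewrite mul1r; congr (_ * (_ * _ + _ * _)); apply: eq_Rintegral => y _; by rewrite mul1r.
rewrite mul0r; under eq_Rintegral do rewrite mul0r.
under [X in _ + _ * X]eq_Rintegral do rewrite mul0r.
by rewrite /Rintegral !integral0 /= !mulr0 addr0 mulr0.
Qed.

(** * Symmetry of the generator from detailed balance *)

Section symmetry.
Context d (W : measurableType d) (P : probability W R) (X : W -> Omega R).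
Hypothesis mX : measurable_fun setT X.
Hypothesis balance : forall h : Omega R * Omega R -> R, measurable_fun setT h ->
  (forall q, 0 <= h q) ->
  (\int[P]_w \int[counting]_p (cw (X w) p * h (X w, omerge p.1 p.2 (X w)))%:E =
   \int[P]_w \int[counting]_i \int[mu]_y (fw (X w) i y * h (osplit i y (X w), X w))%:E)%E.

(** Detailed balance for the test function [g z * f z'] of a pair [(z, z')]. *)
Let balance_coag f g (C D : R) : measurable_fun setT f -> (forall z, 0 <= f z <= C) ->
  measurable_fun setT g -> (forall z, 0 <= g z <= D) ->
  (\int[P]_w (g (X w) * fine (coag f (X w)))%:E =
   \int[P]_w (f (X w) * fine (frag g (X w)))%:E)%E.
Proof.
move=> mf fC mg gD.
have f0 z : 0 <= f z by have /andP[] := fC z.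
have g0 z : 0 <= g z by have /andP[] := gD z.
have e1 w : (g (X w) * fine (coag f (X w)))%:E =
    (\int[counting]_p (cw (X w) p * (g (X w) * f (omerge p.1 p.2 (X w))))%:E)%E.
  rewrite EFinM fineK; last exact: coag_part_fin fC.
  rewrite -ge0_integralZl ?lee_fin//.
  - by apply: eq_integral => p _; rewrite -EFinM; congr EFin; ring.
  - by move=> _ B _; exact: measurable_natnat.
  - by move=> p _; rewrite lee_fin mulr_ge0.
have e2 w : (f (X w) * fine (frag g (X w)))%:E =
    (\int[counting]_i \int[mu]_y (fw (X w) i y * (g (osplit i y (X w)) * f (X w)))%:E)%E.
  rewrite EFinM fineK; last exact: frag_part_fin gD.
  have i0 i : (0 <= \int[mu]_y (fw (X w) i y * g (osplit i y (X w)))%:E)%E.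
    by apply: integral_ge0 => y _; rewrite lee_fin mulr_ge0.
  rewrite -ge0_integralZl ?lee_fin//.
  apply: eq_integral => i _; rewrite -ge0_integralZl ?lee_fin//.
  - by apply: eq_integral => y _; rewrite -EFinM; congr EFin; ring.
  - apply/measurable_EFinP; apply: measurable_funM; first exact: mfw.
    exact: (measurableT_comp mg (mS (X w) i)).
  - by move=> y _; rewrite lee_fin mulr_ge0.
under eq_integral do rewrite e1; under [RHS]eq_integral do rewrite e2.
apply: (balance (h := fun q => g q.1 * f q.2)).
  apply: measurable_funM.
    exact: (measurableT_comp mg measurable_fst).
  exact: (measurableT_comp mf measurable_snd).
by move=> q; rewrite mulr_ge0.
Qed.

Let bnd_int (h : Omega R -> R) (C : R) : measurable_fun setT h -> (forall z, `|h z| <= C) ->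
  P.-integrable setT (EFin \o (h \o X)).
Proof.
move=> mh hC.
exact: (@bounded_integrable _ _ _ P setT (h \o X) C measurableT (measurableT_comp mh mX) (fun w => hC _)).
Qed.

Let prod_int f g (C D : R) : measurable_fun setT f -> (forall z, 0 <= f z <= C) ->
  measurable_fun setT g -> (forall z, 0 <= g z <= D) ->
  P.-integrable setT (EFin \o (fun w => g (X w) * f (X w))).
Proof.
move=> mf fC mg gD.
apply: (@bnd_int (fun z => g z * f z) (D * C)); first exact: measurable_funM.
move=> z; have /andP[f0 fc] := fC z; have /andP[g0 gd] := gD z.
by rewrite ger0_norm ?mulr_ge0// ler_pM.
Qed.

Let part_bound f z (C : R) : measurable_fun setT f -> (forall z, 0 <= f z <= C) ->
  0 <= fine (coag f z) <= C * fine (rate_sup H1) /\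
  0 <= fine (frag f z) <= C * fine (rate_int H2).
Proof.
move=> mf fC.
have f0 z' : 0 <= f z' by have /andP[] := fC z'.
have c0 := coag_part_ge0 hom1 z f0; have r0 := frag_part_ge0 hom2 z f0.
rewrite !fine_ge0//= -!lee_fin !fineK.
- by split; [exact: coag_part_le|exact: frag_part_le].
- exact: frag_part_fin fC.
- exact: coag_part_fin fC.
Qed.

(** Coagulation and fragmentation trade places under the exchange of [f] and [g]; only their sum is
    symmetric. *)
Let gpart_sym f g (C D : R) : measurable_fun setT f -> (forall z, 0 <= f z <= C) ->
  measurable_fun setT g -> (forall z, 0 <= g z <= D) ->
  \int[P]_w (g (X w) * gpart f (X w)) = \int[P]_w (f (X w) * gpart g (X w)).
Proof.
move=> mf fC mg gD.
have E (h k : Omega R -> R) (C' D' : R) : measurable_fun setT h -> (forall z, 0 <= h z <= C') ->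
  measurable_fun setT k -> (forall z, 0 <= k z <= D') ->
  \int[P]_w (k (X w) * gpart h (X w)) =
  \int[P]_w (k (X w) * fine (coag h (X w))) + \int[P]_w (k (X w) * fine (frag h (X w))).
  move=> mh hC mk kD.
  have h0 z' : 0 <= h z' by have /andP[] := hC z'.
  rewrite -RintegralD//.
  - by apply: eq_Rintegral => w _; rewrite /gpart mulrDr.
  - apply: (@prod_int (fun z => fine (coag h z)) k (C' * fine (rate_sup H1)) D' _ _ mk kD) => [|z]; last by have [] := part_bound z mh hC.
    apply: (measurableT_comp (fine_measurable measurableT)).
    exact: measurable_coag_part.
  - apply: (@prod_int (fun z => fine (frag h z)) k (C' * fine (rate_int H2)) D' _ _ mk kD) => [|z]; last by have [] := part_bound z mh hC.
    apply: (measurableT_comp (fine_measurable measurableT)).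
    exact: measurable_frag_part.
apply: etrans (E f g C D mf fC mg gD) _; apply: etrans _ (esym (E g f D C mg gD mf fC)).
rewrite addrC; congr (fine _ + fine _); last exact: balance_coag fC mg gD.
by apply/esym; exact: balance_coag gD mf fC.
Qed.

(** Written with both functions shifted, the gain is symmetric by [gpart_sym], and the loss is the
    integral of a product symmetric in the two functions. *)
Lemma normalized_generator_sym Phi Psi : bounded_borel Phi -> bounded_borel Psi ->
  \int[P]_w (Psi (X w) * A Phi (X w)) = \int[P]_w (Phi (X w) * A Psi (X w)).
Proof.
have E (F G : Omega R -> R) (C D : R) : measurable_fun setT F -> (forall z, `|F z| <= C) ->
    measurable_fun setT G -> (forall z, `|G z| <= D) ->
  \int[P]_w (G (X w) * A F (X w)) = 2^-1 * (
    \int[P]_w ((G (X w) + D) * gpart (fun z => F z + C) (X w)) -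
    \int[P]_w ((G (X w) + D) * ((F (X w) + C) * gpart (fun=> 1) (X w)))).
  move=> mF FC mG GD.
  pose f z := F z + C; pose g z := G z + D.
  have mf : measurable_fun setT f by exact: measurable_funD.
  have mg : measurable_fun setT g by exact: measurable_funD.
  have bf : forall z, 0 <= f z <= C + C := bshift FC.
  have bg : forall z, 0 <= g z <= D + D := bshift GD.
  have mpf : measurable_fun setT (gpart f) by apply: measurable_gpart => // z; have /andP[] := bf z.
  have mp1 : measurable_fun setT (gpart (fun=> 1)) by apply: measurable_gpart => // z; exact: ler01.
  have bpf z := gpart_bound z mf bf.
  have bp1 z := gpart_bound z (measurable_cst (1 : R)) b1.
  have mfp : measurable_fun setT (fun z => f z * gpart (fun=> 1) z) by exact: measurable_funM.
  have bfp z : 0 <= f z * gpart (fun=> 1) z <= (C + C) * (1 * M).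
    have /andP[x0 x1] := bf z; have /andP[y0 y1] := bp1 z.
    by rewrite mulr_ge0// ler_pM.
  have i1 := prod_int mpf bpf mg bg.
  have i2 := prod_int mfp bfp mg bg.
  have i3 := prod_int mpf bpf (measurable_cst (1 : R)) b1.
  have i4 := prod_int mfp bfp (measurable_cst (1 : R)) b1.
  (* Symmetry against the constant 1: [A F] has integral zero, so replacing [G] by [G + D] changes
     nothing. *)
  have s1 : \int[P]_w (1 * gpart f (X w)) = \int[P]_w (1 * (f (X w) * gpart (fun=> 1) (X w))).
    rewrite (gpart_sym mf bf (measurable_cst (1 : R)) b1).
    by apply: eq_Rintegral => w _; rewrite mul1r.
  transitivity (\int[P]_w (2^-1 * ((g (X w) * gpart f (X w) - g (X w) * (f (X w) * gpart (fun=> 1) (X w)))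
     - D * (1 * gpart f (X w) - 1 * (f (X w) * gpart (fun=> 1) (X w)))))).
    have E (a b F' G' : R) : G' * (2^-1 * (a - (F' + C) * b)) =
        2^-1 * (((G' + D) * a - (G' + D) * ((F' + C) * b)) - D * (1 * a - 1 * ((F' + C) * b))).
      by ring.
    by apply: eq_Rintegral => w _; rewrite (normalized_generatorE (X w) mF FC); exact: E.
  have i12 := integrableB measurableT i1 i2.
  have i34 := integrableB measurableT i3 i4.
  have iD34 := integrableZl measurableT D i34.
  have i5 := integrableB measurableT i12 iD34.
  by rewrite RintegralZl// RintegralB// RintegralB// RintegralZl// RintegralB// s1 subrr mulr0 subr0.
move=> [mPhi [C PhiC]] [mPsi [D PsiD]].
have mf : measurable_fun setT (fun z => Phi z + C) by exact: measurable_funD.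
have mg : measurable_fun setT (fun z => Psi z + D) by exact: measurable_funD.
have e1 := @gpart_sym (fun z => Phi z + C) (fun z => Psi z + D) (C + C) (D + D) mf (bshift PhiC) mg (bshift PsiD).
have K (a b c e : R) : a = c -> b = e -> 2^-1 * (a - b) = 2^-1 * (c - e) by move=> -> ->.
apply: etrans (E Phi Psi C D mPhi PhiC mPsi PsiD) _.
apply: etrans _ (esym (E Psi Phi D C mPsi PsiD mPhi PhiC)).
apply: K; first exact: e1.
by apply: eq_Rintegral => w _; rewrite mulrCA.
Qed.

Lemma reversible_of_balance (pi : set (Omega R) -> \bar R) :
  (forall B, measurable B -> pi B = pushforward P X B) ->
  reversible lam (generator H1 H2) pi.
Proof.
move=> piE; apply: (reversible_of_symmetric rate_bound_ge0 _ _ _ mX piE).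
- exact: normalized_generator_measurable.
- exact: normalized_generator_bound.
- by move=> Phi B _ _; exact: normalized_generator_mass.
- exact: normalized_generator_sym.
Qed.

End symmetry.
End generator_symmetry.

(** * From Palm formulas to detailed balance *)

Section product_uniqueness.
Context d1 d2 (T1 : measurableType d1) (T2 : measurableType d2) (R : realType).

(** Since the whole spaces are among the generators, each strip parallel to an axis is obtained from
    generators of one factor only; a rectangle is the intersection of two strips. *)
Lemma measurable_prod_generated (G1 : set (set T1)) (G2 : set (set T2)) :
  @measurable _ T1 = <<s G1 >> -> @measurable _ T2 = <<s G2 >> -> G1 setT -> G2 setT ->
  @measurable _ (T1 * T2)%type = <<s [set A `*` B | A in G1 & B in G2] >>.
Proof.
move=> m1 m2 G1T G2T; set G := [set _ `*` _ | _ in _ & _ in _].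
apply/seteqP; split; last first.
  apply: smallest_sub; first exact: sigma_algebra_measurable.
  by move=> _ [A GA [B GB <-]]; apply: measurableX; rewrite ?m1 ?m2; exact: sub_sigma_algebra.
have s1 : sigma_algebra setT (image_set_system setT (@fst T1 T2) <<s G >>).
  exact/sigma_algebra_image/smallest_sigma_algebra.
have s2 : sigma_algebra setT (image_set_system setT (@snd T1 T2) <<s G >>).
  exact/sigma_algebra_image/smallest_sigma_algebra.
rewrite measurable_prod_measurableType; apply: smallest_sub; first exact: smallest_sigma_algebra.
move=> _ [A mA [B mB <-]].
have gA : <<s G >> (A `*` setT).
  have : image_set_system setT (@fst T1 T2) <<s G >> A.
    move: A mA; rewrite m1; apply: smallest_sub => // A GA.
    apply: sub_sigma_algebra; exists A => //; exists setT => //.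
    by rewrite setTI; apply/seteqP; split => -[a b] //= [].
  rewrite /image_set_system/= setTI; congr (<<s G >> _).
  by apply/seteqP; split => -[a b] //= [].
have gB : <<s G >> (setT `*` B).
  have : image_set_system setT (@snd T1 T2) <<s G >> B.
    move: B mB; rewrite m2; apply: smallest_sub => // B GB.
    apply: sub_sigma_algebra; exists setT; [exact: G1T|exists B; first exact: GB].
    by rewrite setTI; apply/seteqP; split => -[a b] //= [].
  rewrite /image_set_system/= setTI; congr (<<s G >> _).
  by apply/seteqP; split => -[a b] //= [].
rewrite (_ : A `*` B = (A `*` setT) `&` (setT `*` B)).
  exact: (@measurableI _ (g_sigma_algebraType G) _ _ gA gB).
by rewrite -setXI setTI setIT.
Qed.

Lemma finite_measure_unique_prod (G1 : set (set T1)) (G2 : set (set T2))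
    (m m' : {measure set (T1 * T2) -> \bar R}) :
  @measurable _ T1 = <<s G1 >> -> @measurable _ T2 = <<s G2 >> -> G1 setT -> G2 setT ->
  setI_closed G1 -> setI_closed G2 -> (m setT < +oo)%E ->
  (forall A B, G1 A -> G2 B -> m (A `*` B) = m' (A `*` B)) ->
  forall C, measurable C -> m C = m' C.
Proof.
move=> m1 m2 G1T G2T I1 I2 moo mm'.
apply: (finite_measure_unique (measurable_prod_generated m1 m2 G1T G2T)) => //.
- move=> _ _ [A GA [B GB <-]] [A' GA' [B' GB' <-]].
  by exists (A `&` A'); [exact: I1|exists (B `&` B'); [exact: I2|rewrite setXI]].
- by exists setT => //; exists setT => //; rewrite setXTT.
- by move=> _ [A GA [B GB <-]]; exact: mm'.
Qed.

End product_uniqueness.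

Section kernel_precomposition.
Context d1 d2 d3 (X : measurableType d1) (Y : measurableType d2) (Z : measurableType d3)
  (R : realType) (k : R.-pker X ~> Y) (f : Z -> X).

(** Serves for the one-point Palm kernel taken at the sum of two sizes. *)
Definition kprecomp (_ : measurable_fun setT f) (z : Z) : {measure set Y -> \bar R} := k (f z).

Hypothesis mf : measurable_fun setT f.

Let kprecomp_measurable U : measurable U -> measurable_fun setT (kprecomp mf ^~ U).
Proof. by move=> mU; exact: (measurableT_comp (measurable_kernel k U mU) mf). Qed.

HB.instance Definition _ := isKernel.Build _ _ Z Y R (kprecomp mf) kprecomp_measurable.

Let kprecomp_prob z : kprecomp mf z setT = 1%E.
Proof. exact: prob_kernel. Qed.

HB.instance Definition _ := Kernel_isProbability.Build _ _ Z Y R (kprecomp mf) kprecomp_prob.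

Lemma measurable_fun_integral_precomp (g : Z * Y -> \bar R) : (forall q, 0 <= g q)%E ->
  measurable_fun setT g -> measurable_fun setT (fun z => \int[k (f z)]_y g (z, y))%E.
Proof. move=> g0 mg; exact: (measurable_fun_integral_finite_kernel g (kprecomp mf) g0 mg). Qed.

End kernel_precomposition.

Section kernel_probability.
Context d1 d2 (X : measurableType d1) (Y : measurableType d2) (R : realType)
  (k : R.-pker X ~> Y) (x : X).

Definition kernel_at : set Y -> \bar R := k x.

HB.instance Definition _ := Measure.copy kernel_at (k x).
HB.instance Definition _ := Measure_isProbability.Build _ _ _ kernel_at (prob_kernel x).

End kernel_probability.

Lemma integral_scaled_eq d (S : measurableType d) (R : realType)
    (m1 m2 : {measure set S -> \bar R}) (k1 k2 : R) (f : S -> \bar R) :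
  0 <= k1 -> 0 <= k2 -> measurable_fun setT f -> (forall s, 0 <= f s)%E ->
  (forall U, measurable U -> (k1%:E * m1 U = k2%:E * m2 U)%E) ->
  (k1%:E * \int[m1]_s f s = k2%:E * \int[m2]_s f s)%E.
Proof.
move=> k10 k20 mf f0 h.
rewrite -[k1]/((NngNum k10)%:num) -[k2]/((NngNum k20)%:num).
rewrite -!ge0_integral_mscale//.
by apply: eq_measure_integral => A mA _; exact: h.
Qed.

(** * Tests on level counts *)

Section count_checks.
Context {R : realType}.
Implicit Types (l : seq (R * nat)) (u : R -> \bar R) (v : R -> R).

Definition gt01 (t x : R) : R := (t < x)%R%:R.

(** The test that the count [u] minus the correction [v] equals the prescribed number. The
    correction is put on the right because an abstract count may be infinite. *)
Definition chk l u v := all (fun p => u p.1 == (p.2%:R + v p.1)%:E) l.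

Lemma eq_chk l u v u' v' : all (fun p : R * nat => 0 < p.1) l ->
  (forall (t : R) (k : nat), 0 < t -> (u t == (k%:R + v t)%:E) = (u' t == (k%:R + v' t)%:E)) ->
  chk l u v = chk l u' v'.
Proof.
move=> lp h; apply: eq_in_all => -[t k] /(allP lp)/= t0; exact: h.
Qed.

Lemma eqe_addr (x : \bar R) (k r : R) : (x + r%:E == (k + r)%:E)%E = (x == k%:E).
Proof.
case: x => [x| |]//; rewrite -EFinD !eqe; exact: (inj_eq (addIr r)).
Qed.

Lemma measurable_chk d (W : measurableType d) l (u : R -> W -> \bar R) (v : R -> W -> R) :
  all (fun p : R * nat => 0 < p.1) l ->
  (forall t, 0 < t -> measurable_fun setT (u t)) ->
  (forall t, 0 < t -> measurable_fun setT (v t)) ->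
  measurable_fun setT (fun w => chk l (u ^~ w) (v ^~ w)).
Proof.
move=> + mu_ mv; elim: l => [_|[t k] l IH /= /andP[t0 /IH ml]].
  exact: measurable_cst.
apply: measurable_and => //; apply: measurable_fun_eqe; first exact: mu_.
by apply/measurable_EFinP; apply: measurable_funD => //; exact: mv.
Qed.

Lemma measurable_gt01 d (W : measurableType d) t (f : W -> R) : measurable_fun setT f ->
  measurable_fun setT (fun w => gt01 t (f w)).
Proof.
move=> mf; have := measurableT_comp (measurable_gtind t) mf.
by move/measurable_EFinP.
Qed.

Lemma measurable_bool_num d (W : measurableType d) (f : W -> bool) : measurable_fun setT f ->
  measurable_fun setT (fun w => (f w)%:R : R).
Proof.
move=> mf; rewrite (_ : (fun _ => _) = fun w => if f w then 1 else 0).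
  exact: measurable_fun_ifT.
by apply/funext => w; case: (f w).
Qed.

End count_checks.

(** * Detailed balance on products of cylinders *)

Section core.
Context {R : realType}.
Local Notation RT := (measurableTypeR R).
Local Notation mu := (@lebesgue_measure R).
Local Notation mu2 := (mu \x mu)%E.
Variables (lam : R) (H1 H2 : R -> R -> R).
Hypothesis lam0 : 0 <= lam.
Hypothesis hom1 : homogeneous_rate lam H1.
Hypothesis sup1 : (rate_sup H1 < +oo)%E.
Hypothesis hom2 : homogeneous_rate lam H2.
Hypothesis int2 : (rate_int H2 < +oo)%E.
Context d (W : measurableType d) (P : probability W R) (X : W -> Omega R).

(* An abstract state space carrying the level counts [cn t] and the total mass
   [ms] of a configuration, both additive under adding a point by [ad]; it is
   the space of configurations for part (i), and [Omega] for part (ii). *)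
Context dS (S : measurableType dS).
Variables (e : Omega R -> S) (cn : R -> S -> \bar R) (ms : S -> \bar R) (ad : S -> R -> S).
Hypothesis mcn : forall t, 0 < t -> measurable_fun setT (cn t).
Hypothesis mms : measurable_fun setT ms.
Hypothesis ms_ge0 : forall s, (0 <= ms s)%E.
Hypothesis cn_e : forall t z, 0 < t -> cn t (e z) = cnt t z.
Hypothesis ms_e : forall z, ms (e z) = (mass z)%:E.
Hypothesis cn_ad : forall t s x, 0 < t -> 0 < x -> cn t (ad s x) = (cn t s + (gt01 t x)%:E)%E.
Hypothesis ms_ad : forall s x, 0 < x -> ms (ad s x) = (ms s + x%:E)%E.
Variables (r1 : RT -> R) (r2 : RT * RT -> R).
Hypothesis mr1 : measurable_fun (half_line R) r1.
Hypothesis r1_ge0 : forall x, 0 < x -> 0 <= r1 x.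
Hypothesis mr2 : measurable_fun (quadrant R) r2.
Hypothesis r2_ge0 : forall q, 0 < q.1 -> 0 < q.2 -> 0 <= r2 q.
Variables (P1 : R.-pker RT ~> S) (P2 : R.-pker (RT * RT)%type ~> S).
Hypothesis palm1 : forall G : RT * S -> R, measurable_fun setT G ->
  (forall u, 0 <= G u) -> (exists C, forall u, G u <= C) ->
  (\int[P]_w \int[counting]_(i in pos_idx (X w)) (G (X w i, e (X w)))%:E
   = \int[mu]_(x in half_line R) ((r1 x)%:E * \int[P1 x]_s (G (x, ad s x))%:E))%E.
Hypothesis palm2 : forall G : (RT * RT) * S -> R, measurable_fun setT G ->
  (forall u, 0 <= G u) -> (exists C, forall u, G u <= C) ->
  (exists C, forall u, G u * fine (ms u.2) <= C * `|u.1.1 : R|) ->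
  (\int[P]_w \int[counting]_(p in pos_pairs (X w)) (G ((X w p.1, X w p.2), e (X w)))%:E
   = \int[mu2]_(q in quadrant R) ((r2 q)%:E * \int[P2 q]_s (G (q, ad (ad s q.1) q.2))%:E))%E.
Hypothesis balance : {ae mu2, forall q, quadrant R q -> forall U, measurable U ->
  ((coag_rate H1 q.1 q.2 * r2 q)%:E * P2 q U =
   (frag_rate H2 q.1 q.2 * r1 ((q.1 : R) + (q.2 : R))%R)%:E * P1 ((q.1 : R) + (q.2 : R))%R U)%E}.

Variables (a b : seq (R * nat)).
Hypothesis apos : all (fun p : R * nat => 0 < p.1) a.
Hypothesis bpos : all (fun p : R * nat => 0 < p.1) b.

(** The normalization as a function of an extended mass. At [+oo] it is 0, because [fine] gives 0
    and a nonzero power of 0 is 0 ([ccoo]). *)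
Let cc (m : \bar R) : R := fine m `^ (- (2 + lam)).

(** What both sides of the balance test once the moving points are taken out of the configuration:
    [s] with [q.1] and [q.2] added passes [a], [s] with the merged point added passes [b]. The mass
    is the same in both cases. *)
Let J (q : RT * RT) (s : S) : R := cc (ms s + (q.1 + q.2)%R%:E) *
  ((chk a (fun t => cn t s + (gt01 t q.1 + gt01 t q.2)%R%:E)%E (fun=> 0))%:R *
   (chk b (fun t => cn t s + (gt01 t (q.1 + q.2)%R)%:E)%E (fun=> 0))%:R).

Let inq (q : RT * RT) := (0 < q.1) && (0 < q.2).

(** The common density, in terms of the two fragments, to which both sides reduce. *)
Let tau (q : RT * RT) : \bar R :=
  if inq q then ((frag_rate H2 q.1 q.2 * r1 ((q.1 : R) + (q.2 : R))%R)%:E *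
    \int[P1 ((q.1 : R) + (q.2 : R))%R]_s (J q s)%:E)%E else 0%E.

(** The coagulation side as a functional of two points and the whole configuration. The inequality
    with the mass holds for any two distinct points of a state, and it makes the functional
    bounded. *)
Let G2 (u : (RT * RT) * S) : R :=
  if inq u.1 && (u.1.1 + u.1.2 <= fine (ms u.2)) then
    coag_rate H1 u.1.1 u.1.2 * (cc (ms u.2) * ((chk a (cn ^~ u.2) (fun=> 0))%:R *
      (chk b (fun t => cn t u.2 + (gt01 t (u.1.1 + u.1.2)%R)%:E)%E
             (fun t => gt01 t u.1.1 + gt01 t u.1.2))%:R)) else 0.

Let dens (x y : R) : R := if 0 < y < x then frag_rate H2 y (x - y) else 0.

(** The fragmentation side as a functional of the point about to split; the place of the cut is
    integrated inside, since the Palm formula is about that one point. *)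
Let G1 (u : RT * S) : R :=
  if (0 < u.1) && (u.1 <= fine (ms u.2)) then
    fine (\int[mu]_y (dens u.1 y * (cc (ms u.2) *
      ((chk a (fun t => cn t u.2 + (gt01 t y + gt01 t (u.1 - y))%R%:E)%E (fun t => gt01 t u.1))%:R *
       (chk b (cn ^~ u.2) (fun=> 0))%:R)))%:E)%E
  else 0.

Let cc_ge0 m : 0 <= cc m. Proof. exact: powR_ge0. Qed.

Let J_ge0 q s : 0 <= J q s. Proof. by rewrite !mulr_ge0. Qed.

Let coag_ge0 x y : 0 < x -> 0 < y -> 0 <= coag_rate H1 x y.
Proof. by move=> x0 y0; rewrite /coag_rate !mulr_ge0 ?(ltW x0) ?(ltW y0)//; exact: (rate_ge0 hom1). Qed.

Let frag_ge0 x y : 0 < x -> 0 < y -> 0 <= frag_rate H2 x y.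
Proof. by move=> x0 y0; rewrite /frag_rate mulr_ge0 ?addr_ge0 ?(ltW x0) ?(ltW y0)//; exact: (rate_ge0 hom2). Qed.

Let dens_ge0 x y : 0 <= dens x y.
Proof. by rewrite /dens; case: ifP => // /andP[y0 yx]; rewrite frag_ge0 ?subr_gt0. Qed.

Let mcc : measurable_fun setT (fun s => cc (ms s)).
Proof.
apply: (measurableT_comp (measurable_powR _)).
exact: (measurableT_comp (fine_measurable measurableT) mms).
Qed.

Let ccoo (x : R) s : ms s = +oo%E -> cc (ms s + x%:E)%E = 0.
Proof.
move=> ->; rewrite /cc /= powR0//.
by rewrite oppr_eq0 gt_eqF// ltr_wpDr.
Qed.

(** After the two points are added, the inequality in [G2] can fail only when [ms s] is infinite,
    and there [cc] vanishes. *)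
Let G2_ad q s : inq q -> G2 (q, ad (ad s q.1) q.2) = coag_rate H1 q.1 q.2 * J q s.
Proof.
move=> /andP[q1 q2].
have mE : ms (ad (ad s q.1) q.2) = (ms s + (q.1 + q.2)%R%:E)%E.
  by rewrite !ms_ad// EFinD addeA.
have cE t : 0 < t -> cn t (ad (ad s q.1) q.2) = (cn t s + (gt01 t q.1 + gt01 t q.2)%R%:E)%E.
  by move=> t0; rewrite !cn_ad// EFinD addeA.
rewrite /G2 /J /inq/= q1 q2 mE.
case: ifPn => [h|].
  congr (_ * (_ * ((nat_of_bool _)%:R * (nat_of_bool _)%:R))).
    by apply: eq_chk => // t k t0; rewrite cE.
  apply: eq_chk => // t k t0; rewrite cE// -addeA [X in (_ + X)%E]addeC addeA eqe_addr.
  by rewrite addr0.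
rewrite -ltNge => h.
suff -> : cc (ms s + (q.1 + q.2)%R%:E) = 0 by rewrite mul0r mulr0.
case E : (ms s) h => [m| |] /=; last by have := ms_ge0 s; rewrite E.
  by rewrite gtrDr => m0; have := ms_ge0 s; rewrite E lee_fin leNgt m0.
by move=> _; rewrite -E; exact: ccoo.
Qed.

Let dens_int x : 0 < x -> (\int[mu]_y (dens x y)%:E = (x `^ (2 + lam))%:E * rate_int H2)%E.
Proof.
move=> x0.
have -> : 2 + lam = 1 + (1 + lam) by ring.
rewrite powRD ?(gt_eqF x0) ?implybT// powRr1 ?(ltW x0)// EFinM -muleA -(rate_int_scale hom2 x0).
rewrite -ge0_integralZl//; last 3 first.
- by apply/measurable_EFinP; exact: (measurable_rate_split hom2).
- by move=> y /=; rewrite in_itv/= => /andP[y0 yz]; rewrite lee_fin (rate_ge0 hom2)// subr_gt0.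
- by rewrite lee_fin ltW.
rewrite [RHS]integral_mkcond; apply: eq_integral => y _; rewrite patchE /dens /frag_rate.
have -> : (y \in `]0, x[%classic) = (0 < y < x).
  by apply/idP/idP => [/set_mem/=|h]; [|apply/mem_set => /=]; rewrite in_itv.
by case: ifP => // _; rewrite -EFinM (addrC y) subrK.
Qed.

Let intr : rate_int H2 \is a fin_num.
Proof.
rewrite ge0_fin_numE//; apply: integral_ge0 => u; rewrite /= in_itv/= => /andP[u0 u1].
by rewrite lee_fin (rate_ge0 hom2)// subr_gt0.
Qed.

Let mdens d' (W' : measurableType d') (f g : W' -> R) : measurable_fun setT f ->
  measurable_fun setT g -> measurable_fun setT (fun w => dens (f w) (g w)).
Proof.
move=> mf mg; rewrite /dens.
have mc : measurable_fun setT (fun w => 0 < g w < f w).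
  by apply: measurable_and; exact: measurable_fun_ltr.
apply: measurable_fun_if => //.
set D := _ `&` _; have mD : measurable D by apply: mc.
apply: measurable_funM.
  by apply: measurable_funTS; apply: measurable_funD => //; exact: measurable_funB.
apply: (measurable_rate_comp hom2) => //; try (apply: measurable_funTS => //; exact: measurable_funB).
by move=> u [_ /= /andP[h1 h2]]; rewrite subr_gt0.
Qed.

Let dens_int_le x (h : R -> R) (C : R) : 0 < x -> measurable_fun setT h -> (forall y, 0 <= h y <= C) ->
  (\int[mu]_y (dens x y * h y)%:E <= (x `^ (2 + lam) * fine (rate_int H2) * C)%:E)%E.
Proof.
move=> x0 mh hC.
have C0 : 0 <= C by have /andP[h1] := hC 0; exact: le_trans.
have md : measurable_fun setT (fun y : RT => dens x y) by exact: mdens.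
apply: (@le_trans _ _ (C%:E * \int[mu]_y (dens x y)%:E)%E); last first.
  by rewrite dens_int// -(fineK intr) -!EFinM lee_fin mulrC.
rewrite -ge0_integralZl ?lee_fin//; last 2 first.
- exact/measurable_EFinP.
- by move=> y _; rewrite lee_fin.
apply: ge0_le_integral => //.
- by move=> y _; rewrite lee_fin mulr_ge0//; have /andP[] := hC y.
- by apply/measurable_EFinP; exact: measurable_funM.
- by apply/measurable_EFinP; exact: measurable_funM.
- by move=> y _; rewrite -EFinM lee_fin mulrC ler_wpM2r//; have /andP[] := hC y.
Qed.

Let dens_int_fin x (h : R -> R) (C : R) : 0 < x -> measurable_fun setT h -> (forall y, 0 <= h y <= C) ->
  (\int[mu]_y (dens x y * h y)%:E)%E \is a fin_num.
Proof.
move=> x0 mh hC; rewrite ge0_fin_numE; first exact: le_lt_trans (dens_int_le x0 mh hC) (ltry _).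
by apply: integral_ge0 => y _; rewrite lee_fin mulr_ge0//; have /andP[] := hC y.
Qed.

Let mchkab x s : measurable_fun setT (fun y : RT =>
  (chk a (fun t => cn t s + (gt01 t y + gt01 t (x - y))%R%:E)%E (fun t => gt01 t x))%:R : R).
Proof.
apply: measurable_bool_num.
apply: (@measurable_chk _ _ _ _ (fun t (y : RT) => cn t s + (gt01 t y + gt01 t (x - y))%R%:E)%E (fun t _ => gt01 t x)) => // t t0.
apply: emeasurable_funD => //; apply/measurable_EFinP.
by apply: measurable_funD; apply: measurable_gt01 => //; exact: measurable_funB.
Qed.

Let G1_ad x s : 0 < x -> (G1 (x, ad s x))%:E =
  (\int[mu]_y (dens x y * J (y, x - y) s)%:E)%E.
Proof.
move=> x0; rewrite /G1 /= x0 ms_ad//=.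
have E y : J (y, x - y) s = cc (ms s + x%:E) *
  ((chk a (fun t => cn t s + (gt01 t y + gt01 t (x - y))%R%:E)%E (fun=> 0))%:R *
   (chk b (fun t => cn t s + (gt01 t x)%:E)%E (fun=> 0))%:R).
  by rewrite /J /= (addrC y) subrK.
case: ifPn => [h|].
  rewrite fineK; last first.
    apply: (@dens_int_fin x (fun y => cc (ms s + x%:E) *
      ((chk a (fun t => cn t (ad s x) + (gt01 t y + gt01 t (x - y))%R%:E)%E (fun t => gt01 t x))%:R *
       (chk b (cn ^~ (ad s x)) (fun=> 0))%:R)) (cc (ms s + x%:E))) => //.
      by apply: measurable_funM => //; apply: measurable_funM => //; exact: mchkab.
    move=> y; rewrite !mulr_ge0//= -[leRHS]mulr1 ler_wpM2l//.
    by case: chk; case: chk; rewrite ?mulr1 ?mulr0 ?lexx ?ler01.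
  apply: eq_integral => y _; rewrite E; congr ((_ * (_ * ((nat_of_bool _)%:R * (nat_of_bool _)%:R)))%:E).
    apply: eq_chk => // t k t0; rewrite cn_ad// -addeA [X in (_ + X)%E]addeC addeA eqe_addr.
    by rewrite addr0.
  by apply: eq_chk => // t k t0; rewrite cn_ad.
rewrite -ltNge => h.
suff c0 : cc (ms s + x%:E) = 0.
  by rewrite integral0_eq// => y _; rewrite E c0 mul0r mulr0.
case E' : (ms s) h => [m| |] /=; last by have := ms_ge0 s; rewrite E'.
  by rewrite gtrDr => m0; have := ms_ge0 s; rewrite E' lee_fin leNgt m0.
by move=> _; rewrite -E'; exact: ccoo.
Qed.

(** Both sizes and their sum are at most the mass [m], so the rate is at most [m] to the power
    [2 + lam] times the supremum of [H1], which [cc] cancels. *)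
Let G2_bound : exists C, forall u, G2 u <= C.
Proof.
exists (fine (rate_sup H1)) => -[[x y] s]; rewrite /G2 /inq/=.
have C0 := rate_sup_ge0 hom1 sup1.
case: ifP => // /andP[/andP[x0 y0] xym].
set m := fine _ in xym *.
have xy0 : 0 < x + y by exact: addr_gt0.
have m0 : 0 < m by exact: lt_le_trans xym.
have B01 (b1 b2 : bool) : 0 <= (b1%:R * b2%:R : R) <= 1.
  by case: b1; case: b2; rewrite ?mulr1 ?mulr0 ?lexx ?ler01.
have K : coag_rate H1 x y * cc (ms s) <= fine (rate_sup H1).
  rewrite /cc -/m.
  have -> : fine (rate_sup H1) = m `^ (2 + lam) * fine (rate_sup H1) * m `^ (- (2 + lam)).
    by rewrite powRN mulrAC mulfV ?mul1r// gt_eqF// powR_gt0.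
  rewrite ler_wpM2r ?powR_ge0//.
  have -> : m `^ (2 + lam) = m * m * m `^ lam.
    by rewrite powRD ?(gt_eqF m0) ?implybT// powR_mulrn ?ltW// expr2.
  rewrite /coag_rate -[leRHS]mulrA ler_pM//.
  - by rewrite mulr_ge0// ltW.
  - exact: (rate_ge0 hom1).
  - by rewrite ler_pM ?(ltW x0) ?(ltW y0)// (le_trans _ xym)// ?lerDl ?lerDr ltW.
  - apply: (le_trans (rate_sup_bound hom1 sup1 x0 y0)); rewrite ler_wpM2r//.
    by rewrite ge0_ler_powR// nnegrE ltW.
rewrite mulrA -[leRHS]mulr1 ler_pM//.
- by rewrite mulr_ge0// coag_ge0.
- by case/andP: (B01 (chk a (cn^~ s) (fun=> 0)) (chk b (fun t : R => cn t s + (gt01 t (x + y))%:E)%E (fun t => gt01 t x + gt01 t y))).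
Qed.

(** Compared with [G2_bound], the first size is kept instead of being replaced by the mass. Sizes
    add up to the mass, so a sum of [G2] over single points stays bounded. *)
Let G2_diag_bound : exists C, forall u, G2 u * fine (ms u.2) <= C * `|u.1.1 : R|.
Proof.
exists (fine (rate_sup H1)) => -[[x y] s]; rewrite /G2 /inq/=.
have C0 := rate_sup_ge0 hom1 sup1.
case: ifP => [/andP[/andP[x0 y0] xym]|_]; last by rewrite mul0r mulr_ge0.
set m := fine _ in xym *.
have xy0 : 0 < x + y by exact: addr_gt0.
have m0 : 0 < m by exact: lt_le_trans xym.
rewrite gtr0_norm//.
have B01 (b1 b2 : bool) : 0 <= (b1%:R * b2%:R : R) <= 1.
  by case: b1; case: b2; rewrite ?mulr1 ?mulr0 ?lexx ?ler01.
have K : coag_rate H1 x y <= x * m * (m `^ lam * fine (rate_sup H1)).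
  rewrite /coag_rate ler_pM//.
  - by rewrite mulr_ge0// ltW.
  - exact: (rate_ge0 hom1).
  - by rewrite ler_pM2l// (le_trans _ xym)// lerDr ltW.
  - apply: (le_trans (rate_sup_bound hom1 sup1 x0 y0)); rewrite ler_wpM2r//.
    by rewrite ge0_ler_powR// nnegrE ltW.
have E : x * m * (m `^ lam * fine (rate_sup H1)) * (cc (ms s) * m) = fine (rate_sup H1) * x.
  have mE : m `^ (2 + lam) = m * m * m `^ lam.
    by rewrite powRD ?(gt_eqF m0) ?implybT// powR_mulrn ?ltW// expr2.
  rewrite /cc -/m powRN mE; field.
  by rewrite !gt_eqF// powR_gt0.
rewrite -E -mulrA ler_pM ?coag_ge0//.
  by rewrite !mulr_ge0// ltW.
rewrite ler_wpM2r ?(ltW m0)// -[leRHS]mulr1 ler_wpM2l//.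
by case/andP: (B01 (chk a (cn^~ s) (fun=> 0)) (chk b (fun t : R => cn t s + (gt01 t (x + y))%:E)%E (fun t => gt01 t x + gt01 t y))).
Qed.

Let minq : measurable_fun setT inq.
Proof. by apply: measurable_and; apply: measurable_fun_ltr. Qed.

Let inqE q : (q \in quadrant R) = inq q.
Proof. by apply/idP/idP => [/set_mem/= [? ?]|/andP[? ?]]; [apply/andP|apply/mem_set]. Qed.

Let mquadrant : measurable (quadrant R).
Proof.
rewrite (_ : quadrant R = inq @^-1` [set true]).
  by rewrite -[X in measurable X]setTI; exact: minq.
by apply/seteqP; split => q /=; [case=> ? ?; apply/andP|move/andP].
Qed.

Let mG2 : measurable_fun setT G2.
Proof.
rewrite /G2.
have m11 : measurable_fun setT (fun u : (RT * RT) * S => u.1.1 : R).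
  exact: (measurableT_comp measurable_fst measurable_fst).
have m12 : measurable_fun setT (fun u : (RT * RT) * S => u.1.2 : R).
  exact: (measurableT_comp measurable_snd measurable_fst).
have m112 : measurable_fun setT (fun u : (RT * RT) * S => u.1.1 + u.1.2 : R).
  exact: measurable_funD.
have mc : measurable_fun setT (fun u : (RT * RT) * S => inq u.1 && (u.1.1 + u.1.2 <= fine (ms u.2))).
  apply: measurable_and; first exact: (measurableT_comp minq measurable_fst).
  apply: measurable_fun_ler => //.
  apply: (measurableT_comp (fine_measurable measurableT)).
  exact: (measurableT_comp mms measurable_snd).
apply: measurable_fun_if => //.
set D := _ `&` _; have mD : measurable D by apply: mc.
apply: measurable_funM.
  apply: measurable_funM; first by apply: measurable_funM; exact: measurable_funTS.
  apply: (measurable_rate_comp hom1) => //; try exact: measurable_funTS.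
  by move=> u [_ /= /andP[/andP[]]].
apply: measurable_funTS; apply: measurable_funM.
  exact: (measurableT_comp mcc measurable_snd).
have mcn2 t : 0 < t -> measurable_fun setT (fun u : (RT * RT) * S => cn t u.2).
  by move=> t0; exact: (measurableT_comp (mcn t0) measurable_snd).
apply: measurable_funM; apply: measurable_bool_num.
  exact: (@measurable_chk _ _ _ _ (fun t (u : (RT * RT) * S) => cn t u.2) (fun t _ => 0)).
apply: (@measurable_chk _ _ _ _ (fun t (u : (RT * RT) * S) => (cn t u.2 + (gt01 t (u.1.1 + u.1.2)%R)%:E)%E)
   (fun t u => gt01 t u.1.1 + gt01 t u.1.2)) => // t t0.
  apply: emeasurable_funD; first exact: mcn2.
  by apply/measurable_EFinP; exact: measurable_gt01.
by apply: measurable_funD; exact: measurable_gt01.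
Qed.

Let G2_ge0 u : 0 <= G2 u.
Proof.
rewrite /G2; case: ifP => // /andP[/andP[x0 y0] _].
by rewrite mulr_ge0 ?coag_ge0// !mulr_ge0.
Qed.

Let mG1 : measurable_fun setT G1.
Proof.
rewrite /G1.
have m1 : measurable_fun setT (fun u : RT * S => u.1 : R) by exact: measurable_fst.
have mc : measurable_fun setT (fun u : RT * S => (0 < u.1) && (u.1 <= fine (ms u.2))).
  apply: measurable_and; first exact: measurable_fun_ltr.
  apply: measurable_fun_ler => //.
  apply: (measurableT_comp (fine_measurable measurableT)).
  exact: (measurableT_comp mms measurable_snd).
apply: measurable_fun_ifT => //.
apply: (measurableT_comp (fine_measurable measurableT)).
apply: (measurable_fun_fubini_tonelli_F (m2 := mu) (fun v : (RT * S) * RT => (dens v.1.1 v.2 * (cc (ms v.1.2) *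
      ((chk a (fun t => cn t v.1.2 + (gt01 t v.2 + gt01 t (v.1.1 - v.2))%R%:E)%E (fun t => gt01 t v.1.1))%:R *
       (chk b (cn ^~ v.1.2) (fun=> 0))%:R)))%:E)); last first.
  by move=> v; rewrite lee_fin !mulr_ge0.
have m11 : measurable_fun setT (fun u : (RT * S) * RT => u.1.1 : R).
  exact: (measurableT_comp measurable_fst measurable_fst).
have m12 : measurable_fun setT (fun u : (RT * S) * RT => u.1.2).
  exact: (measurableT_comp measurable_snd measurable_fst).
have m2 : measurable_fun setT (fun u : (RT * S) * RT => u.2 : R) by exact: measurable_snd.
have mcn2 t : 0 < t -> measurable_fun setT (fun u : (RT * S) * RT => cn t u.1.2).
  by move=> t0; exact: (measurableT_comp (mcn t0) m12).
apply/measurable_EFinP; apply: measurable_funM; first exact: mdens.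
apply: measurable_funM; first exact: (measurableT_comp mcc m12).
apply: measurable_funM; apply: measurable_bool_num; last first.
  exact: (@measurable_chk _ _ _ _ (fun t (u : (RT * S) * RT) => cn t u.1.2) (fun t _ => 0)).
apply: (@measurable_chk _ _ _ _ (fun t (v : (RT * S) * RT) => (cn t v.1.2 + (gt01 t v.2 + gt01 t (v.1.1 - v.2))%R%:E)%E)
   (fun t v => gt01 t v.1.1)) => // t t0; last exact: measurable_gt01.
apply: emeasurable_funD; first exact: mcn2.
apply/measurable_EFinP; apply: measurable_funD; apply: measurable_gt01 => //.
exact: measurable_funB.
Qed.

Let G1_ge0 u : 0 <= G1 u.
Proof.
rewrite /G1; case: ifP => // _; apply: fine_ge0; apply: integral_ge0 => y _.
by rewrite lee_fin !mulr_ge0.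
Qed.

Let chk_int_bound x s y : 0 <= cc (ms s) *
      ((chk a (fun t => cn t s + (gt01 t y + gt01 t (x - y))%R%:E)%E (fun t => gt01 t x))%:R *
       (chk b (cn ^~ s) (fun=> 0))%:R) <= cc (ms s).
Proof.
rewrite !mulr_ge0//= -[leRHS]mulr1 ler_wpM2l//.
by case: chk; case: chk; rewrite ?mulr1 ?mulr0 ?lexx ?ler01.
Qed.

Let mchk_int x s : measurable_fun setT (fun y : RT => cc (ms s) *
      ((chk a (fun t => cn t s + (gt01 t y + gt01 t (x - y))%R%:E)%E (fun t => gt01 t x))%:R *
       (chk b (cn ^~ s) (fun=> 0))%:R)).
Proof. by apply: measurable_funM => //; apply: measurable_funM => //; exact: mchkab. Qed.

Let G1_bound : exists C, forall u, G1 u <= C.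
Proof.
have r0 : 0 <= fine (rate_int H2).
  apply: fine_ge0; apply: integral_ge0 => u; rewrite /= in_itv/= => /andP[u0 u1].
  by rewrite lee_fin (rate_ge0 hom2)// subr_gt0.
exists (fine (rate_int H2)) => -[x s]; rewrite /G1/=; case: ifP => // /andP[x0 xm].
rewrite -lee_fin fineK; last exact: dens_int_fin x0 (mchk_int x s) (chk_int_bound x s).
apply: le_trans (dens_int_le x0 (mchk_int x s) (chk_int_bound x s)) _.
have m0 : 0 < fine (ms s) by exact: lt_le_trans xm.
rewrite lee_fin mulrAC -[leRHS]mul1r ler_wpM2r// /cc powRN ler_pdivrMr ?powR_gt0// mul1r.
by rewrite ge0_ler_powR// ?nnegrE ?(ltW x0) ?(ltW m0)// addr_ge0.
Qed.

Let cyl_chk (l : seq (R * nat)) (z : Omega R) :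
  \1_(cyl l) z = (chk l (fun t => cnt t z) (fun=> 0))%:R :> R.
Proof.
rewrite indicE; congr ((nat_of_bool _)%:R); apply/idP/idP => [/set_mem|h].
  by rewrite /cyl/= => h; apply: etrans h; apply: eq_all => p; rewrite addr0.
by apply/mem_set; rewrite /cyl/=; apply: etrans h; apply: eq_all => p; rewrite addr0.
Qed.

Let coag_term z :
  (\int[counting]_p (coag_weight lam H1 z p * (\1_(cyl a) z * \1_(cyl b) (omerge p.1 p.2 z)))%:E =
   \int[counting]_(p in pos_pairs z) (G2 ((z p.1, z p.2), e z))%:E)%E.
Proof.
rewrite [RHS]integral_mkcond; apply: eq_integral => p _; rewrite patchE /coag_weight.
have -> : (p \in pos_pairs z) = [&& p.1 != p.2, 0 < z p.1 & 0 < z p.2].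
  by apply/idP/idP => [/set_mem[? ? ?]|/and3P[? ? ?]]; [apply/and3P|apply/mem_set].
case: ifP => [/and3P[p12 p1 p2]|_]; last by rewrite mul0r.
rewrite /G2 /inq/= p1 p2/= ms_e/= le_mass2// /omerge p12 !cyl_chk /cc /= -/(norm_rate lam z).
rewrite [norm_rate _ _ * _]mulrC -mulrA.
congr ((_ * (_ * ((nat_of_bool _)%:R * (nat_of_bool _)%:R)))%:E).
  by apply: eq_chk => // t k t0; rewrite cn_e.
apply: eq_chk => // t k t0; rewrite cn_e// addr0.
have g0 x : (0 <= (t < x)%R%:R%:E :> \bar R)%E by rewrite lee_fin.
have := gsum_merge g0 p12 p1 p2; rewrite -/(cnt t z) -EFinD => <-.
by rewrite eqe_addr.
Qed.

Let frag_term z :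
  (\int[counting]_i \int[mu]_y (frag_weight lam H2 z i y * (\1_(cyl a) (osplit i y z) * \1_(cyl b) z))%:E =
   \int[counting]_(i in pos_idx z) (G1 (z i, e z))%:E)%E.
Proof.
rewrite [RHS]integral_mkcond; apply: eq_integral => i _; rewrite patchE.
have -> : (i \in pos_idx z) = (0 < z i).
  by apply/idP/idP => [/set_mem//|?]; apply/mem_set.
case: ifPn => [zi|zi]; last first.
  apply: integral0_eq => y _; rewrite /frag_weight.
  case: ifP => [/andP[y0 /(lt_trans y0)]|]; last by rewrite mul0r.
  by rewrite (negbTE zi).
rewrite /G1/= zi ms_e/= le_mass/= fineK; last first.
  have := dens_int_fin zi (mchk_int (z i) (e z)) (chk_int_bound (z i) (e z)).
  by rewrite ms_e.
apply: eq_integral => y _; rewrite /frag_weight /dens; case: ifP => [yz|]; last by rewrite !mul0r.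
have [y0 yz'] := andP yz.
rewrite /osplit (ltW y0) (ltW yz')/= !cyl_chk /cc /= -/(norm_rate lam z).
rewrite [norm_rate _ _ * _]mulrC -mulrA.
congr ((_ * (_ * ((nat_of_bool _)%:R * (nat_of_bool _)%:R)))%:E); last first.
  by apply: eq_chk => // t k t0; rewrite cn_e.
apply: eq_chk => // t k t0; rewrite cn_e// addr0.
have g0 x : (0 <= (t < x)%R%:R%:E :> \bar R)%E by rewrite lee_fin.
have := gsum_split g0 yz; rewrite -/(cnt t z) -EFinD => <-.
by rewrite eqe_addr.
Qed.

Let mJ : measurable_fun setT (fun u : (RT * RT) * S => J u.1 u.2).
Proof.
have m1 : measurable_fun setT (fun u : (RT * RT) * S => u.1.1 : R).
  exact: (measurableT_comp measurable_fst measurable_fst).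
have m2 : measurable_fun setT (fun u : (RT * RT) * S => u.1.2 : R).
  exact: (measurableT_comp measurable_snd measurable_fst).
have mcn2 t : 0 < t -> measurable_fun setT (fun u : (RT * RT) * S => cn t u.2).
  by move=> t0; exact: (measurableT_comp (mcn t0) measurable_snd).
apply: measurable_funM.
  apply: (measurableT_comp (measurable_powR _)).
  apply: (measurableT_comp (fine_measurable measurableT)).
  apply: emeasurable_funD; first exact: (measurableT_comp mms measurable_snd).
  by apply/measurable_EFinP; exact: measurable_funD.
apply: measurable_funM; apply: measurable_bool_num.
  apply: (@measurable_chk _ _ _ _ (fun t (u : (RT * RT) * S) => (cn t u.2 + (gt01 t u.1.1 + gt01 t u.1.2)%R%:E)%E) (fun t _ => 0)) => // t t0.
  apply: emeasurable_funD; first exact: mcn2.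
  by apply/measurable_EFinP; apply: measurable_funD; exact: measurable_gt01.
apply: (@measurable_chk _ _ _ _ (fun t (u : (RT * RT) * S) => (cn t u.2 + (gt01 t (u.1.1 + u.1.2))%:E)%E) (fun t _ => 0)) => // t t0.
apply: emeasurable_funD; first exact: mcn2.
by apply/measurable_EFinP; apply: measurable_gt01; exact: measurable_funD.
Qed.

Let msum : measurable_fun setT (fun q : RT * RT => (q.1 : R) + (q.2 : R) : RT).
Proof. exact: measurable_funD. Qed.

Let mkJ : measurable_fun setT (fun q : RT * RT => \int[P1 ((q.1 : R) + (q.2 : R))%R]_s (J q s)%:E)%E.
Proof.
apply: (measurable_fun_integral_precomp P1 msum (g := fun u => (J u.1 u.2)%:E)).
  by move=> u; rewrite lee_fin.
exact/measurable_EFinP.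
Qed.

Let m_frag_r1 D : measurable D -> (forall q, D q -> inq q) ->
  measurable_fun D (fun q : RT * RT => (frag_rate H2 q.1 q.2 * r1 ((q.1 : R) + (q.2 : R))%R)%:E : \bar R).
Proof.
move=> mD Dq; apply/measurable_EFinP; apply: measurable_funM.
  apply: measurable_funM; first by apply: measurable_funTS; exact: measurable_funD.
  apply: (measurable_rate_comp hom2) => //; try exact: measurable_funTS.
  by move=> q /Dq /andP[].
apply: (@measurable_comp _ _ _ _ _ _ (half_line R) r1 _ (fun q : RT * RT => ((q.1 : R) + (q.2 : R) : RT))) => //.
- exact: measurable_itv.
- move=> _ [q /Dq /andP[q1 q2] <-]; rewrite /half_line/= in_itv/= andbT; exact: addr_gt0.
- exact: measurable_funTS.
Qed.

Let mtau : measurable_fun setT tau.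
Proof.
apply: measurable_fun_if => //; set D := _ `&` _; have mD : measurable D by apply: minq.
apply: emeasurable_funM; last exact: measurable_funTS.
by apply: m_frag_r1 => // q [].
Qed.

Let tau_ge0 q : (0 <= tau q)%E.
Proof.
rewrite /tau; case: ifP => // /andP[q1 q2]; apply: mule_ge0.
  by rewrite lee_fin mulr_ge0 ?frag_ge0 ?r1_ge0 ?addr_gt0.
by apply: integral_ge0 => s _; rewrite lee_fin.
Qed.

Let coag_side :
  (\int[P]_w \int[counting]_p (coag_weight lam H1 (X w) p *
     (\1_(cyl a) (X w) * \1_(cyl b) (omerge p.1 p.2 (X w))))%:E = \int[mu2]_q tau q)%E.
Proof.
under eq_integral do rewrite coag_term.
rewrite (palm2 mG2 G2_ge0 G2_bound G2_diag_bound).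
transitivity (\int[mu2]_(q in quadrant R) tau q)%E; last first.
  rewrite [LHS]integral_mkcond; apply: eq_integral => q _; rewrite patchE inqE /tau.
  by case: (inq q).
have mJs (q : RT * RT) : measurable_fun setT (fun s => (J q s)%:E).
  apply/measurable_EFinP; apply: (measurableT_comp mJ (_ : measurable_fun setT (fun s => (q, s)))).
  exact: measurable_fun_pair.
have E (q : RT * RT) : quadrant R q -> ((r2 q)%:E * \int[P2 q]_s (G2 (q, ad (ad s q.1) q.2))%:E =
    (coag_rate H1 q.1 q.2 * r2 q)%:E * \int[P2 q]_s (J q s)%:E)%E.
  move=> [q1 q2].
  under eq_integral do rewrite G2_ad ?/inq ?q1 ?q2// EFinM.
  rewrite ge0_integralZl//; [|by move=> s _; rewrite lee_fin|by rewrite lee_fin coag_ge0].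
  by rewrite muleA -EFinM mulrC.
rewrite (@eq_integral _ _ _ mu2 _ (fun q => (coag_rate H1 q.1 q.2 * r2 q)%:E * \int[P2 q]_s (J q s)%:E)%E); last first.
  by move=> q /set_mem; exact: E.
(* The assumed identity between Palm distributions enters here: at almost every [q] two scaled
   measures agree, hence so do their integrals of [J q]. *)
apply: ge0_ae_eq_integral => //.
- apply: emeasurable_funM.
    apply/measurable_EFinP; apply: measurable_funM => //.
    apply: measurable_funM; first by apply: measurable_funM; exact: measurable_funTS.
    apply: (measurable_rate_comp hom1) => //; exact: measurable_funTS.
  apply: measurable_funTS.
  apply: (measurable_fun_integral_finite_kernel (fun u => (J u.1 u.2)%:E) P2).
    by move=> u; rewrite lee_fin.
  exact/measurable_EFinP.
- exact: measurable_funTS.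
- move=> q [q1 q2]; apply: mule_ge0; last by apply: integral_ge0 => s _; rewrite lee_fin.
  by rewrite lee_fin mulr_ge0 ?coag_ge0 ?r2_ge0.
- apply: filterS balance => q h Dq; have {}h := h Dq; have [q1 q2] := Dq.
  rewrite /tau /inq q1 q2/=; apply: integral_scaled_eq => //.
  + by rewrite mulr_ge0 ?coag_ge0 ?r2_ge0.
  + by rewrite mulr_ge0 ?frag_ge0 ?r1_ge0 ?addr_gt0.
  + by move=> s; rewrite lee_fin.
Qed.

Let mtaus : measurable_fun setT (fun v : RT * RT => tau (v.2, ((v.1 : R) - (v.2 : R))%R)).
Proof.
apply: (measurableT_comp mtau).
by apply: measurable_fun_pair; [exact: measurable_snd|exact: measurable_funB].
Qed.

Let frag_side :
  (\int[P]_w \int[counting]_i \int[mu]_y (frag_weight lam H2 (X w) i y *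
     (\1_(cyl a) (osplit i y (X w)) * \1_(cyl b) (X w)))%:E = \int[mu2]_q tau q)%E.
Proof.
under eq_integral do rewrite frag_term.
rewrite (palm1 mG1 G1_ge0 G1_bound).
have E (x : RT) : x \in half_line R -> ((r1 x)%:E * \int[P1 x]_s (G1 (x, ad s x))%:E =
   \int[mu]_y tau (y, ((x : R) - (y : R))%R))%E.
  move=> /set_mem; rewrite /half_line/= in_itv/= andbT => x0.
  under eq_integral do rewrite G1_ad//.
  have mj : measurable_fun setT (fun v : S * RT => (dens x v.2 * J (v.2, x - v.2) v.1)%:E).
    apply/measurable_EFinP; apply: measurable_funM.
      by apply: mdens => //; exact: measurable_snd.
    apply: (measurableT_comp mJ (_ : measurable_fun setT (fun v : S * RT => ((v.2, (x - (v.2 : R))%R : RT) : RT * RT, v.1)))).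
    apply: measurable_fun_pair; last exact: measurable_fst.
    apply: measurable_fun_pair; first exact: measurable_snd.
    by apply: measurable_funB => //; exact: measurable_snd.
  have jp v : (0 <= (dens x v.2 * J (v.2, x - v.2) v.1)%:E)%E by rewrite lee_fin mulr_ge0.
  have := @fubini_tonelli _ _ S RT R (kernel_at P1 x) mu (fun v => (dens x v.2 * J (v.2, x - v.2) v.1)%:E) mj jp.
  rewrite [X in X = _ -> _](_ : _ = \int[P1 x]_s \int[mu]_y (dens x y * J (y, x - y) s)%:E)%E// => ->.
  rewrite -ge0_integralZl//; last 3 first.
  - exact: (measurable_fun_fubini_tonelli_G (m1 := kernel_at P1 x) _ mj jp).
  - by move=> y _; apply: integral_ge0 => s _; exact: (jp (s, y)).
  - by rewrite lee_fin r1_ge0.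
  apply: eq_integral => y _; rewrite /tau /inq /= /dens.
  rewrite subr_gt0; case: ifP => [/andP[y0 yx]|_]; last first.
    by rewrite integral0_eq ?mule0// => s _; rewrite mul0r.
  have -> : (y + (x - y) = x)%R by rewrite addrC subrK.
  rewrite [in RHS]mulrC EFinM -muleA; congr (_ * _)%E.
  rewrite -ge0_integralZl//; last 3 first.
  - apply/measurable_EFinP; apply: (measurableT_comp mJ (_ : measurable_fun setT (fun s => ((y, x - y) : RT * RT, s)))).
    exact: measurable_fun_pair.
  - by move=> s _; rewrite lee_fin.
  - by rewrite lee_fin frag_ge0// subr_gt0.
have EE := @eq_integral _ _ _ mu (half_line R) (fun x : RT => \int[mu]_y tau (y, ((x : R) - (y : R))%R))%E
  (fun x : RT => (r1 x)%:E * \int[P1 x]_s (G1 (x, ad s x))%:E)%E E.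
apply: etrans EE _.
(* [tau] vanishes outside the quadrant, so both variables may run over the whole line; the order is
   then exchanged and [x] translated by [y]. *)
transitivity (\int[mu]_x \int[mu]_y tau (y, ((x : R) - (y : R))%R))%E.
  rewrite [LHS]integral_mkcond; apply: eq_integral => x _; rewrite patchE.
  case: ifPn => // /negP xn; apply/esym; apply: integral0_eq => y _; rewrite /tau /inq/= subr_gt0.
  case: ifP => // /andP[y0 yx]; exfalso; apply: xn; apply/mem_set.
  by rewrite /half_line/= in_itv/= andbT (lt_trans y0).
rewrite (@fubini_tonelli _ _ RT RT R mu mu (fun v => tau (v.2, ((v.1 : R) - (v.2 : R))%R)) mtaus)//.
transitivity (\int[mu]_y \int[mu]_u tau (y, u))%E; last by rewrite -(fubini_tonelli1 tau).
apply: eq_integral => y _.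
have my : measurable_fun setT (fun x : RT => tau (y, ((x : R) - (y : R))%R)).
  apply: (measurableT_comp mtau); apply: measurable_fun_pair => //.
  exact: measurable_funB.
apply: etrans (ge0_integral_translation y my (fun x => tau_ge0 _)) _.
by apply: eq_integral => u _; rewrite addrK.
Qed.

Lemma balance_cyl :
  (\int[P]_w \int[counting]_p (coag_weight lam H1 (X w) p *
     (\1_(cyl a) (X w) * \1_(cyl b) (omerge p.1 p.2 (X w))))%:E =
   \int[P]_w \int[counting]_i \int[mu]_y (frag_weight lam H2 (X w) i y *
     (\1_(cyl a) (osplit i y (X w)) * \1_(cyl b) (X w)))%:E)%E.
Proof. by rewrite coag_side frag_side. Qed.

End core.

(** * From cylinders to all test functions *)

Section balance_extension.
Context {R : realType}.
Local Notation RT := (measurableTypeR R).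
Local Notation mu := (@lebesgue_measure R).
Variables (lam : R) (H1 H2 : R -> R -> R).
Hypothesis lam0 : 0 <= lam.
Hypothesis hom1 : homogeneous_rate lam H1.
Hypothesis sup1 : (rate_sup H1 < +oo)%E.
Hypothesis hom2 : homogeneous_rate lam H2.
Context d (W : measurableType d) (P : probability W R) (X : W -> Omega R).
Hypothesis mX : measurable_fun setT X.

Local Notation cw := (coag_weight lam H1).
Local Notation fw := (frag_weight lam H2).

Let kc (q : W * (nat * nat)) : R := cw (X q.1) q.2.
Let kc0 q : 0 <= kc q. Proof. exact: (coag_weight_ge0 hom1). Qed.
Let mkc : measurable_fun setT kc.
Proof.
apply: measurable_fun_pairs => p; exact: (measurableT_comp (measurable_coag_weight hom1 p) mX).
Qed.
Let phic (q : W * (nat * nat)) : Omega R * Omega R := (X q.1, omerge q.2.1 q.2.2 (X q.1)).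
Let mphic : measurable_fun setT phic.
Proof.
apply: measurable_fun_pairs => p; apply: measurable_fun_pair => //.
exact: (measurableT_comp (measurable_omerge _ _) mX).
Qed.

Let kf i (q : W * RT) : R := fw (X q.1) i q.2.
Let kf0 i q : 0 <= kf i q. Proof. exact: (frag_weight_ge0 hom2). Qed.
Let mXf (i : nat) : measurable_fun setT (fun q : W * RT => ((X q.1, i), q.2)).
Proof.
apply: measurable_fun_pair; last exact: measurable_snd.
by apply: measurable_fun_pair => //; exact: (measurableT_comp mX measurable_fst).
Qed.
Let mkf i : measurable_fun setT (kf i).
Proof. exact: (measurableT_comp (measurable_frag_weight hom2) (mXf i)). Qed.
Let phif i (q : W * RT) : Omega R * Omega R := (osplit i q.2 (X q.1), X q.1).
Let mphif i : measurable_fun setT (phif i).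
Proof.
apply: measurable_fun_pair; first exact: (measurableT_comp measurable_osplit_mid (mXf i)).
exact: (measurableT_comp mX measurable_fst).
Qed.

(** [nuc] is the intensity of pairs formed by a state and its coagulation; [nuf] is that of pairs
    formed by a fragmented state and its origin, that is, of fragmentations read backwards. Detailed
    balance is the equality of the two. *)
Let nuc := wpush (P \x counting_pairs R)%E kc0 mkc mphic.
Let nuf := mseries (fun i => wpush (P \x mu)%E (kf0 i) (mkf i) (mphif i)) 0.

Let nucE (h : Omega R * Omega R -> R) : measurable_fun setT h -> (forall q, 0 <= h q) ->
  (\int[nuc]_q (h q)%:E =
   \int[P]_w \int[counting]_p (cw (X w) p * h (X w, omerge p.1 p.2 (X w)))%:E)%E.
Proof.
move=> mh h0; rewrite (@ge0_integral_wpush _ _ _ _ _ _ _ _ kc0 mkc mphic (EFin \o h)); last 2 first.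
- by move=> y; rewrite lee_fin.
- exact/measurable_EFinP.
rewrite fubini_tonelli1//; last 2 first.
- apply: emeasurable_funM; first exact/measurable_EFinP.
  by apply/measurable_EFinP; exact: (measurableT_comp mh mphic).
- by move=> q; rewrite mule_ge0 ?lee_fin.
Qed.

Let nufE (h : Omega R * Omega R -> R) : measurable_fun setT h -> (forall q, 0 <= h q) ->
  (\int[nuf]_q (h q)%:E =
   \int[P]_w \int[counting]_i \int[mu]_y (fw (X w) i y * h (osplit i y (X w), X w))%:E)%E.
Proof.
move=> mh h0; have mhE : measurable_fun setT (EFin \o h) by exact/measurable_EFinP.
have hE0 q : (0 <= (EFin \o h) q)%E by rewrite lee_fin.
rewrite ge0_integral_measure_series//; last by move=> q _; exact: hE0.
have mm i : measurable_fun setT (fun x => (kf i x)%:E * (EFin \o h) (phif i x))%E.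
  apply: emeasurable_funM; first exact/measurable_EFinP.
  exact: (measurableT_comp mhE (mphif i)).
have m0 i x : (0 <= (kf i x)%:E * (EFin \o h) (phif i x))%E by rewrite mule_ge0 ?lee_fin.
transitivity (\sum_(0 <= i <oo) \int[P]_w \int[mu]_y ((kf i (w, y))%:E * (EFin \o h) (phif i (w, y))))%E.
  apply: eq_eseriesr => i _.
  rewrite (@ge0_integral_wpush _ _ _ _ _ _ _ _ (kf0 i) (mkf i) (mphif i) (EFin \o h))//.
  exact: (@fubini_tonelli1 _ _ W RT R P mu _ (mm i) (m0 i)).
have i0 i w : (0 <= \int[mu]_y ((kf i (w, y))%:E * (EFin \o h) (phif i (w, y))))%E.
  by apply: integral_ge0 => y _; exact: m0.
rewrite -integral_nneseries//; last first.
  by move=> i; exact: (measurable_fun_fubini_tonelli_F _ (mm i) (m0 i)).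
by apply: eq_integral => w _; rewrite [RHS]ge0_integral_count//; move=> i; exact: (i0 i w).
Qed.

Let indX (A B : set (Omega R)) q : \1_(A `*` B) q = \1_A q.1 * \1_B q.2 :> R.
Proof. by rewrite !indicE in_setX -natrM mulnb. Qed.

Hypothesis balance_cyl : forall a b : seq (R * nat),
  all (fun p : R * nat => 0 < p.1) a -> all (fun p : R * nat => 0 < p.1) b ->
  (\int[P]_w \int[counting]_p (cw (X w) p * (\1_(cyl a) (X w) * \1_(cyl b) (omerge p.1 p.2 (X w))))%:E =
   \int[P]_w \int[counting]_i \int[mu]_y (fw (X w) i y * (\1_(cyl a) (osplit i y (X w)) * \1_(cyl b) (X w)))%:E)%E.

Lemma balance_fun (h : Omega R * Omega R -> R) : measurable_fun setT h -> (forall q, 0 <= h q) ->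
  (\int[P]_w \int[counting]_p (cw (X w) p * h (X w, omerge p.1 p.2 (X w)))%:E =
   \int[P]_w \int[counting]_i \int[mu]_y (fw (X w) i y * h (osplit i y (X w), X w))%:E)%E.
Proof.
move=> mh h0; rewrite -nucE// -nufE//; apply: eq_measure_integral => C mC _.
have iE (m : {measure set (Omega R * Omega R) -> \bar R}) B : measurable B -> m B = (\int[m]_q (\1_B q)%:E)%E.
  by move=> mB; rewrite integral_indic// setIT.
apply: (finite_measure_unique_prod (@measurable_cylinders R) (@measurable_cylinders R)) => //.
- exact: cylinders_setT.
- exact: cylinders_setT.
- exact: cylinders_setI.
- exact: cylinders_setI.
(* The total mass is finite because the normalized coagulation rates have a sum bounded uniformly in
   the state. *)
- rewrite iE// nucE//.
  apply: (@le_lt_trans _ _ (\int[P]_w (fine (rate_sup H1))%:E)%E); last first.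
    by rewrite (@integral_cst _ _ _ P setT measurableT) [X in (_ * X)%E]probability_setT mule1 ltry.
  apply: ge0_le_integral => //.
  + by move=> w _; apply: integral_ge0 => p _; rewrite lee_fin mulr_ge0// (coag_weight_ge0 hom1).
  + apply: (measurable_fun_fubini_tonelli_F (m2 := counting_pairs R) (fun q => (kc q * \1_setT (phic q))%:E)).
      apply/measurable_EFinP; apply: measurable_funM => //.
      exact: (measurableT_comp (measurable_indic measurableT) mphic).
    by move=> q; rewrite lee_fin mulr_ge0.
  + move=> w _; under eq_integral do rewrite indicT mulr1.
    exact: integral_coag_weight.
move=> _ _ [a /= ap <-] [b /= bp <-].
have ma : measurable (cyl a) by apply: cylinders_measurable; exists a.
have mb : measurable (cyl b) by apply: cylinders_measurable; exists b.
have mab : measurable (cyl a `*` cyl b) by exact: measurableX.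
rewrite !iE// nucE// nufE//.
under eq_integral do under eq_integral do rewrite indX.
under [RHS]eq_integral do under eq_integral do under eq_integral do rewrite indX.
exact: balance_cyl.
Qed.

End balance_extension.

Section reversible_of_palm.
Context {R : realType}.
Local Notation RT := (measurableTypeR R).
Local Notation mu := (@lebesgue_measure R).
Local Notation mu2 := (mu \x mu)%E.
Context d (W : measurableType d) (P : probability W R) (X : W -> Omega R).
Context dS (S : measurableType dS).

Lemma balance_of_palm (lam : R) (H1 H2 : R -> R -> R)
  (e : Omega R -> S) (cn : R -> S -> \bar R) (ms : S -> \bar R) (ad : S -> R -> S)
  (r1 : RT -> R) (r2 : RT * RT -> R)
  (P1 : R.-pker RT ~> S) (P2 : R.-pker (RT * RT)%type ~> S) :
  0 <= lam -> homogeneous_rate lam H1 -> (rate_sup H1 < +oo)%E ->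
  homogeneous_rate lam H2 -> (rate_int H2 < +oo)%E -> measurable_fun setT X ->
  (forall t, 0 < t -> measurable_fun setT (cn t)) ->
  measurable_fun setT ms -> (forall s, (0 <= ms s)%E) ->
  (forall t z, 0 < t -> cn t (e z) = cnt t z) ->
  (forall z, ms (e z) = (mass z)%:E) ->
  (forall t s x, 0 < t -> 0 < x -> cn t (ad s x) = (cn t s + (gt01 t x)%:E)%E) ->
  (forall s x, 0 < x -> ms (ad s x) = (ms s + x%:E)%E) ->
  measurable_fun (half_line R) r1 -> (forall x, 0 < x -> 0 <= r1 x) ->
  measurable_fun (quadrant R) r2 -> (forall q, 0 < q.1 -> 0 < q.2 -> 0 <= r2 q) ->
  (forall G : RT * S -> R, measurable_fun setT G ->
    (forall u, 0 <= G u) -> (exists C, forall u, G u <= C) ->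
    (\int[P]_w \int[counting]_(i in pos_idx (X w)) (G (X w i, e (X w)))%:E
     = \int[mu]_(x in half_line R) ((r1 x)%:E * \int[P1 x]_s (G (x, ad s x))%:E))%E) ->
  (forall G : (RT * RT) * S -> R, measurable_fun setT G ->
    (forall u, 0 <= G u) -> (exists C, forall u, G u <= C) ->
    (exists C, forall u, G u * fine (ms u.2) <= C * `|u.1.1 : R|) ->
    (\int[P]_w \int[counting]_(p in pos_pairs (X w)) (G ((X w p.1, X w p.2), e (X w)))%:E
     = \int[mu2]_(q in quadrant R) ((r2 q)%:E * \int[P2 q]_s (G (q, ad (ad s q.1) q.2))%:E))%E) ->
  {ae mu2, forall q, quadrant R q -> forall U, measurable U ->
    ((coag_rate H1 q.1 q.2 * r2 q)%:E * P2 q U =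
     (frag_rate H2 q.1 q.2 * r1 ((q.1 : R) + (q.2 : R))%R)%:E * P1 ((q.1 : R) + (q.2 : R))%R U)%E} ->
  forall h : Omega R * Omega R -> R, measurable_fun setT h -> (forall q, 0 <= h q) ->
  (\int[P]_w \int[counting]_p (coag_weight lam H1 (X w) p * h (X w, omerge p.1 p.2 (X w)))%:E =
   \int[P]_w \int[counting]_i \int[mu]_y (frag_weight lam H2 (X w) i y * h (osplit i y (X w), X w))%:E)%E.
Proof.
move=> lam0 hom1 sup1 hom2 int2 mX mcn mms ms0 cne mse cnad msad mr1 r10 mr2 r20 p1 p2 bal.
apply: balance_fun => // a b ap bp; exact: (balance_cyl lam0 hom1 sup1 hom2 int2 mcn mms ms0 cne mse cnad msad mr1 r10 mr2 r20 p1 p2 bal).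
Qed.

End reversible_of_palm.

(** * Measurable functionals of configurations *)

Section configuration_measurability.
Context {R : realType}.
Local Notation RT := (measurableTypeR R).
Implicit Types (eta : config R) (f k : R -> R) (t x : R) (n : nat).

(** A continuous approximation of the indicator of []t, +oo[], increasing in [n] when [t >= 0]: for
    large [n] it climbs between [t + 1/n] and [t + 2/n] and descends between [n - 1] and [n]. The
    vague topology sees functions of compact support only. *)
Definition bump t n x : R :=
  Num.max 0 (Num.min 1 (Num.min (n%:R * (x - t) - 1) (n%:R - x))).

Lemma bump_ge0 t n x : 0 <= bump t n x.
Proof. by rewrite le_max lexx. Qed.

Lemma bump_le1 t n x : bump t n x <= 1.
Proof. by rewrite ge_max ler01 ge_min lexx. Qed.

(** The successor keeps the lower endpoint above [t], hence positive, even for [n = 0]. *)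
Lemma bump_support t n x : 0 <= t -> bump t n x != 0 -> t + n.+1%:R^-1 <= x <= n%:R.
Proof.
move=> t0 xn.
have : 0 < Num.min 1 (Num.min (n%:R * (x - t) - 1) (n%:R - x)).
  by rewrite ltNge; apply: contra xn => h; rewrite /bump max_l.
rewrite !lt_min subr_gt0 subr_gt0 => /and3P[_ h1 /ltW ->]; rewrite andbT.
rewrite -lerBrDl -[leLHS]mul1r ler_pdivrMr ?ltr0n// (le_trans (ltW h1))//.
have xt : 0 < x - t.
  by rewrite ltNge; apply/negP => h; move: h1; rewrite ltNge (le_trans (mulr_ge0_le0 _ h)).
by rewrite mulrC ler_pM2l// ler_nat.
Qed.

Lemma bump_continuous t n : continuous (bump t n).
Proof.
have c1 : continuous (fun _ : R => 1 : R) by exact: cst_continuous.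
have c2 : continuous (fun x : R => n%:R * (x - t) - 1).
  move=> x; apply: cvgB; last exact: cvg_cst.
  by apply: cvgM; [exact: cvg_cst|apply: cvgB; [exact: cvg_id|exact: cvg_cst]].
have c3 : continuous (fun x : R => n%:R - x).
  by move=> x; apply: cvgB; [exact: cvg_cst|exact: cvg_id].
move=> x; have c0 : continuous (fun _ : R => 0 : R) by exact: cst_continuous.
exact: (@continuous_max R R _ _ x (c0 x) (@continuous_min R R _ _ x (c1 x)
  (@continuous_min R R _ _ x (c2 x) (c3 x)))).
Qed.

Lemma bump_homo t x : 0 <= t -> {homo (fun n => bump t n x) : m n / (m <= n)%N >-> m <= n}.
Proof.
move=> t0 m n mn; have [xt|xt] := leP x t.
  rewrite [leLHS](_ : _ = 0) ?bump_ge0//; rewrite /bump max_l// ge_min; apply/orP; right.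
  rewrite ge_min subr_le0; apply/orP; left.
  by rewrite (le_trans (mulr_ge0_le0 _ _))// subr_le0.
have nm : m%:R <= n%:R :> R by rewrite ler_nat.
apply: le_max2 => //; apply: le_min2 => //; apply: le_min2; last by rewrite lerD2r.
by rewrite lerD2r ler_wpM2r// subr_ge0 ltW.
Qed.

Lemma bump_cvg t x : 0 <= t -> (bump t n x @[n --> \oo]) --> ((t < x)%R%:R : R).
Proof.
move=> t0; have [xt|xt] := leP x t.
  rewrite (_ : (fun n => bump t n x) = fun=> 0); first exact: cvg_cst.
  apply/funext => n; rewrite /bump max_l// ge_min; apply/orP; right.
  rewrite ge_min subr_le0; apply/orP; left.
  by rewrite (le_trans (mulr_ge0_le0 _ _))// subr_le0.
apply: (@cvg_near_cst _ _ _ _ _ _).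
have xt0 : 0 < x - t by rewrite subr_gt0.
near=> n.
(* Under these two bounds on [n], the point [x] lies where the function is equal to 1. *)
have n1 : 2 <= n%:R * (x - t).
  by rewrite -ler_pdivrMr//; near: n; exact: nbhs_infty_ger.
have n2 : x + 1 <= n%:R by near: n; exact: nbhs_infty_ger.
rewrite /bump min_l ?max_r ?ler01//.
by rewrite le_min; apply/andP; split; lra.
Unshelve. all: by end_near. Qed.

Lemma config_finite eta (a b : R) : 0 < a -> (eta `[a, b]%classic < +oo)%E.
Proof.
move=> a0; have [_ h] := configP eta.
by have [n ->] := h `[a, b]%classic a b (measurable_itv _) a0 (fun x hx => hx); rewrite ltry.
Qed.

Lemma measurable_config_eval (f : Cc_pos R) :
  measurable_fun setT (fun eta : config R => config_eval eta f).
Proof.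
apply: (@measurability _ _ (config R) R setT _ (@RGenOInfty.G R)).
  exact: RGenOInfty.measurableE.
move=> _ [_ [r ->] <-]; rewrite setTI; apply: sub_sigma_algebra.
have oB : open (`]r, +oo[%classic : set R) by exact: interval_open.
move: (`]r, +oo[%classic) oB; apply/continuousP.
have c1 : continuous (@config_eval R) by exact: initial_continuous.
have c2 : continuous (proj f : prod_topology (fun _ : Cc_pos R => R) -> R) by exact: proj_continuous.
move=> eta; exact: (@continuous_comp _ _ _ (@config_eval R) (proj f) eta (c1 eta) (c2 _)).
Qed.

Variable k : R -> R.
Hypothesis ck : continuous k.
Hypothesis k0 : forall x, 0 < x -> 0 <= k x.
Hypothesis kC : forall b, exists C, forall x, 0 < x <= b -> k x <= C.
Variable t : R.
Hypothesis t0 : 0 <= t.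

Let kb n x := k x * bump t n x.

Let kb_Cc n : continuous (kb n) /\
   exists a b : R, 0 < a /\ forall x, kb n x != 0 -> a <= x <= b.
Proof.
split; first by move=> x; apply: cvgM; [exact: ck|exact: bump_continuous].
exists (t + n.+1%:R^-1), n%:R; split; first by rewrite ltr_wpDl// invr_gt0 ltr0n.
move=> x; rewrite mulf_eq0 negb_or => /andP[_]; exact: bump_support.
Qed.

Let kb_ge0 n x : 0 <= kb n x.
Proof.
have [->|h] := eqVneq (kb n x) 0; first by [].
rewrite mulr_ge0 ?bump_ge0//; apply: k0.
move: h; rewrite mulf_eq0 negb_or => /andP[_ /(bump_support t0)/andP[h _]].
by apply: lt_le_trans h; rewrite ltr_wpDl// invr_gt0 ltr0n.
Qed.

Let mkb n : measurable_fun setT (kb n : RT -> R).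
Proof. by apply: continuous_measurable_fun; have [] := kb_Cc n. Qed.

(** [config_eval] is a real-valued integral, so finiteness is needed to recover the extended one
    from it. *)
Let kb_int eta n : (\int[eta]_(x in half_line R) (kb n x)%:E)%E \is a fin_num.
Proof.
have [C hC] := kC n%:R.
have i0 : (0 <= \int[eta]_(x in half_line R) (kb n x)%:E)%E.
  by apply: integral_ge0 => x _; rewrite lee_fin.
rewrite ge0_fin_numE//.
pose a := t + n.+1%:R^-1; have a0 : 0 < a by rewrite ltr_wpDl// invr_gt0 ltr0n.
apply: (@le_lt_trans _ _ (\int[eta]_(x in half_line R) (`|C| * \1_(`[a, n%:R]%classic : set RT) x)%:E)%E).
  apply: ge0_le_integral => //; try exact: measurable_itv.
  - by move=> x _; rewrite lee_fin.
  - by apply/measurable_EFinP; exact: measurable_funTS.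
  - by apply/measurable_EFinP; apply: measurable_funM => //; apply: measurable_indic; exact: measurable_itv.
  - move=> x; rewrite /half_line/= in_itv/= andbT => x0; rewrite lee_fin.
    have [h|h] := eqVneq (kb n x) 0; first by rewrite h mulr_ge0.
    have xab : a <= x <= n%:R.
      by move: h; rewrite mulf_eq0 negb_or => /andP[_ /(bump_support t0)].
    rewrite indicE mem_set/=; last by rewrite in_itv/=.
    rewrite mulr1 /kb -[leRHS]mulr1 ler_pM ?bump_ge0 ?bump_le1 ?k0//.
    by rewrite (le_trans _ (ler_norm _))// hC// x0; case/andP: xab.
under eq_integral do rewrite EFinM.
rewrite ge0_integralZl//; [|exact: measurable_itv|].
  rewrite integral_indic//; try exact: measurable_itv.
  rewrite lte_mul_pinfty ?lee_fin//.
  apply: le_lt_trans (config_finite eta n%:R a0).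
  by apply: le_measure; rewrite ?inE; [apply: measurableI; exact: measurable_itv|exact: measurable_itv|exact: subIsetl].
by apply/measurable_EFinP; apply: measurable_indic; exact: measurable_itv.
Qed.

(** A monotone limit of evaluations at functions of compact support. Counts are the case [k = 1]
    with [t > 0], the mass is the case of the identity with [t = 0]. *)
Lemma measurable_config_integral :
  measurable_fun setT (fun eta : config R => \int[eta]_(x in `]t, +oo[) (k x)%:E)%E.
Proof.
apply: (@emeasurable_fun_cvg _ _ _ _ (fun n eta => (config_eval eta (exist _ (kb n) (kb_Cc n)))%:E)).
  by move=> n; apply/measurable_EFinP; exact: measurable_config_eval.
move=> eta _.
rewrite (_ : (fun n => _) = fun n => (\int[eta]_(x in half_line R) (kb n x)%:E)%E); last first.
  by apply/funext => n; rewrite /config_eval/= /Rintegral fineK//; exact: kb_int.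
rewrite (_ : (\int[eta]_(x in `]t, +oo[) (k x)%:E)%E =
    (\int[eta]_(x in half_line R) limn (fun n => (kb n x)%:E))%E); last first.
  rewrite integral_mkcond [RHS]integral_mkcond; apply: eq_integral => x _; rewrite !patchE.
  have lim : (kb n x)%:E @[n --> \oo] --> (k x * (t < x)%R%:R)%:E.
    apply: cvg_EFin; first by near=> n.
    by apply: cvgM; [exact: cvg_cst|exact: bump_cvg].
  have -> : (x \in `]t, +oo[%classic) = (t < x).
    by apply/idP/idP => [/set_mem/=|h]; [|apply/mem_set]; rewrite /= in_itv/= andbT.
  have -> : (x \in half_line R) = (0 < x).
    by apply/idP/idP => [/set_mem|h]; [|apply/mem_set]; rewrite /half_line/= in_itv/= andbT.
  rewrite (cvg_lim _ lim)//; case: ltP => tx; last by rewrite mulr0; case: ifP.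
  by rewrite (le_lt_trans t0 tx) mulr1.
apply: cvg_monotone_convergence.
- exact: measurable_itv.
- by move=> n; apply/measurable_EFinP; exact: measurable_funTS.
- by move=> n x _; rewrite lee_fin.
- move=> x; rewrite /half_line/= in_itv/= andbT => x0 m n mn.
  by rewrite lee_fin ler_wpM2l ?k0//; exact: bump_homo.
Unshelve. all: by end_near. Qed.

End configuration_measurability.

Section configuration_counts.
Context {R : realType}.
Local Notation RT := (measurableTypeR R).
Implicit Types (eta : config R) (t x : R) (z : Omega R).

Definition config_count t eta : \bar R := eta `]t, +oo[%classic.
Definition config_mass eta : \bar R := (\int[eta]_(x in `]0%R, +oo[) x%:E)%E.

Lemma measurable_config_count t : 0 < t -> measurable_fun setT (config_count t).
Proof.
move=> t0; rewrite (_ : config_count t = fun eta => \int[eta]_(x in `]t, +oo[) 1%:E)%E.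
  apply: (@measurable_config_integral R (fun=> 1)) => //.
  - by move=> x; exact: cvg_cst.
  - by move=> b; exists 1.
  - exact: ltW.
by apply/funext => eta; rewrite integral_cst ?mul1e//; exact: measurable_itv.
Qed.

Lemma measurable_config_mass : measurable_fun setT config_mass.
Proof.
apply: (@measurable_config_integral R id) => //.
- by move=> x; exact: cvg_id.
- by move=> x; exact: ltW.
- by move=> b; exists b => x /andP[].
Qed.

Lemma config_mass_ge0 eta : (0 <= config_mass eta)%E.
Proof. by apply: integral_ge0 => x /=; rewrite in_itv/= andbT lee_fin => /ltW. Qed.

Lemma atomE x (A : set RT) : atom x A = ((0 < x) && (x \in A))%:R%:E.
Proof. by rewrite /atom; case: ifP => _ //=; rewrite diracE. Qed.

Lemma ge0_integral_atom x (D : set RT) (f : RT -> \bar R) : measurable D -> measurable_fun D f ->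
  (\int[atom x]_(y in D) f y = ((0 < x) && (x \in D))%:R%:E * f x)%E.
Proof.
move=> mD mf; rewrite /atom; case: ifP => _ /=; last by rewrite integral_measure_zero mul0e.
by rewrite integral_dirac// diracE.
Qed.

Lemma config_count_Xi t z : 0 < t -> config_count t (Xi z) = cnt t z.
Proof.
move=> t0; rewrite /config_count /= /mseries /cnt /gsum; apply: eq_eseriesr => i _.
rewrite atomE; congr (_%:R%:E); have -> : (z i \in `]t, +oo[%classic) = (t < z i).
  by apply/idP/idP => [/set_mem/=|h]; [|apply/mem_set]; rewrite /= in_itv/= andbT.
by case: (ltP t (z i)) => tz; rewrite ?andbF// (lt_trans t0 tz).
Qed.

Let in0 x : (x \in (`]0%R, +oo[%classic : set RT)) = (0 < x).
Proof. by apply/idP/idP => [/set_mem/=|h]; [|apply/mem_set]; rewrite /= in_itv/= andbT. Qed.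

Lemma config_mass_Xi z : config_mass (Xi z) = (mass z)%:E.
Proof.
rewrite /config_mass /= ge0_integral_measure_series//; last first.
  by move=> x /=; rewrite in_itv/= andbT lee_fin => /ltW.
rewrite -massE; apply: eq_eseriesr => i _.
rewrite ge0_integral_atom//.
rewrite in0 andbb; case: ltP => [_|zi]; first by rewrite mul1e.
by rewrite mul0e; congr EFin; apply/eqP; rewrite eq_le zi Omega_ge0.
Qed.

Lemma config_count_add t eta x : 0 < t -> 0 < x ->
  config_count t (add_point eta x) = (config_count t eta + (gt01 t x)%:E)%E.
Proof.
move=> t0 x0; apply: etrans (measure_addE _ _ _) _; congr (_ + _)%E.
rewrite atomE x0/=; congr (_%:R%:E); apply: congr1.
by apply/idP/idP => [/set_mem/=|h]; [|apply/mem_set]; rewrite /= in_itv/= andbT.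
Qed.

Lemma config_mass_add eta x : 0 < x -> config_mass (add_point eta x) = (config_mass eta + x%:E)%E.
Proof.
move=> x0; apply: etrans (ge0_integral_measure_add _ _ _ _ _) _ => //.
- by move=> y /=; rewrite in_itv/= andbT lee_fin => /ltW.
- by congr (_ + _)%E; rewrite ge0_integral_atom ?in0 ?x0 ?mul1e//; exact: measurable_itv.
Qed.

End configuration_counts.

Section correlation_balance.
Context {R : realType}.
Local Notation RT := (measurableTypeR R).

Lemma reversible_of_palm_balance (lam : R) (Hhat Hcheck : R -> R -> R)
    (d : measure_display) (W : measurableType d) (P : probability W R) (Z : {RV P >-> Omega R})
    (r1 : RT -> R) (r2 : RT * RT -> R)
    (P1 : R.-pker RT ~> config R) (P2 : R.-pker (RT * RT)%type ~> config R) : 0 <= lam ->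
  homogeneous_rate lam Hhat -> (rate_sup Hhat < +oo)%E ->
  homogeneous_rate lam Hcheck -> (rate_int Hcheck < +oo)%E ->
  correlation_function1 P Z r1 -> correlation_function2 P Z r2 ->
  palm1 P Z r1 P1 -> palm2 P Z r2 P2 ->
  {ae (@lebesgue_measure R \x @lebesgue_measure R)%E,
    forall z, quadrant R z -> forall U, measurable U ->
      ((coag_rate Hhat z.1 z.2 * r2 z)%:E * P2 z U =
       (frag_rate Hcheck z.1 z.2 * r1 ((z.1 : R) + (z.2 : R))%R)%:E * P1 ((z.1 : R) + (z.2 : R))%R U)%E} ->
  reversible lam (generator Hhat Hcheck) (pushforward P Z).
Proof.
move=> lam0 hom1 sup1 hom2 int2 [mr1 r10 _] [mr2 r20 _] p1 p2 bal.
have mZ : measurable_fun setT Z by exact: measurable_funPT.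
have B := @balance_of_palm R d W P Z _ (config R) lam Hhat Hcheck (@Xi R) (@config_count R)
  (@config_mass R) (@add_point R) r1 r2 P1 P2 lam0 hom1 sup1 hom2 int2 mZ (@measurable_config_count R)
  (@measurable_config_mass R) (@config_mass_ge0 R) (@config_count_Xi R) (@config_mass_Xi R)
  (@config_count_add R) (@config_mass_add R) mr1 r10 mr2 r20 p1 (fun G mG G0 GC _ => p2 G mG G0 GC) bal.
exact: (reversible_of_balance lam0 hom1 sup1 hom2 int2 mZ B (fun B _ => erefl)).
Qed.

End correlation_balance.

(** * Mecke's formula *)

Section countable_blocks.
Context d (T : measurableType d) (R : realType).

(** The last two hypotheses say that [B] is the union of the blocks that it contains, and a
    countable disjoint union is measured block by block. The enumeration [G] is empty at numbers
    that encode no block. *)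
Lemma measure_eq_on_blocks (J : countType) (F : J -> set T) (m m' : {measure set T -> \bar R})
    (B : set T) : (forall i, measurable (F i)) -> trivIset setT F ->
  (forall i, m (F i) = m' (F i)) -> B `<=` \bigcup_i F i ->
  (forall i x, F i x -> B x -> F i `<=` B) -> m B = m' B.
Proof.
move=> mF tF mm' BF FB.
pose G n : set T := if pickle_inv n is Some i then [set x | F i x /\ F i `<=` B] else set0.
have mG n : measurable (G n).
  rewrite /G; case: pickle_inv => [i|//].
  have [h|h] := pselect (F i `<=` B).
    by rewrite (_ : [set x | _] = F i)//; apply/seteqP; split => x // [].
  by rewrite (_ : [set x | _] = set0)//; apply/seteqP; split => x // [].
have tG : trivIset setT G.
  move=> n n' _ _ [x []]; rewrite /G.
  case E: (pickle_inv n) => [i|//] [Fi _]; case E': (pickle_inv n') => [i'|//] [Fi' _].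
  have ii' : i = i' by apply: (tF i i' I I); exists x.
  have := @pickle_invK J n; have := @pickle_invK J n'; rewrite E E'/= => <- <-.
  by rewrite ii'.
have BE : B = \bigcup_n G n.
  apply/seteqP; split => x; last by move=> [n _]; rewrite /G; case: pickle_inv => [i|//] [Fi /(_ x Fi)].
  move=> Bx; have [i _ Fi] := BF _ Bx; exists (choice.pickle i) => //.
  by rewrite /G pickleK_inv; split => //; exact: FB Fi Bx.
have mUG : measurable (\bigcup_n G n) by exact: bigcup_measurable.
rewrite BE !measure_semi_bigcup//; apply: eq_eseriesr => n _; rewrite /G.
case: pickle_inv => [i|]; last by rewrite !measure0.
have [h|h] := pselect (F i `<=` B).
  rewrite (_ : [set x | _] = F i); last by apply/seteqP; split => x // [].
  exact: mm'.
by rewrite (_ : [set x | _] = set0) ?measure0//; apply/seteqP; split => x // [].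
Qed.

End countable_blocks.

Section point_counts.
Context {R : realType}.
Local Notation RT := (measurableTypeR R).
Implicit Types (A : set RT) (z : Omega R) (t x : R).

Definition pts A z : \bar R := gsum (fun x => ((0 < x) && (x \in A))%R%:R%:E) z.

Lemma XiE z A : Xi z A = pts A z.
Proof. by rewrite /= /mseries /pts /gsum; apply: eq_eseriesr => i _; rewrite atomE. Qed.

Let ind0 A x : (0 <= ((0 < x) && (x \in A))%R%:R%:E :> \bar R)%E.
Proof. by rewrite lee_fin. Qed.

Lemma pts_ge0 A z : (0 <= pts A z)%E.
Proof. exact: gsum_ge0. Qed.

Lemma pts_padd A x z : 0 < x -> pts A (padd x z) = (pts A z + (x \in A)%:R%:E)%E.
Proof. by move=> x0; rewrite /pts gsum_padd// x0. Qed.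

Lemma pts_nat t A z : 0 < t -> (forall x, A x -> t < x) -> exists n : nat, pts A z = n%:R%:E.
Proof.
move=> t0 At; have [N zN] := @Omega_tends0 R z t t0.
exists (\sum_(0 <= k < N) ((0 < z k)%R && (z k \in A)))%N.
rewrite /pts /gsum (nneseries_split 0 N) => [|k _]; last exact: ind0.
rewrite add0n [X in (_ + X)%E]eseries0 ?adde0 => [|i Ni _].
  by rewrite natr_sum -sumEFin.
have -> : (z i \in A) = false; last by rewrite andbF.
apply/negbTE/negP => /set_mem /At; apply/negP; rewrite -leNgt.
by rewrite (le_trans (Omega_le z Ni))// ltW.
Qed.

Lemma measurable_pts A : measurable A -> measurable_fun setT (fun z : Omega R => pts A z).
Proof.
move=> mA; apply: measurable_gsum => //; apply/measurable_EFinP.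
rewrite (_ : (fun _ => _) = fun x : RT => \1_(`]0%R, +oo[%classic : set RT) x * \1_A x).
  by apply: measurable_funM; apply: measurable_indic => //; exact: measurable_itv.
apply/funext => x; rewrite !indicE -natrM mulnb; congr ((_ && _)%:R).
by apply/idP/idP => [h|/set_mem/=]; [apply/mem_set|]; rewrite /= in_itv/= andbT.
Qed.

End point_counts.

(** * Cells cut out by finitely many thresholds *)

Section sign_cells.
Context {R : realType}.
Local Notation RT := (measurableTypeR R).
Variable ts : seq R.
Hypothesis ts_gt0 : forall t, t \in ts -> 0 < t.
Let m := size ts.
Let t (j : 'I_m) : R := ts`_j.

Let t_gt0 j : 0 < t j. Proof. by apply: ts_gt0; exact: mem_nth. Qed.

(* The sign vector of [x] records which of the thresholds [ts] lie below [x];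
   the points with null sign vector, which accumulate at 0, form no cell. *)
Definition signs := {s : {ffun 'I_(size ts) -> bool} | [exists j, s j]}.
HB.instance Definition _ := Finite.on signs.

Definition sign_cell (s : signs) : set RT := [set x | forall j : 'I_(size ts), (ts`_j < x) = val s j].

Lemma sign_cell_measurable s : measurable (sign_cell s).
Proof.
apply: (@measurable_forall_ord _ _ _ (fun j => [set x : RT | (t j < x) = val s j])) => j.
have mf : measurable_fun setT (fun x : RT => t j < x) by apply: measurable_fun_ltr.
rewrite (_ : [set x | _] = (fun x : RT => t j < x) @^-1` [set val s j])//.
by rewrite -[X in measurable X]setTI; exact: mf.
Qed.

Lemma sign_cell_gt s : exists2 u : R, 0 < u & forall x, sign_cell s x -> u < x.
Proof.
by have /existsP[j sj] := valP s; exists (t j) => // x /(_ j); rewrite sj.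
Qed.

Lemma sign_cell_half_line s : sign_cell s `<=` half_line R.
Proof.
have [u u0 h] := sign_cell_gt s.
by move=> x /h ux; rewrite /half_line/= in_itv/= andbT (lt_trans u0).
Qed.

Lemma sign_cell_inj s s' x : sign_cell s x -> sign_cell s' x -> s = s'.
Proof. by move=> h h'; apply/val_inj/ffunP => j; rewrite -h -h'. Qed.

Lemma sign_cell_ex x u : u \in ts -> u < x -> exists s, sign_cell s x.
Proof.
move=> /(nthP 0)[j jm <-] ux.
have ex : [exists j : 'I_(size ts), [ffun j : 'I_(size ts) => ts`_j < x] j].
  by apply/existsP; exists (Ordinal jm); rewrite ffunE.
by exists (exist (fun s : {ffun 'I_(size ts) -> bool} => [exists j, s j]) _ ex) => i /=; rewrite ffunE.
Qed.

Lemma sign_cell_nat s z : exists n : nat, pts (sign_cell s) z = n%:R%:E.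
Proof. by have [u u0 h] := sign_cell_gt s; exact: pts_nat u0 h. Qed.

(** The points above the threshold [j] are shared out among the disjoint cells whose sign at [j] is
    true. *)
Lemma cnt_sign_cells (j : 'I_(size ts)) (z : Omega R) :
  cnt ts`_j z = (\sum_(s : signs | val s j) pts (sign_cell s) z)%E.
Proof.
rewrite /pts /gsum -nneseries_sum; last by move=> s k _; rewrite lee_fin.
apply: eq_eseriesr => k _.
set x := z k; case: ltP => jx; last first.
  rewrite big1// => s sj; have -> : (x \in sign_cell s) = false; last by rewrite andbF.
  by apply/negbTE/negP => /set_mem/(_ j); rewrite sj ltNge jx.
have jin : ts`_j \in ts by exact: mem_nth.
have [s0 s0x] := sign_cell_ex jin jx.
rewrite (bigD1 s0)/=; last by rewrite -s0x.
rewrite (lt_trans (ts_gt0 jin) jx) mem_set//= big1 ?adde0// => s /andP[_ /eqP ss0].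
have -> // : (x \in sign_cell s) = false.
by apply/negbTE/negP => /set_mem sx; apply: ss0; exact: sign_cell_inj sx s0x.
Qed.

Definition counts_event (c : {ffun signs -> nat}) : set (Omega R) :=
  [set z | forall s : signs, pts (sign_cell s) z = (c s)%:R%:E].

Lemma counts_event_measurable c : measurable (counts_event c).
Proof.
rewrite (_ : counts_event c = \bigcap_(s in [set: signs])
    ((fun z : Omega R => pts (sign_cell s) z) @^-1` [set (c s)%:R%:E])).
  apply: fin_bigcap_measurable => [|s _]; first exact: finite_finset.
  rewrite -[X in measurable X]setTI.
  by apply: (measurable_pts (sign_cell_measurable s)) => //; exact: emeasurable_set1.
by apply/seteqP; split => z /= h; [move=> s _; exact: h|move=> s; exact: h].
Qed.

Lemma counts_event_ex z : exists c, counts_event c z.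
Proof.
pose c s := projT1 (cid (sign_cell_nat s z)).
by exists [ffun s => c s] => s; rewrite ffunE; exact: projT2 (cid (sign_cell_nat s z)).
Qed.

Lemma counts_event_inj c c' z : counts_event c z -> counts_event c' z -> c = c'.
Proof.
move=> h h'; apply/ffunP => s; have := h s; rewrite (h' s) => -[].
by move=> /eqP; rewrite eqr_nat => /eqP.
Qed.

(** The cell of a marked point together with the counts in all cells: on such events a Poisson
    process has explicit probabilities. *)
Definition block (i : signs * {ffun signs -> nat}) : set (RT * Omega R) :=
  sign_cell i.1 `*` counts_event i.2.

(** Level counts at thresholds of [ts] are sums of cell counts, so the product set is a union of
    blocks. *)
Lemma eq_measure_of_blocks (u : R) (l : seq (R * nat)) (M M' : {measure set (RT * Omega R) -> \bar R}) :
  u \in ts -> {subset map fst l <= ts} ->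
  (forall i, M (block i) = M' (block i)) ->
  M (`]u, +oo[%classic `*` cyl l) = M' (`]u, +oo[%classic `*` cyl l).
Proof.
move=> uts lts MM'.
apply: (measure_eq_on_blocks (F := block)) => //.
- by move=> i; apply: measurableX; [exact: sign_cell_measurable|exact: counts_event_measurable].
- move=> [s c] [s' c'] _ _ [[x z] [[/= h1 h2] [/= h3 h4]]].
  by rewrite (sign_cell_inj h1 h3) (counts_event_inj h2 h4).
- move=> [x z] [/= ]; rewrite in_itv/= andbT => ux _.
  have [s sx] := sign_cell_ex uts ux; have [c cz] := counts_event_ex z.
  by exists (s, c).
- move=> [s c] [x z] [/= sx cz] [/= + zl] [x' z'] [/= sx' cz'].
  rewrite !in_itv/= !andbT => ux; split => /=.
    have [j jm ju] := nthP 0 uts.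
    by have := sx' (Ordinal jm); have := sx (Ordinal jm); rewrite /= ju ux => <-.
  apply/allP => -[v k] vl /=; have := allP zl _ vl => /=.
  have /(nthP 0)[j jm jv] : v \in ts by apply: lts; apply/mapP; exists (v, k).
  rewrite -jv (cnt_sign_cells (Ordinal jm)) => /eqP <-.
  rewrite (cnt_sign_cells (Ordinal jm)); apply/eqP; apply: eq_bigr => s' _.
  by rewrite cz cz'.
Qed.

End sign_cells.

(** * The intensity of the Poisson process *)

Section pd_rate.
Context {R : realType}.
Local Notation RT := (measurableTypeR R).
Local Notation mu := (@lebesgue_measure R).
Variable theta : R.
Hypothesis theta0 : 0 < theta.

Definition pd_rate (x : R) : R := if 0 < x then theta * x^-1 * expR (- x) else 0.

Lemma pd_rate_ge0 x : 0 <= pd_rate x.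
Proof.
by rewrite /pd_rate; case: ifP => // x0; rewrite !mulr_ge0 ?invr_ge0 ?expR_ge0 ?ltW.
Qed.

Lemma measurable_pd_rate : measurable_fun setT (pd_rate : RT -> R).
Proof.
rewrite (_ : pd_rate = fun x => if 0 < x then theta * x `^ (-1) * expR (- x) else 0).
  apply: measurable_fun_ifT => //; first by apply: measurable_fun_ltr.
  apply: measurable_funM; first by apply: measurable_funM => //; exact: measurable_powR.
  by apply: (measurableT_comp (@measurable_expR R)); exact: oppr_measurable.
by apply/funext => x; rewrite /pd_rate; case: ifP => // x0; rewrite powR_inv1// ltW.
Qed.

Lemma PD_intensityE (B : set RT) : B `<=` half_line R ->
  PD_intensity theta B = (\int[mu]_(x in B) (pd_rate x)%:E)%E.
Proof.
move=> Bh; apply: eq_integral => x /set_mem/Bh; rewrite /half_line/= in_itv/= andbT => x0.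
by rewrite /pd_rate x0.
Qed.

Lemma expR_integral : (\int[mu]_(x in `[0%R, +oo[) (expR (- x))%:E = 1)%E.
Proof.
rewrite -[RHS](integral_exponential_pdf (@ltr01 R)) integral_mkcond.
apply: eq_integral => x _; rewrite patchE /exponential_pdf patchE.
by case: ifP => // _; rewrite mul1r mulN1r.
Qed.

(** Above [t] the factor [x^-1] is at most [t^-1], and the exponential is integrable. *)
Lemma PD_intensity_fin (t : R) (B : set RT) : 0 < t -> measurable B ->
  (forall x, B x -> t < x) -> (PD_intensity theta B < +oo)%E.
Proof.
move=> t0 mB Bt.
have Bh : B `<=` half_line R.
  by move=> x /Bt tx; rewrite /half_line/= in_itv/= andbT (lt_trans t0).
rewrite PD_intensityE//.
have mexp : measurable_fun setT (fun x : RT => expR (- x) : R).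
  by apply: (measurableT_comp (@measurable_expR R)); exact: oppr_measurable.
apply: (@le_lt_trans _ _ (\int[mu]_(x in `[0%R, +oo[) (theta * t^-1 * expR (- x))%:E)%E); last first.
  under eq_integral do rewrite EFinM.
  rewrite ge0_integralZl//; last 2 first.
  - by apply/measurable_EFinP; exact: measurable_funTS.
  - by rewrite lee_fin mulr_ge0 ?invr_ge0 ?ltW.
  by rewrite expR_integral mule1 ltry.
rewrite integral_mkcond [leRHS]integral_mkcond; apply: ge0_le_integral => //.
- by move=> x _; rewrite patchE; case: ifP => // _; rewrite lee_fin pd_rate_ge0.
- apply/(measurable_restrictT _ mB); apply: measurable_funTS.
  by apply/measurable_EFinP; exact: measurable_pd_rate.
- apply/(measurable_restrictT _ (measurable_itv _)); apply: measurable_funTS.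
  by apply/measurable_EFinP; exact: measurable_funM.
- move=> x _; rewrite !patchE; case: ifPn => [/set_mem/Bt tx|_]; last first.
    by case: ifP => // _; rewrite lee_fin !mulr_ge0 ?invr_ge0 ?expR_ge0 ?ltW.
  have x0 := lt_trans t0 tx.
  rewrite mem_set/=; last by rewrite in_itv/= andbT ltW.
  rewrite lee_fin /pd_rate x0 ler_wpM2r ?expR_ge0// ler_wpM2l ?(ltW theta0)//.
  by rewrite lef_pV2 ?posrE// ltW.
Qed.

End pd_rate.

Section poisson_pmf.
Context {R : realType}.

Definition poisson_pmf (l : R) (k : nat) : R := expR (- l) * l ^+ k / k`!%:R.

(** The one-cell form of Mecke's formula. *)
Lemma poisson_pmf_rec l k : k.+1%:R * poisson_pmf l k.+1 = l * poisson_pmf l k.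
Proof.
rewrite /poisson_pmf factS natrM exprS; field.
by rewrite pnatr_eq0 -lt0n fact_gt0 /= nat1r pnatr_eq0.
Qed.

End poisson_pmf.

(** * The one-point formula *)

Section mecke.
Context {R : realType}.
Local Notation RT := (measurableTypeR R).
Local Notation mu := (@lebesgue_measure R).
Variable theta : R.
Hypothesis theta0 : 0 < theta.
Context d (W : measurableType d) (Q : probability W R) (Y : W -> Omega R).
Hypothesis mY : measurable_fun setT Y.
Hypothesis poissonY : poisson_process Q (@Xi R \o Y) (PD_intensity theta).

Local Notation r := (pd_rate theta).

Let kl i (w : W) : R := (0 < Y w i)%R%:R.
Let kl0 i w : 0 <= kl i w. Proof. by []. Qed.
Let mkl i : measurable_fun setT (kl i).
Proof.
apply: measurable_bool_num; apply: measurable_fun_ltr => //.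
exact: (measurableT_comp (measurable_coordinate i) mY).
Qed.
Let phil i (w : W) : RT * Omega R := (Y w i, Y w).
Let mphil i : measurable_fun setT (phil i).
Proof. by apply: measurable_fun_pair => //; exact: (measurableT_comp (measurable_coordinate i) mY). Qed.

(** The two sides of Mecke's formula as measures on pairs of a point and a state: [nul] is the
    Campbell measure of the process, [nur] adds to the process a new point taken with intensity
    [r]. *)
Let nul := mseries (fun i => wpush Q (kl0 i) (mkl i) (mphil i)) 0.

Let kr (q : RT * W) : R := r q.1.
Let kr0 q : 0 <= kr q. Proof. exact: pd_rate_ge0. Qed.
Let mkr : measurable_fun setT kr.
Proof. exact: (measurableT_comp (measurable_pd_rate theta) measurable_fst). Qed.
Let phir (q : RT * W) : RT * Omega R := (q.1, padd q.1 (Y q.2)).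
Let mphir : measurable_fun setT phir.
Proof.
apply: measurable_fun_pair => //.
apply: (measurableT_comp (measurable_padd (R := R)) (_ : measurable_fun setT (fun q : RT * W => (q.1, Y q.2)))).
by apply: measurable_fun_pair => //; exact: (measurableT_comp mY measurable_snd).
Qed.

Let nur := wpush (mu \x Q)%E kr0 mkr mphir.

Let nulE (f : RT * Omega R -> \bar R) : measurable_fun setT f -> (forall q, 0 <= f q)%E ->
  (\int[nul]_q f q = \int[Q]_w \int[counting]_(i in pos_idx (Y w)) f (Y w i, Y w))%E.
Proof.
move=> mf f0; rewrite ge0_integral_measure_series//.
transitivity (\sum_(0 <= i <oo) \int[Q]_w ((kl i w)%:E * f (phil i w)))%E.
  by apply: eq_eseriesr => i _; rewrite (@ge0_integral_wpush _ _ _ _ _ _ _ _ (kl0 i) (mkl i) (mphil i) f).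
have m0 i w : (0 <= (kl i w)%:E * f (phil i w))%E by rewrite mule_ge0 ?lee_fin.
rewrite -integral_nneseries//; last first.
  move=> i; apply: emeasurable_funM; first exact/measurable_EFinP.
  exact: (measurableT_comp mf (mphil i)).
apply: eq_integral => w _; rewrite [in RHS]integral_mkcond.
rewrite [RHS]ge0_integral_count; last first.
  by move=> i; rewrite patchE; case: ifP.
apply: eq_eseriesr => i _; rewrite patchE /kl.
have -> : (i \in pos_idx (Y w)) = (0 < Y w i).
  by apply/idP/idP => [/set_mem//|?]; apply/mem_set.
by case: ifP => _; rewrite ?mul1e ?mul0e.
Qed.

Let nurE (f : RT * Omega R -> \bar R) : measurable_fun setT f -> (forall q, 0 <= f q)%E ->
  (\int[nur]_q f q = \int[mu]_x ((r x)%:E * \int[Q]_w f (x, padd x (Y w))))%E.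
Proof.
move=> mf f0; rewrite (@ge0_integral_wpush _ _ _ _ _ _ _ _ kr0 mkr mphir f)//.
have mm : measurable_fun setT (fun q => (kr q)%:E * f (phir q))%E.
  apply: emeasurable_funM; first exact/measurable_EFinP.
  exact: (measurableT_comp mf mphir).
have m0 q : (0 <= (kr q)%:E * f (phir q))%E by rewrite mule_ge0 ?lee_fin.
apply: etrans (@fubini_tonelli1 _ _ RT W R mu Q _ mm m0) _.
apply: eq_integral => x _.
transitivity (\int[Q]_w ((r x)%:E * f (x, padd x (Y w))))%E => //.
rewrite ge0_integralZl//.
- apply: (measurableT_comp mf (_ : measurable_fun setT (fun w => (x, padd x (Y w))))).
  apply: (measurableT_comp mphir (_ : measurable_fun setT (fun w : W => (x, w)))).
  exact: measurable_fun_pair.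
- by rewrite lee_fin pd_rate_ge0.
Qed.

Let indX (A : set RT) (C : set (Omega R)) q : \1_(A `*` C) q = \1_A q.1 * \1_C q.2 :> R.
Proof. by rewrite !indicE in_setX -natrM mulnb. Qed.

Let mind (B : set (RT * Omega R)) : measurable B ->
  measurable_fun setT (fun q => (\1_B q)%:E : \bar R).
Proof. by move=> mB; apply/measurable_EFinP; exact: measurable_indic. Qed.

Let intind (m : {measure set (RT * Omega R) -> \bar R}) B : measurable B ->
  m B = (\int[m]_q (\1_B q)%:E)%E.
Proof. by move=> mB; rewrite integral_indic// setIT. Qed.

Let nulX (A : set RT) (C : set (Omega R)) : measurable A -> measurable C ->
  nul (A `*` C) = (\int[Q]_w ((\1_C (Y w))%:E * pts A (Y w)))%E.
Proof.
move=> mA mC; rewrite [LHS]intind; last exact: measurableX.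
rewrite nulE//; last by apply: mind; exact: measurableX.
apply: eq_integral => w _; rewrite integral_mkcond ge0_integral_count; last first.
  by move=> i; rewrite patchE; case: ifP => // _; rewrite lee_fin.
rewrite /pts /gsum -nneseriesZl; last by move=> i _; rewrite lee_fin.
apply: eq_eseriesr => i _; rewrite patchE indX /=.
have -> : (i \in pos_idx (Y w)) = (0 < Y w i).
  by apply/idP/idP => [/set_mem//|?]; apply/mem_set.
case: ifP => _ /=; last by rewrite mule0.
by rewrite -EFinM mulrC !indicE.
Qed.

Let nurX (A : set RT) (C : set (Omega R)) : measurable A -> measurable C ->
  nur (A `*` C) = (\int[mu]_x ((r x * \1_A x)%:E * \int[Q]_w (\1_C (padd x (Y w)))%:E))%E.
Proof.
move=> mA mC; rewrite [LHS]intind; last exact: measurableX.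
rewrite nurE//; last by apply: mind; exact: measurableX.
apply: eq_integral => x _; rewrite EFinM -muleA; congr (_ * _)%E.
rewrite -ge0_integralZl//; last first.
  apply: (measurableT_comp (_ : measurable_fun setT (fun z : Omega R => (\1_C z)%:E : \bar R))).
    by apply/measurable_EFinP; exact: measurable_indic.
  apply: (measurableT_comp (measurable_padd (R := R)) (_ : measurable_fun setT (fun w : W => (x, Y w)))).
  exact: (measurable_fun_pair (measurable_cst x) mY).
by apply: eq_integral => w _; rewrite indX EFinM.
Qed.

Section blocks.
Variable ts : seq R.
Hypothesis ts_gt0 : forall t, t \in ts -> 0 < t.
Local Notation signs := (signs ts).

Let lam (s : signs) : R := fine (PD_intensity theta (sign_cell s)).

Let lamE (s : signs) : PD_intensity theta (sign_cell s) = (lam s)%:E.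
Proof.
have [u u0 su] := sign_cell_gt ts_gt0 s.
rewrite /lam fineK// ge0_fin_numE; first exact: PD_intensity_fin u0 (sign_cell_measurable s) su.
rewrite PD_intensityE; last exact: sign_cell_half_line.
by apply: integral_ge0 => x _; rewrite lee_fin pd_rate_ge0.
Qed.

Let prob_counts (c : {ffun signs -> nat}) :
  Q (Y @^-1` counts_event c) = (\prod_s poisson_pmf (lam s) (c s))%:E.
Proof.
pose B (i : 'I_#|{: signs}|) := sign_cell (enum_val i : signs).
rewrite (_ : Y @^-1` counts_event c = [set w | forall i : 'I_#|{: signs}|,
    (@Xi R \o Y) w (B i) = (c (enum_val i : signs))%:R%:E]); last first.
  apply/seteqP; split => w /= h; first by move=> i; rewrite XiE; exact: h.
  by move=> s; have := h (enum_rank s); rewrite /B enum_rankK XiE.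
rewrite (poissonY (fun i : 'I_#|{: signs}| => c (enum_val i : signs))).
- by rewrite (big_enum_val (fun s : signs => poisson_pmf (lam s) (c s))).
- by move=> i; exact: sign_cell_measurable.
- by move=> i; exact: sign_cell_half_line.
- move=> i j _ _ [x [hi hj]]; apply: enum_val_inj; exact: sign_cell_inj hi hj.
- by move=> i; rewrite lamE ltry.
Qed.

(** On the event, the cell offers exactly [c s] choices of a point. *)
Let nul_block (s : signs) (c : {ffun signs -> nat}) : nul (sign_cell s `*` counts_event c) =
  ((c s)%:R%:E * Q (Y @^-1` counts_event c))%E.
Proof.
have mC := counts_event_measurable c; have mA := sign_cell_measurable s.
rewrite nulX//.
under eq_integral => w _.
  rewrite (_ : _ * _ = (c s)%:R%:E * (\1_(Y @^-1` counts_event c) w)%:E)%E; last first.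
    have [h|h] := pselect (counts_event c (Y w)).
      by rewrite !indicE !mem_set// mul1e mule1 h.
    by rewrite !indicE !memNset// mul0e mule0.
  over.
have mYC : measurable (Y @^-1` counts_event c).
  by rewrite -[X in measurable X]setTI; exact: mY.
rewrite ge0_integralZl//; last first.
  by apply/measurable_EFinP; exact: measurable_indic.
by rewrite integral_indic// setIT.
Qed.

(** The new point raises by one the count of its own cell, wherever it lies in it, so the
    probability comes out of the integral. *)
Let nur_block (s : signs) (c : {ffun signs -> nat}) : nur (sign_cell s `*` counts_event c) =
  ((lam s)%:E * Q [set w | forall s' : signs,
     (pts (sign_cell s') (Y w) + (s' == s)%:R%:E = (c s')%:R%:E)%E])%E.
Proof.
have mC := counts_event_measurable c; have mA := sign_cell_measurable s.
rewrite nurX//; set E := [set w | _].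
have PE : measurable E.
  rewrite (_ : E = \bigcap_(s' in [set: signs])
     ((fun w => pts (sign_cell s') (Y w) + (s' == s)%:R%:E)%E @^-1` [set (c s')%:R%:E])).
    apply: fin_bigcap_measurable => [|s' _]; first exact: finite_finset.
    rewrite -[X in measurable X]setTI.
    have mm : measurable_fun setT (fun w => pts (sign_cell s') (Y w) + (s' == s)%:R%:E)%E.
      by apply: emeasurable_funD => //; exact: (measurableT_comp (measurable_pts (sign_cell_measurable s')) mY).
    by apply: mm => //; exact: emeasurable_set1.
  by apply/seteqP; split => w /= h; [move=> s' _; exact: h|move=> s'; exact: h].
transitivity (\int[mu]_x ((r x * \1_(sign_cell s) x)%:E * Q E))%E.
  apply: eq_integral => x _; rewrite indicE.
  have [sx|sx] := pselect (sign_cell s x); last by rewrite memNset// mulr0 !mul0e.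
  rewrite mem_set//; congr (_ * _)%E.
  rewrite -(setIT E) -integral_indic//; apply: eq_integral => w _; congr EFin.
  have x0 : 0 < x by have := sign_cell_half_line ts_gt0 sx; rewrite /half_line/= in_itv/= andbT.
  rewrite !indicE; congr (_%:R); apply: congr1.
  have H s' : pts (sign_cell s') (padd x (Y w)) = (pts (sign_cell s') (Y w) + (s' == s)%:R%:E)%E.
    rewrite pts_padd//; congr (_ + _%:R%:E)%E; apply: congr1; apply/idP/idP.
      by move=> /set_mem h; apply/eqP; exact: sign_cell_inj h sx.
    by move=> /eqP ->; exact/mem_set.
  apply/idP/idP => /set_mem h; apply/mem_set => s'; first by rewrite -H; exact: h.
  by rewrite H; exact: h.
rewrite ge0_integralZr//; last 2 first.
- apply/measurable_EFinP; apply: measurable_funM; last exact: measurable_indic.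
  exact: measurable_pd_rate.
- by move=> x _; rewrite lee_fin mulr_ge0// pd_rate_ge0.
congr (_ * _)%E; rewrite -lamE PD_intensityE; last exact: sign_cell_half_line.
rewrite [RHS]integral_mkcond; apply: eq_integral => x _; rewrite patchE indicE.
by case: ifP => _; rewrite ?mulr1 ?mulr0.
Qed.

(** With [c s = 0] both sides vanish. Otherwise the new point is removed by lowering the count at
    [s] by one; the factors of the other cells are unchanged and [poisson_pmf_rec] settles the
    factor at [s]. *)
Let blockE (i : signs * {ffun signs -> nat}) : nul (block i) = nur (block i).
Proof.
case: i => s c; rewrite /block/= nul_block nur_block.
case E : (c s) => [|k].
  rewrite mul0e (_ : [set w | _] = set0) ?measure0 ?mule0//.
  apply/seteqP; split => // w /= /(_ s); rewrite eqxx E /= => h.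
  have := pts_ge0 (sign_cell s) (Y w); move: h.
  by case: pts => [x| |]//= [] /eqP; rewrite addr_eq0 => /eqP ->; rewrite lee_fin oppr_ge0 ler10.
pose c' := [ffun s' => if s' == s then k else c s'] : {ffun signs -> nat}.
rewrite (_ : [set w | _] = Y @^-1` counts_event c'); last first.
  apply/seteqP; split => w /= h s'; have := h s'; rewrite /c' ffunE; case: eqVneq => [->|_].
  - rewrite E -natr1; case: pts => [x| |]//= [] /(congr1 (fun y => y - 1)).
    by rewrite !addrK => ->.
  - by rewrite adde0.
  - by move=> ->; rewrite E -EFinD natr1.
  - by move=> ->; rewrite adde0.
rewrite !prob_counts -!EFinM; congr EFin.
transitivity (k.+1%:R * poisson_pmf (lam s) k.+1 *
    \prod_(s' | s' != s) poisson_pmf (lam s') (c s')).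
  by rewrite (bigD1 s)//= E mulrA.
rewrite poisson_pmf_rec -[LHS]mulrA [in RHS](bigD1 s)//= ffunE eqxx; congr (_ * (_ * _)).
by apply: eq_bigr => s' ss'; rewrite ffunE (negbTE ss').
Qed.

Lemma mecke_cyl u l : u \in ts -> {subset map fst l <= ts} ->
  nul (`]u, +oo[%classic `*` cyl l) = nur (`]u, +oo[%classic `*` cyl l).
Proof. by move=> uts lts; apply: (eq_measure_of_blocks ts_gt0 uts lts); exact: blockE. Qed.

End blocks.

Let nulr_cyl u l : 0 < u -> all (fun p : R * nat => 0 < p.1) l ->
  nul (`]u, +oo[%classic `*` cyl l) = nur (`]u, +oo[%classic `*` cyl l).
Proof.
move=> u0 lp; apply: (@mecke_cyl (u :: map fst l)).
- by move=> t; rewrite inE => /predU1P[->//|/mapP[p pl ->]]; exact: (allP lp).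
- exact: mem_head.
- by move=> t tl; rewrite inE tl orbT.
Qed.

Let nur_fin (u : R) : 0 < u -> (nur (`]u, +oo[%classic `*` setT) < +oo)%E.
Proof.
move=> u0; rewrite nurX//.
have hu (x : RT) : (`]u, +oo[%classic : set RT) x -> u < x by rewrite /= in_itv/= andbT.
apply: le_lt_trans (PD_intensity_fin theta0 u0 (measurable_itv _) hu).
rewrite PD_intensityE; last first.
  by move=> x /=; rewrite /half_line/= !in_itv/= !andbT; exact: lt_trans.
rewrite [leRHS]integral_mkcond le_eqVlt; apply/orP; left; apply/eqP; apply: eq_integral => x _.
rewrite (_ : \int[Q]_w _ = 1)%E; last first.
  transitivity (\int[Q]_w (cst 1%E w))%E; first by apply: eq_integral => w _; rewrite indicT.
  by rewrite integral_cst// [X in (1 * X)%E]probability_setT mule1.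
rewrite mule1 patchE indicE.
by case: ifP => _; rewrite ?mulr1 ?mulr0.
Qed.

Let rays : set (set RT) := [set A | A = setT \/ exists a : R, A = `]a, +oo[%classic].

Let rays_setI : setI_closed rays.
Proof.
move=> _ _ [->|[a ->]] [->|[b ->]]; rewrite ?setTI ?setIT.
- by left.
- by right; exists b.
- by right; exists a.
- right; exists (Num.max a b); apply/seteqP; split => x /=; rewrite !in_itv/= !andbT gt_max.
    by move=> [-> ->].
  by move=> /andP.
Qed.

Let rays_generate : @measurable _ RT = <<s rays >>.
Proof.
apply/seteqP; split; last first.
  apply: smallest_sub; first exact: sigma_algebra_measurable.
  by move=> _ [->|[a ->]]; [exact: measurableT|exact: measurable_itv].
have -> : @measurable _ RT = <<s @RGenOInfty.G R >> by exact: RGenOInfty.measurableE.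
apply: smallest_sub; first exact: smallest_sigma_algebra.
by move=> _ [a ->]; apply: sub_sigma_algebra; right; exists a.
Qed.

(** The intensity is infinite near 0, so uniqueness of finite measures applies only to points above
    a positive level; [nulrE] then lets the level decrease to 0. *)
Let nulr_strip (n : nat) (C : set (RT * Omega R)) : measurable C ->
  nul (C `&` (`]n.+1%:R^-1, +oo[%classic `*` setT)) =
  nur (C `&` (`]n.+1%:R^-1, +oo[%classic `*` setT)).
Proof.
set a := n.+1%:R^-1; have a0 : 0 < a by rewrite invr_gt0 ltr0n.
have mS : measurable (`]a, +oo[%classic `*` setT : set (RT * Omega R)).
  by apply: measurableX => //; exact: measurable_itv.
(* The sides are exchanged because finiteness is established for [nur]. *)
move=> mC; rewrite -[LHS]/(mrestr nul mS C) -[RHS]/(mrestr nur mS C); apply/esym.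
apply: (finite_measure_unique_prod rays_generate (@measurable_cylinders R)) => //.
- by left.
- exact: cylinders_setT.
- exact: cylinders_setI.
- by rewrite /= /mrestr setTI; exact: nur_fin.
move=> A B rA [l lp <-]; rewrite /= /mrestr -setXI setIT.
have [u u0 ->] : exists2 u : R, 0 < u & A `&` `]a, +oo[%classic = `]u, +oo[%classic.
  case: rA => [->|[b ->]]; first by exists a => //; rewrite setTI.
  exists (Num.max b a); first by rewrite lt_max a0 orbT.
  apply/seteqP; split => x /=; rewrite !in_itv/= !andbT gt_max; first by move=> [-> ->].
  by move=> /andP.
by apply/esym; exact: nulr_cyl.
Qed.

Let nulrE (C : set (RT * Omega R)) : measurable C -> nul C = nur C.
Proof.
move=> mC.
pose S n : set (RT * Omega R) := `]n.+1%:R^-1, +oo[%classic `*` setT.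
have mS n : measurable (S n) by apply: measurableX => //; exact: measurable_itv.
have mCS n : measurable (C `&` S n) by exact: measurableI.
have mUS : measurable (\bigcup_n (C `&` S n)) by exact: bigcup_measurable.
have US : \bigcup_n (C `&` S n) = C `&` (`]0%R, +oo[%classic `*` setT).
  apply/seteqP; split => -[x z] /=.
    move=> [n _ [Cxz [/= + _]]]; rewrite !in_itv/= !andbT => nx; split => //; split => //=.
    by rewrite (lt_trans _ nx)// invr_gt0 ltr0n.
  rewrite in_itv/= andbT => -[Cxz [x0 _]].
  have [n nx] : exists n : nat, x^-1 < n.+1%:R.
    by exists (Num.truncn x^-1); exact: truncnS_gt.
  exists n => //; split => //; split => //=; rewrite in_itv/= andbT.
  by rewrite invf_plt ?posrE.
have hS : {homo (fun n => C `&` S n) : n m / (n <= m)%N >-> (n <= m)%O}.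
  move=> n m nm; apply/subsetPset => -[x z] /= [Cxz [/= + _]].
  rewrite in_itv/= andbT => nx; split => //; split => //=; rewrite in_itv/= andbT.
  by apply: le_lt_trans nx; rewrite lef_pV2 ?posrE ?ltr0n// ler_nat.
have lim (m : {measure set (RT * Omega R) -> \bar R}) :
    m (C `&` (`]0%R, +oo[%classic `*` setT)) = limn (fun n => m (C `&` S n)).
  by rewrite -US; apply/esym/cvg_lim => //; exact: nondecreasing_cvg_mu.
have neg (m : {measure set (RT * Omega R) -> \bar R}) :
    m (`]-oo, 0%R]%classic `*` setT) = 0%E -> m C = m (C `&` (`]0%R, +oo[%classic `*` setT)).
  move=> m0; have mN : measurable (`]-oo, 0%R]%classic `*` setT : set (RT * Omega R)).
    by apply: measurableX => //; exact: measurable_itv.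
  have mP : measurable (`]0%R, +oo[%classic `*` setT : set (RT * Omega R)).
    by apply: measurableX => //; exact: measurable_itv.
  rewrite {1}(_ : C = (C `&` (`]0%R, +oo[%classic `*` setT)) `|` (C `&` (`]-oo, 0%R]%classic `*` setT))).
    rewrite measureU//; try exact: measurableI.
      rewrite [X in (_ + X)%E](_ : _ = 0%E) ?adde0//.
      by apply: subset_measure0 m0 => //; exact: measurableI.
    apply/seteqP; split => // -[x z] /=; rewrite !in_itv/= andbT => -[[_ [x0 _]] [_ [+ _]]].
    by rewrite leNgt x0.
  apply/seteqP; split => -[x z] /=; last by move=> [[]|[]].
  rewrite !in_itv/= andbT => Cxz; case: (ltP 0 x) => x0; [left|right] => //.
have zr : nur (`]-oo, 0%R]%classic `*` setT) = 0%E.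
  rewrite [LHS]nurX//; apply: integral0_eq => x _; rewrite /pd_rate indicE.
  case: ifP => x0; last by rewrite mul0r mul0e.
  by rewrite memNset ?mulr0 ?mul0e//= in_itv/= leNgt x0.
have zl : nul (`]-oo, 0%R]%classic `*` setT) = 0%E.
  rewrite [LHS]nulX//; apply: integral0_eq => w _; rewrite indicT mul1e.
  apply: eseries0 => i _ _; case: ltP => //= x0.
  by rewrite memNset//= in_itv/= leNgt x0.
apply: etrans (neg nul zl) _; apply: etrans _ (esym (neg nur zr)).
apply: etrans (lim nul) _; apply: etrans _ (esym (lim nur)).
by congr (limn _); apply/funext => n; exact: nulr_strip.
Qed.

Lemma mecke1 (f : RT * Omega R -> \bar R) : measurable_fun setT f -> (forall q, 0 <= f q)%E ->
  (\int[Q]_w \int[counting]_(i in pos_idx (Y w)) f (Y w i, Y w) =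
   \int[mu]_x ((r x)%:E * \int[Q]_w f (x, padd x (Y w))))%E.
Proof.
move=> mf f0; rewrite -nulE// -nurE//.
by apply: eq_measure_integral => C mC _; exact: nulrE.
Qed.

End mecke.

Section omega_extensionality.
Context {R : realType}.
Implicit Types z : Omega R.

(** If two entries of the same rank differed, the count above their midpoint would tell them apart.
    It yields [padd_comm] without comparing ranks. *)
Lemma Omega_eq_cnt z z' : (forall t : R, 0 < t -> cnt t z = cnt t z') -> z = z'.
Proof.
move=> h; apply: val_inj; apply/funext => i; rewrite -/(sizes z i) -/(sizes z' i).
have le (u v : Omega R) : (forall t : R, 0 < t -> cnt t u = cnt t v) -> u i <= v i.
  move=> uv; rewrite leNgt; apply/negP => vu; have := midf_lt vu.
  set t := _ / _ => -[vt tu].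
  have t0 : 0 < t by apply: le_lt_trans vt; exact: Omega_ge0.
  have : t < v i by rewrite cnt_gt -uv// -cnt_gt.
  by rewrite ltNge ltW.
by apply/eqP; rewrite eq_le !le// => t t0; rewrite h.
Qed.

Lemma padd_comm (x y : R) z : 0 < x -> 0 < y -> padd x (padd y z) = padd y (padd x z).
Proof.
move=> x0 y0; apply: Omega_eq_cnt => t t0.
by rewrite /cnt !gsum_padd// -!addeA [X in (_ + X)%E]addeC.
Qed.

End omega_extensionality.

(** * The two-point formula *)

Section mecke2.
Context {R : realType}.
Local Notation RT := (measurableTypeR R).
Local Notation mu := (@lebesgue_measure R).
Local Notation mu2 := (mu \x mu)%E.
Variable theta : R.
Hypothesis theta0 : 0 < theta.
Context d (W : measurableType d) (Q : probability W R) (Y : W -> Omega R).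
Hypothesis mY : measurable_fun setT Y.
Hypothesis poissonY : poisson_process Q (@Xi R \o Y) (PD_intensity theta).

Local Notation r := (pd_rate theta).

Variable G : (RT * RT) * Omega R -> R.
Hypothesis mG : measurable_fun setT G.
Hypothesis G0 : forall u, 0 <= G u.
(* keeps the diagonal sum over the points integrable, so that it can be cancelled *)
Hypothesis GC : exists C, forall u, G u * mass u.2 <= C * `|u.1.1 : R|.

(** The second point runs over all points, the first one included: this makes the sum a function of
    the first point's size and the state, to which the one-point formula applies. *)
Let full (v : RT * Omega R) : \bar R :=
  gsum (fun y => if 0 < y then (G ((v.1, y), v.2))%:E else 0%E) v.2.

Let diag (v : RT * Omega R) : \bar R := (G ((v.1, v.1), v.2))%:E.

(* the other points, when [v.1] is a point added to [v.2] *)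
Let others (v : RT * Omega R) : \bar R :=
  gsum (fun y => if 0 < y then (G ((v.1, y), padd v.1 v.2))%:E else 0%E) v.2.

Let msnd1 : measurable_fun setT (fun v : RT * Omega R => v.2). Proof. exact: measurable_snd. Qed.

Let mgs (k : RT * Omega R -> Omega R) : measurable_fun setT k ->
  measurable_fun setT (fun v : RT * Omega R =>
    gsum (fun y => if 0 < y then (G ((v.1, y), k v))%:E else 0%E) v.2).
Proof.
move=> mk; apply: ge0_emeasurable_sum => [i v _ _|i _]; first by case: ifP; rewrite ?lee_fin.
have mi : measurable_fun setT (fun v : RT * Omega R => v.2 i : R).
  exact: (measurableT_comp (measurable_coordinate i) msnd1).
apply: measurable_fun_ifT => //; first exact: measurable_fun_ltr.
apply/measurable_EFinP.
apply: (measurableT_comp mG (_ : measurable_fun setT (fun v : RT * Omega R => ((v.1, v.2 i : RT), k v)))).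
by apply: measurable_fun_pair => //; exact: measurable_fun_pair.
Qed.

Let mpaddv : measurable_fun setT (fun v : RT * Omega R => padd v.1 v.2).
Proof. exact: measurable_padd. Qed.

Let mfull : measurable_fun setT full. Proof. exact: mgs. Qed.
Let mothers : measurable_fun setT others. Proof. exact: mgs. Qed.
Let mdiag : measurable_fun setT diag.
Proof.
apply/measurable_EFinP; apply: (measurableT_comp mG (_ : measurable_fun setT (fun v : RT * Omega R => ((v.1, v.1), v.2)))).
by apply: measurable_fun_pair => //; exact: measurable_fun_pair.
Qed.

Let full0 v : (0 <= full v)%E. Proof. by apply: gsum_ge0 => y; case: ifP; rewrite ?lee_fin. Qed.
Let others0 v : (0 <= others v)%E. Proof. by apply: gsum_ge0 => y; case: ifP; rewrite ?lee_fin. Qed.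
Let diag0 v : (0 <= diag v)%E. Proof. by rewrite lee_fin. Qed.

Let full_padd x (z : Omega R) : 0 < x -> full (x, padd x z) = (others (x, z) + diag (x, padd x z))%E.
Proof.
move=> x0; rewrite /full /others /diag /= gsum_padd ?x0// => y.
by case: ifP; rewrite ?lee_fin.
Qed.

Let pairs (z : Omega R) : \bar R := (\int[counting]_(p in pos_pairs z) (G ((z p.1 : RT, z p.2 : RT), z))%:E)%E.

Let in_pairs (z : Omega R) p : (p \in pos_pairs z) = [&& p.1 != p.2, 0 < z p.1 & 0 < z p.2].
Proof. by apply/idP/idP => [/set_mem[? ? ?]|/and3P[? ? ?]]; [apply/and3P|apply/mem_set]. Qed.

Let in_idx (z : Omega R) i : (i \in pos_idx z) = (0 < z i).
Proof. by apply/idP/idP => [/set_mem//|?]; apply/mem_set. Qed.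

Let sum_full (z : Omega R) : (\int[counting]_(i in pos_idx z) full (z i, z) =
  pairs z + \int[counting]_(i in pos_idx z) diag (z i, z))%E.
Proof.
pose F (p : nat * nat) : \bar R := if (0 < z p.1) && (0 < z p.2) then (G ((z p.1 : RT, z p.2 : RT), z))%:E else 0%E.
have F0 p : (0 <= F p)%E by rewrite /F; case: ifP; rewrite ?lee_fin.
have mm (f : nat * nat -> \bar R) : measurable_fun setT f by move=> _ B _; exact: measurable_natnat.
transitivity (\int[counting]_p F p)%E.
  rewrite integral_counting_pairs// integral_mkcond; apply: eq_integral => i _.
  rewrite patchE in_idx /F /full /gsum /= ge0_integral_count; last first.
    by move=> j; case: ifP; rewrite ?lee_fin.
  by case: ifP => _ //=; rewrite eseries0.
transitivity (\int[counting]_p ((if p.1 != p.2 then F p else 0) + (if p.1 == p.2 then F p else 0)))%E.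
  by apply: eq_integral => p _; case: eqVneq => _ /=; rewrite ?add0e ?adde0.
rewrite ge0_integralD//; try exact: mm; try by move=> p _; case: ifP.
congr (_ + _)%E.
  rewrite /pairs [RHS]integral_mkcond; apply: eq_integral => p _; rewrite patchE in_pairs /F.
  by case: ifP.
rewrite integral_counting_pairs; last by move=> p; case: ifP.
rewrite [RHS]integral_mkcond; apply: eq_integral => i _; rewrite patchE in_idx /diag.
rewrite ge0_integral_count; last by move=> j; case: ifP.
rewrite (@nneseriesD1 _ _ i xpredT)//; last by move=> j _; case: ifP.
rewrite eqxx eseries0 ?adde0 /F ?andbb// => j _ /= ji; by rewrite eq_sym (negbTE ji).
Qed.

Let mpairs : measurable_fun setT (fun w => pairs (Y w)).
Proof.
rewrite /pairs; under eq_fun do rewrite integral_mkcond.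
apply: (measurable_fun_fubini_tonelli_F (m2 := counting_pairs R) (fun q : W * (nat * nat) =>
   ((fun p => (G (((Y q.1 p.1 : RT), (Y q.1 p.2 : RT)), Y q.1))%:E) \_ (pos_pairs (Y q.1))) q.2)%E).
  apply: measurable_fun_pairs => p /=; under eq_fun do rewrite patchE in_pairs.
  have mi i : measurable_fun setT (fun w => Y w i : RT).
    exact: (measurableT_comp (measurable_coordinate i) mY).
  have mi' i : measurable_fun setT (fun w => Y w i : R) by exact: mi.
  apply: measurable_fun_ifT => //.
    by apply: measurable_and => //; apply: measurable_and; exact: measurable_fun_ltr.
  apply/measurable_EFinP; apply: (measurableT_comp mG (_ : measurable_fun setT
     (fun w => (((Y w p.1 : RT), (Y w p.2 : RT)), Y w)))).
  exact: (measurable_fun_pair (measurable_fun_pair (mi p.1) (mi p.2)) mY).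
by move=> q; rewrite patchE; case: ifP => // _; rewrite lee_fin.
Qed.

Let pairs0 (z : Omega R) : (0 <= pairs z)%E. Proof. by apply: integral_ge0 => p _; rewrite lee_fin. Qed.

Let mdiagsum : measurable_fun setT (fun w => \int[counting]_(i in pos_idx (Y w)) diag (Y w i, Y w))%E.
Proof.
under eq_fun do rewrite integral_mkcond.
apply: (measurable_fun_fubini_tonelli_F (m2 := @counting nat R) (fun q : W * nat =>
   ((fun i => diag (Y q.1 i, Y q.1)) \_ (pos_idx (Y q.1))) q.2)%E).
  apply: measurable_fun_natr => i /=; under eq_fun do rewrite patchE in_idx.
  have mi : measurable_fun setT (fun w => Y w i).
    exact: (measurableT_comp (measurable_coordinate i) mY).
  apply: measurable_fun_ifT => //; first exact: measurable_fun_ltr.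
  apply: (measurableT_comp mdiag (_ : measurable_fun setT (fun w => ((Y w i : RT), Y w)))).
  exact: measurable_fun_pair.
by move=> q; rewrite patchE; case: ifP.
Qed.

(** By [GC] the diagonal term at [z i] is at most [|C| * z i / mass z], and these add up to
    [|C|]. *)
Let diag_fin : (\int[Q]_w \int[counting]_(i in pos_idx (Y w)) diag (Y w i, Y w))%E \is a fin_num.
Proof.
have [C hC] := GC.
have dC z : (\int[counting]_(i in pos_idx z) diag (z i, z) <= (`|C|)%:E)%E.
  have m0 := mass_gt0 z.
  rewrite integral_mkcond ge0_integral_count; last by move=> i; rewrite patchE; case: ifP.
  apply: (@le_trans _ _ (\sum_(0 <= i <oo) (`|C| / mass z)%:E * (z i)%:E)%E).
    apply: lee_nneseries => i _; first by move=> _; rewrite patchE; case: ifP.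
    rewrite patchE in_idx; case: ifP => zi; last by rewrite -EFinM lee_fin !mulr_ge0 ?invr_ge0 ?(ltW m0) ?Omega_ge0.
    rewrite -EFinM lee_fin mulrAC ler_pdivlMr//.
    apply: (le_trans (hC _)) => /=; rewrite (gtr0_norm zi) ler_wpM2r ?ler_norm// ltW//.
  rewrite nneseriesZl; last by move=> i _; rewrite lee_fin Omega_ge0.
  by rewrite massE -EFinM divfK// gt_eqF.
rewrite ge0_fin_numE; last by apply: integral_ge0 => w _; apply: integral_ge0.
apply: (@le_lt_trans _ _ (\int[Q]_w (cst (`|C|)%:E w))%E).
  by apply: ge0_le_integral => // w _; (exact: dC || exact: integral_ge0).
by rewrite integral_cst// [X in (_ * X)%E]probability_setT mule1 ltry.
Qed.

Let mY2 (x : RT) : measurable_fun setT (fun w => (x, Y w)).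
Proof. exact: measurable_fun_pair. Qed.

Let r0 x : (0 <= (r x)%:E)%E. Proof. by rewrite lee_fin pd_rate_ge0. Qed.

Let minner (f : RT * Omega R -> \bar R) : measurable_fun setT f -> (forall v, 0 <= f v)%E ->
  measurable_fun setT (fun x : RT => ((r x)%:E * \int[Q]_w f (x, Y w))%E).
Proof.
move=> mf f0; apply: emeasurable_funM; first by apply/measurable_EFinP; exact: measurable_pd_rate.
apply: (measurable_fun_fubini_tonelli_F (m2 := Q) (fun q : RT * W => f (q.1, Y q.2))) => //.
apply: (measurableT_comp mf (_ : measurable_fun setT (fun q : RT * W => (q.1, Y q.2)))).
by apply: measurable_fun_pair => //; exact: (measurableT_comp mY measurable_snd).
Qed.

Let mpadd2 : measurable_fun setT (fun v : RT * Omega R => (v.1, padd v.1 v.2)).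
Proof. exact: measurable_fun_pair. Qed.

Let others_side :
  (\int[mu]_x ((r x)%:E * \int[Q]_w others (x, Y w)) =
   \int[mu2]_(q in quadrant R) ((r q.1 * r q.2)%:E *
     \int[Q]_w (G (q, padd q.2 (padd q.1 (Y w))))%:E))%E.
Proof.
have mK : measurable_fun setT (fun u : (RT * RT) * W => (G (u.1, padd u.1.1 (padd u.1.2 (Y u.2))))%:E).
  apply/measurable_EFinP; apply: (measurableT_comp mG (_ : measurable_fun setT
    (fun u : (RT * RT) * W => (u.1, padd u.1.1 (padd u.1.2 (Y u.2)))))).
  apply: measurable_fun_pair; first exact: measurable_fst.
  apply: (measurableT_comp mpaddv (_ : measurable_fun setT
    (fun u : (RT * RT) * W => (u.1.1, padd u.1.2 (Y u.2))))).
  apply: measurable_fun_pair; first exact: (measurableT_comp measurable_fst measurable_fst).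
  apply: (measurableT_comp mpaddv (_ : measurable_fun setT
    (fun u : (RT * RT) * W => (u.1.2, Y u.2)))).
  apply: measurable_fun_pair; first exact: (measurableT_comp measurable_snd measurable_fst).
  exact: (measurableT_comp mY measurable_snd).
pose K (q : RT * RT) : \bar R := (\int[Q]_w (G (q, padd q.1 (padd q.2 (Y w))))%:E)%E.
have K0 q : (0 <= K q)%E by apply: integral_ge0 => w _; rewrite lee_fin.
have mKK : measurable_fun setT K.
  by apply: (measurable_fun_fubini_tonelli_F (m2 := Q) _ mK) => u; rewrite lee_fin.
have mrr : measurable_fun setT (fun q : RT * RT => (r q.1 * r q.2)%:E * K q)%E.
  apply: emeasurable_funM => //; apply/measurable_EFinP; apply: measurable_funM.
    exact: (measurableT_comp (measurable_pd_rate theta) measurable_fst).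
  exact: (measurableT_comp (measurable_pd_rate theta) measurable_snd).
have rr0 q : (0 <= (r q.1 * r q.2)%:E * K q)%E.
  by rewrite mule_ge0// lee_fin mulr_ge0// pd_rate_ge0.
transitivity (\int[mu2]_q ((r q.1 * r q.2)%:E * K q))%E; last first.
  rewrite [RHS]integral_mkcond; apply: eq_integral => q _; rewrite patchE.
  case: ifPn => [/set_mem[q1 q2]|/negP qn].
    by congr (_ * _)%E; apply: eq_integral => w _; rewrite padd_comm.
  rewrite /pd_rate; case: ifP => q1; last by rewrite mul0r mul0e.
  case: ifP => q2; last by rewrite mulr0 mul0e.
  by exfalso; apply: qn; apply/mem_set.
apply: etrans _ (esym (@fubini_tonelli1 _ _ RT RT R mu mu _ mrr rr0)).
apply: eq_integral => x _; rewrite /fubini_F /=.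
have [x0|x0] := ltP 0 x; last first.
  rewrite /pd_rate ltNge x0 /= mul0e integral0_eq// => y _; by rewrite mul0r mul0e.
have mKx : measurable_fun setT (fun v : RT * Omega R => (G ((x, v.1), padd x v.2))%:E).
  apply/measurable_EFinP; apply: (measurableT_comp mG (_ : measurable_fun setT
    (fun v : RT * Omega R => ((x, v.1), padd x v.2)))).
  apply: measurable_fun_pair; first exact: measurable_fun_pair.
  apply: (measurableT_comp mpaddv (_ : measurable_fun setT (fun v : RT * Omega R => (x, v.2)))).
  exact: measurable_fun_pair.
transitivity ((r x)%:E * \int[mu]_y ((r y)%:E * K (x, y)))%E; last first.
  rewrite -ge0_integralZl//; last 2 first.
  - apply: emeasurable_funM; first by apply/measurable_EFinP; exact: measurable_pd_rate.
    by apply: (measurableT_comp mKK (_ : measurable_fun setT (fun y : RT => (x, y)))); exact: measurable_fun_pair.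
  - by move=> y _; rewrite mule_ge0.
  by apply: eq_integral => y _; rewrite muleA -EFinM.
congr (_ * _)%E.
(* The second use of Mecke's formula, with the first point frozen at [x]. *)
have := mecke1 theta0 mY poissonY mKx (fun v => (_ : 0 <= (G ((x, v.1), padd x v.2))%:E)%E) => /= <-; last first.
  by move=> v; rewrite lee_fin.
apply: eq_integral => w _; rewrite [RHS]integral_mkcond ge0_integral_count; last first.
  by move=> i; rewrite patchE; case: ifP => // _; rewrite lee_fin.
by apply: eq_eseriesr => i _; rewrite patchE in_idx.
Qed.

(** Mecke's formula for [full] holds with the diagonal on both sides. The two diagonal contributions
    are equal by the same formula for [diag], and finite, so they cancel. *)
Lemma mecke2 :
  (\int[Q]_w \int[counting]_(p in pos_pairs (Y w)) (G ((Y w p.1, Y w p.2), Y w))%:E =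
   \int[mu2]_(q in quadrant R) ((r q.1 * r q.2)%:E *
     \int[Q]_w (G (q, padd q.2 (padd q.1 (Y w))))%:E))%E.
Proof.
have e1 := mecke1 theta0 mY poissonY mfull full0.
have e2 := mecke1 theta0 mY poissonY mdiag diag0.
have mdp : measurable_fun setT (fun v => diag (v.1, padd v.1 v.2)).
  exact: (measurableT_comp mdiag mpadd2).
have split_l : (\int[Q]_w \int[counting]_(i in pos_idx (Y w)) full (Y w i, Y w) =
    \int[Q]_w pairs (Y w) + \int[Q]_w \int[counting]_(i in pos_idx (Y w)) diag (Y w i, Y w))%E.
  rewrite -ge0_integralD//; try exact: mpairs; try by move=> w _; exact: integral_ge0.
  by apply: eq_integral => w _; rewrite sum_full.
have split_r : (\int[mu]_x ((r x)%:E * \int[Q]_w full (x, padd x (Y w))) =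
    \int[mu]_x ((r x)%:E * \int[Q]_w others (x, Y w)) +
    \int[mu]_x ((r x)%:E * \int[Q]_w diag (x, padd x (Y w))))%E.
  rewrite -ge0_integralD//; last 4 first.
  - by move=> x _; rewrite mule_ge0// integral_ge0.
  - exact: minner.
  - by move=> x _; rewrite mule_ge0// integral_ge0.
  - exact: (minner mdp).
  apply: eq_integral => x _.
  have [x0|x0] := ltP 0 x; last by rewrite /pd_rate ltNge x0 /= !mul0e adde0.
  rewrite -ge0_muleDr ?integral_ge0//; congr (_ * _)%E.
  rewrite -ge0_integralD//; last 2 first.
  - exact: (measurableT_comp mothers (mY2 x)).
  - exact: (measurableT_comp mdp (mY2 x)).
  by apply: eq_integral => w _; exact: full_padd.
have := e1; rewrite split_l split_r -e2 others_side => /(congr1 (fun y => y - \int[Q]_w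
   \int[counting]_(i in pos_idx (Y w)) diag (Y w i, Y w))%E).
by rewrite !addeK//; exact: diag_fin.
Qed.

End mecke2.

(** * Scaling and the Poisson-Dirichlet law *)

Section rintegral_scaling.
Context {R : realType}.
Local Notation RT := (measurableTypeR R).
Local Notation mu := (@lebesgue_measure R).

Let fine_muleB (c : R) (A B : \bar R) : 0 < c -> (0 <= A)%E -> (0 <= B)%E ->
  fine (c%:E * A - c%:E * B)%E = c * fine (A - B)%E.
Proof.
move=> c0; case: A => [a| |]//; case: B => [b| |]// _ _.
- by rewrite -!EFinM -!EFinB /= mulrBr.
- by rewrite gt0_muley// -EFinM /= mulr0.
- by rewrite gt0_muley// -EFinM /= mulr0.
- by rewrite gt0_muley//= mulr0.
Qed.

(* No integrability is needed: both sides are 0 when an integral is infinite. *)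
Lemma RintegralZl_gt0 d (T : measurableType d) (m : {measure set T -> \bar R}) (D : set T)
    (c : R) (f : T -> R) : 0 < c -> measurable D -> measurable_fun D f ->
  \int[m]_(x in D) (c * f x) = c * \int[m]_(x in D) f x.
Proof.
move=> c0 mD mf; have mfE : measurable_fun D (EFin \o f) by exact/measurable_EFinP.
rewrite /Rintegral integralE [in RHS]integralE.
rewrite (_ : (\int[m]_(x in D) ((fun x => (c * f x)%:E)^\+ x) = c%:E * \int[m]_(x in D) ((EFin \o f)^\+ x))%E).
  rewrite (_ : (\int[m]_(x in D) ((fun x => (c * f x)%:E)^\- x) = c%:E * \int[m]_(x in D) ((EFin \o f)^\- x))%E).
    by apply: fine_muleB => //; apply: integral_ge0.
  rewrite -ge0_integralZl ?lee_fin ?(ltW c0)//; last exact: measurable_funeneg.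
  apply: eq_integral => x _; rewrite !funenegE/= -!EFin_max -EFinM.
  by rewrite maxr_pMr ?(ltW c0)// mulr0 mulrN.
rewrite -ge0_integralZl ?lee_fin ?(ltW c0)//; last exact: measurable_funepos.
apply: eq_integral => x _; rewrite !funeposE/= -!EFin_max -EFinM.
by rewrite maxr_pMr ?(ltW c0)// mulr0.
Qed.

Lemma Rintegral_itv_dilation (z : R) (f : RT -> R) : 0 < z ->
  measurable_fun (`]0%R, z[ : set RT) f ->
  \int[mu]_(y in `]0, z[) f y = z * \int[mu]_(u in `]0, 1[) f (z * u).
Proof.
move=> z0 mf; have mfE : measurable_fun (`]0%R, z[ : set RT) (EFin \o f) by exact/measurable_EFinP.
rewrite /Rintegral integralE [in RHS]integralE.
rewrite (ge0_integral_itv_dilation z0 (measurable_funepos mfE)); last by [].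
rewrite (ge0_integral_itv_dilation z0 (measurable_funeneg mfE)); last by [].
rewrite fine_muleB ?integral_ge0//.
by congr (_ * fine (_ - _)%E); apply: eq_integral => u _; rewrite ?funeposE ?funenegE.
Qed.

End rintegral_scaling.

Section omega_scaling.
Context {R : realType}.
Implicit Types (z : Omega R) (v y : R) (w : nat -> R).

Lemma ins_scale v y w k : 0 < v -> ins (v * y) (fun k => v * w k) k = v * ins y w k.
Proof. by move=> v0; rewrite /ins !ler_pM2l//; case: ifP => // _; case: ifP. Qed.

Lemma del_scale v i w : del i (fun k => v * w k) = fun k => v * del i w k.
Proof. by apply/funext => k; rewrite /del; case: ifP. Qed.

Lemma merge_scale v i j z : 0 < v -> i != j -> merge i j (scale v z) = scale v (merge i j z).
Proof.
move=> v0 ij; apply: val_inj; rewrite -/(sizes _) -/(sizes (scale v _)) mergeE// !scaleE// mergeE//.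
apply/funext => k; rewrite /merge_seq -mulrDr !del_scale; exact: ins_scale.
Qed.

Lemma split_scale v i y z : 0 < v -> 0 <= y <= z i ->
  split i (v * y) (scale v z) = scale v (split i y z).
Proof.
move=> v0 yz; have [y0 yz'] := andP yz.
apply: val_inj; rewrite -/(sizes _) -/(sizes (scale v _)) splitE ?scaleE//.
  rewrite splitE// /split_seq -mulrBr del_scale.
  have -> : ins (v * (z i - y)) (fun k => v * del i z k) = fun k => v * ins (z i - y) (del i z) k.
    by apply/funext => k; exact: ins_scale.
  by apply/funext => k; exact: ins_scale.
by rewrite mulr_ge0 ?(ltW v0)//= ler_pM2l.
Qed.

Lemma mass_scale v z : 0 < v -> mass (scale v z) = v * mass z.
Proof.
move=> v0; apply: EFin_inj; rewrite EFinM -!massE scaleE// -nneseriesZl//.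
by move=> k _; rewrite lee_fin Omega_ge0.
Qed.

Lemma normalizeP z : normalize z = oscale (mass z)^-1 z.
Proof.
have m0 : 0 < (mass z)^-1 by rewrite invr_gt0 mass_gt0.
apply: val_inj; rewrite -/(sizes _) -/(sizes (oscale _ _)) normalizeE /oscale m0 scaleE//.
by apply/funext => k; rewrite mulrC.
Qed.

Lemma measurable_normalize : measurable_fun setT (@normalize R).
Proof.
rewrite (_ : @normalize R = fun z => oscale (mass z)^-1 z); last by apply/funext => z; exact: normalizeP.
apply: (measurableT_comp (measurable_oscale (R := R)) (_ : measurable_fun setT (fun z : Omega R => ((mass z)^-1 : measurableTypeR R, z)))).
apply: measurable_fun_pair => //.
rewrite (_ : (fun z : Omega R => _) = fun z : Omega R => mass z `^ (-1)).
  exact: (measurableT_comp (measurable_powR _) measurable_mass).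
by apply/funext => z; rewrite powR_inv1// ltW// mass_gt0.
Qed.

End omega_scaling.

(** * The generator with proportional rates, and its scaling *)

Section theta_generator.
Context {R : realType}.
Local Notation RT := (measurableTypeR R).
Local Notation mu := (@lebesgue_measure R).
Variables (lam theta : R) (H : R -> R -> R).
Hypothesis lam0 : 0 <= lam.
Hypothesis theta0 : 0 < theta.
Hypothesis homH : homogeneous_rate lam H.
Hypothesis supH : (rate_sup H < +oo)%E.
Implicit Types (z : Omega R) (Phi : Omega R -> R) (v : R).

Definition theta_rate (x y : R) : R := theta * H x y.

Lemma homogeneous_theta_rate : homogeneous_rate lam theta_rate.
Proof.
have [mH H0 Hs Hh] := homH; split.
- by apply: measurable_funM.
- by move=> x y x0 y0; rewrite mulr_ge0 ?H0// ltW.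
- by move=> x y x0 y0; rewrite /theta_rate Hs.
- by move=> a x y a0 x0 y0; rewrite /theta_rate Hh// mulrCA.
Qed.

Lemma theta_rate_int : (rate_int theta_rate < +oo)%E.
Proof.
apply: (@le_lt_trans _ _ (\int[mu]_(u in `]0%R, 1%R[) (cst (theta * fine (rate_sup H))%:E u))%E).
  apply: ge0_le_integral => //.
  - move=> u /=; rewrite in_itv/= => /andP[u0 u1].
    by rewrite lee_fin (rate_ge0 homogeneous_theta_rate)// subr_gt0.
  - by apply/measurable_EFinP; exact: (measurable_rate_split homogeneous_theta_rate).
  - move=> u /=; rewrite in_itv/= => /andP[u0 u1].
    rewrite lee_fin /theta_rate ler_pM2l//.
    have u1' : 0 < 1 - u by rewrite subr_gt0.
    by have := rate_sup_bound homH supH u0 u1'; rewrite [u + _]addrC subrK powR1 mul1r.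
rewrite integral_cst//= lebesgue_measure_itv/= lte_fin ltr01 -EFinD -EFinM ltry//.
Qed.

Let mS z i : measurable_fun setT (fun y : RT => osplit i y z).
Proof.
apply: (measurableT_comp (measurable_osplit i) (_ : measurable_fun setT (fun y : RT => (y, z)))).
exact: measurable_fun_pair.
Qed.

Let mHu (x : R) : 0 < x -> measurable_fun (`]0%R, 1%R[ : set RT) (fun u : RT => H (u * x) ((1 - u) * x)).
Proof.
move=> x0; apply: (measurable_rate_comp homH) => //.
- by move=> u /=; rewrite in_itv/= => /andP[u0 u1]; rewrite !mulr_gt0// subr_gt0.
- by apply: measurable_funTS; apply: measurable_funM.
- by apply: measurable_funTS; apply: measurable_funM => //; exact: measurable_funB.
Qed.

Let mfrag_u Phi z i : measurable_fun setT Phi -> 0 < z i ->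
  measurable_fun (`]0%R, 1%R[ : set RT)
    (fun u : RT => H (u * z i) ((1 - u) * z i) * (Phi (split i (u * z i) z) - Phi z)).
Proof.
move=> mPhi zi.
apply: (@eq_measurable_fun _ _ _ _ _ (fun u : RT => H (u * z i) ((1 - u) * z i) * (Phi (osplit i (u * z i) z) - Phi z))).
  move=> u /set_mem/=; rewrite in_itv/= => /andP[u0 u1].
  by rewrite /osplit mulr_ge0 ?(ltW u0) ?(ltW zi)//= ler_piMl ?(ltW u1) ?(ltW zi).
apply: measurable_funM; first exact: mHu.
apply: measurable_funTS; apply: measurable_funB => //.
apply: (measurableT_comp mPhi); apply: (measurableT_comp (mS z i) (_ : measurable_fun setT (fun u : RT => u * z i : RT))).
exact: measurable_funM.
Qed.

(** The substitution [y = u * z i] yields one factor [z i]; the other comes from the sum of the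
    fragments in [frag_rate]. *)
Lemma generator_thetaE Phi z : measurable_fun setT Phi ->
  generator_theta H theta Phi z = generator H theta_rate Phi z.
Proof.
move=> mPhi; rewrite /generator_theta /generator; congr (_ + _).
rewrite [theta / 2]mulrC -mulrA; congr (_ * _).
rewrite -RintegralZl_gt0//.
apply: eq_Rintegral => i /set_mem/= zi.
rewrite (Rintegral_itv_dilation zi); last first.
  apply: measurable_funM.
    apply: measurable_funM; first by apply: measurable_funTS; apply: measurable_funD => //; exact: measurable_funB.
    exact: (measurable_rate_split homogeneous_theta_rate).
  apply: (@eq_measurable_fun _ _ _ _ _ (fun y : RT => Phi (osplit i y z) - Phi z)).
    move=> y /set_mem/=; rewrite in_itv/= => /andP[y0 yz].
    by rewrite /osplit (ltW y0) (ltW yz).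
  by apply: measurable_funTS; apply: measurable_funB => //; exact: (measurableT_comp mPhi (mS z i)).
rewrite mulrA expr2 mulrA -mulrA [theta * z i]mulrC -mulrA; congr (_ * _).
rewrite -RintegralZl_gt0//; last exact: mfrag_u.
rewrite -RintegralZl_gt0//; last by apply: measurable_funM => //; exact: mfrag_u.
apply: eq_Rintegral => u _; rewrite /frag_rate /theta_rate.
have -> : z i * u = u * z i by rewrite mulrC.
have -> : z i - u * z i = (1 - u) * z i by rewrite mulrBl mul1r.
have -> : u * z i + (1 - u) * z i = z i by rewrite -mulrDl addrC subrK mul1r.
by rewrite !mulrA [theta * _]mulrC.
Qed.

Let Hscale v x y : 0 < v -> 0 < x -> 0 < y -> H (v * x) (v * y) = v `^ lam * H x y.
Proof. by have [_ _ _ h] := homH; exact: h. Qed.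

Lemma generator_theta_scale Phi v z : measurable_fun setT Phi -> 0 < v ->
  generator_theta H theta Phi (scale v z) =
  v `^ (2 + lam) * generator_theta H theta (fun z => Phi (oscale v z)) z.
Proof.
move=> mPhi v0.
have vE : v `^ (2 + lam) = v * v * v `^ lam.
  by rewrite powRD ?(gt_eqF v0) ?implybT// powR_mulrn ?ltW// expr2.
have v20 : 0 < v `^ (2 + lam) by rewrite powR_gt0.
have pv i : (0 < scale v z i) = (0 < z i) by rewrite scaleE// pmulr_rgt0.
have mPhiv : measurable_fun setT (fun z => Phi (oscale v z)).
  apply: (measurableT_comp mPhi); apply: (measurableT_comp (measurable_oscale (R := R)) (_ : measurable_fun setT (fun z : Omega R => (v : RT, z)))).
  exact: measurable_fun_pair.
have oE z' : oscale v z' = scale v z' by rewrite /oscale v0.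
rewrite /generator_theta mulrDr !(mulrCA (v `^ (2 + lam))); congr (_ * _ + _ * _).
  rewrite -RintegralZl_gt0//; try (by move=> _ B _; exact: measurable_natnat).
  rewrite (_ : pos_pairs (scale v z) = pos_pairs z); last first.
    by apply/funext => p; apply/propext; rewrite /pos_pairs/= !pv.
  apply: eq_Rintegral => p /set_mem[p12 p1 p2].
  rewrite merge_scale// !oE !scaleE// Hscale// vE; ring.
  exact: measurable_natnat.
rewrite -RintegralZl_gt0//.
rewrite (_ : pos_idx (scale v z) = pos_idx z); last first.
  by apply/funext => i; apply/propext; rewrite /pos_idx/= pv.
apply: eq_Rintegral => i /set_mem/= zi.
transitivity ((v * z i) ^+ 2 * \int[mu]_(u in `]0, 1[) (v `^ lam *
    (H (u * z i) ((1 - u) * z i) * (Phi (oscale v (split i (u * z i) z)) - Phi (oscale v z))))).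
  rewrite scaleE//; congr (_ * _); apply: eq_Rintegral => u /set_mem/=.
  rewrite in_itv/= => /andP[u0 u1].
  have u1' : 0 < 1 - u by rewrite subr_gt0.
  have uz : 0 <= u * z i <= z i by rewrite mulr_ge0 ?(ltW u0) ?(ltW zi)//= ler_piMl ?(ltW u1) ?(ltW zi).
  rewrite !(mulrCA _ v) split_scale// !oE Hscale ?mulr_gt0//.
  by rewrite mulrA.
rewrite RintegralZl_gt0 ?powR_gt0//; last exact: (mfrag_u mPhiv).
by rewrite vE exprMn; ring.
Qed.

Local Notation At := (normalized_generator lam (generator_theta H theta)).

Lemma normalized_theta_scale Phi v z : measurable_fun setT Phi -> 0 < v ->
  At Phi (scale v z) = At (fun z => Phi (oscale v z)) z.
Proof.
move=> mPhi v0; rewrite /normalized_generator generator_theta_scale// mass_scale//.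
rewrite powRM ?(ltW v0) ?(ltW (mass_gt0 z))// mulrACA [v `^ _ * v `^ _]mulrC.
by rewrite [v `^ (- _)]powRN mulfV ?gt_eqF ?powR_gt0// mul1r.
Qed.

End theta_generator.

(** * Detailed balance for the Poisson process *)

Section pd_balance.
Context {R : realType}.
Local Notation RT := (measurableTypeR R).
Local Notation mu := (@lebesgue_measure R).
Variables (lam theta : R) (H : R -> R -> R).
Hypothesis lam0 : 0 <= lam.
Hypothesis theta0 : 0 < theta.
Hypothesis homH : homogeneous_rate lam H.
Hypothesis supH : (rate_sup H < +oo)%E.
Context d (W : measurableType d) (Q : probability W R) (Y : {mfun W >-> Omega R}).
Hypothesis poissonY : poisson_process Q (@Xi R \o Y) (PD_intensity theta).

Let law : pprobability (Omega R) R := (distribution Q Y : probability _ _).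

Local Notation P1 := (kprobability (measurable_cst law : measurable_fun [set: RT] _)).
Local Notation P2 := (kprobability (measurable_cst law : measurable_fun [set: RT * RT] _)).

Let lawE (g : Omega R -> R) : measurable_fun setT g -> (forall z, 0 <= g z) ->
  (\int[law]_z (g z)%:E = \int[Q]_w (g (Y w))%:E)%E.
Proof.
move=> mg g0; rewrite (ge0_integral_distribution Y (f := EFin \o g))//; exact/measurable_EFinP.
Qed.

Let pd_rate_merge x y : 0 < x -> 0 < y ->
  x * y * H x y * (pd_rate theta x * pd_rate theta y) =
  (x + y) * (theta * H x y) * pd_rate theta (x + y).
Proof.
move=> x0 y0; rewrite /pd_rate x0 y0 addr_gt0// opprD expRD.
have [nx ny nxy] : [/\ x != 0, y != 0 & x + y != 0] by rewrite !gt_eqF// addr_gt0.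
by field; rewrite nx ny nxy.
Qed.

Lemma pd_balance (h : Omega R * Omega R -> R) : measurable_fun setT h -> (forall q, 0 <= h q) ->
  (\int[Q]_w \int[counting]_p
     (coag_weight lam H (Y w) p * h (Y w, omerge p.1 p.2 (Y w)))%:E =
   \int[Q]_w \int[counting]_i \int[mu]_y
     (frag_weight lam (theta_rate theta H) (Y w) i y * h (osplit i y (Y w), Y w))%:E)%E.
Proof.
have mY : measurable_fun setT Y by exact: measurable_funPT.
have mr := measurable_pd_rate theta.
have B := @balance_of_palm R d W Q Y _ (Omega R) lam H (theta_rate theta H) id (fun t (z : Omega R) => cnt t z)
  (fun z : Omega R => (mass z)%:E) (fun (z : Omega R) x => padd x z) (pd_rate theta)
  (fun q => pd_rate theta q.1 * pd_rate theta q.2) P1 P2.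

move=> mh h0; apply: B => //.
- exact: homogeneous_theta_rate.
- exact: (theta_rate_int theta0 homH supH).
- move=> t t0; apply: measurable_gsum => //; exact: measurable_gtind.
- by apply/measurable_EFinP; exact: measurable_mass.
- by move=> z; rewrite lee_fin ltW// mass_gt0.
- by move=> t s x t0 x0; rewrite /cnt gsum_padd.
- by move=> s x x0; rewrite mass_padd// EFinD.
- exact: measurable_funTS.
- by move=> x x0; exact: pd_rate_ge0.
- apply: measurable_funTS; apply: measurable_funM.
    exact: (measurableT_comp mr measurable_fst).
  exact: (measurableT_comp mr measurable_snd).
- by move=> q q1 q2; rewrite mulr_ge0// pd_rate_ge0.
- move=> G mG G0 _.
  have mGx (x : RT) : measurable_fun setT (fun z => G (x, padd x z)).
    apply: (measurableT_comp mG); apply: measurable_fun_pair => //.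
    apply: (measurableT_comp measurable_padd (_ : measurable_fun setT (fun z : Omega R => (x, z)))).
    exact: measurable_fun_pair.
  apply: etrans (mecke1 theta0 mY poissonY (f := EFin \o G) _ _) _.
  + exact/measurable_EFinP.
  + by move=> q; rewrite lee_fin.
  rewrite [RHS]integral_mkcond; apply: eq_integral => x _; rewrite patchE.
  case: ifPn => [_|]; first by rewrite lawE.
  rewrite notin_setE /half_line/= in_itv/= andbT => x0.
  by rewrite /pd_rate (negbTE (introN idP x0)) mul0e.
- move=> G mG G0 _ GC.
  apply: etrans (mecke2 theta0 mY poissonY mG G0 GC) _.
  apply: eq_integral => q _; rewrite lawE//.
  apply: (measurableT_comp mG); apply: measurable_fun_pair => //.
  apply: (measurableT_comp measurable_padd (_ : measurable_fun setT (fun z : Omega R => (q.2, padd q.1 z)))).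
  apply: measurable_fun_pair => //.
  apply: (measurableT_comp measurable_padd (_ : measurable_fun setT (fun z : Omega R => (q.1, z)))).
  exact: measurable_fun_pair.
- apply: aeW => q [q1 q2] U mU; congr (_%:E * _)%E.
  rewrite /coag_rate /frag_rate /theta_rate; exact: pd_rate_merge.
Qed.

End pd_balance.

(** * Conditioning on an independent variable *)

Section independence.
Context {R : realType} d d1 d2 (W : measurableType d) (T1 : measurableType d1)
  (T2 : measurableType d2) (P : probability W R) (X : {mfun W >-> T1}) (V : {mfun W >-> T2}).
Hypothesis XV : independent P X V.

Lemma ge0_independent_integral (f : T1 * T2 -> \bar R) : measurable_fun setT f ->
  (forall q, 0 <= f q)%E ->
  (\int[P]_w f (X w, V w) = \int[P]_w' \int[P]_w f (X w, V w'))%E.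
Proof.
move=> mf f0.
have mXV : measurable_fun setT (fun w => (X w, V w)) by apply: measurable_fun_pair.
pose XV' : {mfun W >-> (T1 * T2)%type} := HB.pack (fun w => (X w, V w)) (isMeasurableFun.Build _ _ _ _ _ mXV).
have prodE : forall A, measurable A ->
    (distribution P X \x distribution P V)%E A = distribution P XV' A.
  by apply: product_measure_unique => A B mA mB; rewrite -XV.
transitivity (\int[distribution P X \x distribution P V]_q f q)%E.
  transitivity (\int[distribution P XV']_q f q)%E; first by rewrite ge0_integral_distribution.
  by apply: eq_measure_integral => A mA _; exact: esym (prodE A mA).
rewrite fubini_tonelli2//.
rewrite (ge0_integral_distribution V); last 2 first.
- exact: (measurable_fun_fubini_tonelli_G _ mf f0).
- by move=> y; apply: integral_ge0.
apply: eq_integral => w' _ /=.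
rewrite [LHS](ge0_integral_distribution X)//.
by apply: (measurableT_comp mf); exact: measurable_fun_pair.
Qed.

Lemma integral_shift d' (T : measurableType d') (m : probability T R) (g : T -> R) (C : R) :
  measurable_fun setT g -> (forall x, `|g x| <= C) ->
  (\int[m]_x (g x + C)%:E = (\int[m]_x g x + C)%:E)%E.
Proof.
move=> mg gC; have ig : m.-integrable setT (EFin \o g) by exact: bounded_integrable gC.
have iC : m.-integrable setT (EFin \o (cst C : T -> R)).
  by apply: (@bounded_integrable _ _ _ m setT (cst C) `|C|).
under eq_integral do rewrite EFinD.
rewrite (integralD measurableT ig iC) EFinD; congr (_ + _)%E.
  by rewrite [RHS]fineK//; exact: integrable_fin_num ig.
by rewrite [LHS](integral_cst m measurableT C%:E) [X in (_ * X)%E]probability_setT mule1.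
Qed.

(** The value of [V] is frozen by Tonelli's theorem for the product law; adding [C] makes the
    functions nonnegative. *)
Lemma independent_Rintegral_eq (f g : T1 * T2 -> R) (C : R) :
  measurable_fun setT f -> measurable_fun setT g ->
  (forall q, `|f q| <= C) -> (forall q, `|g q| <= C) ->
  (forall w', \int[P]_w f (X w, V w') = \int[P]_w g (X w, V w')) ->
  \int[P]_w f (X w, V w) = \int[P]_w g (X w, V w).
Proof.
move=> mf mg fC gC fg.
have mXV : measurable_fun setT (fun w => (X w, V w)) by apply: measurable_fun_pair.
have mX y : measurable_fun setT (fun w => (X w, V y)) by apply: measurable_fun_pair.
have E (h : T1 * T2 -> R) : measurable_fun setT h -> (forall q, `|h q| <= C) ->
    ((\int[P]_w h (X w, V w) + C)%:E = \int[P]_w' (\int[P]_w h (X w, V w') + C)%:E)%E.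
  move=> mh hC; rewrite -(integral_shift P (measurableT_comp mh mXV)); last by move=> w; exact: hC.
  rewrite (ge0_independent_integral (f := fun q => (h q + C)%:E)).
  - by apply: eq_integral => w' _; rewrite (integral_shift P (measurableT_comp mh (mX w')))// => w; exact: hC.
  - by apply/measurable_EFinP; exact: measurable_funD.
  - by move=> q; have := hC q; rewrite ler_norml lee_fin -lerBlDr sub0r => /andP[].
apply: (@addIr _ C); apply: EFin_inj; rewrite !E//.
by apply: eq_integral => w' _; rewrite fg.
Qed.

End independence.

(** * From the Poisson process to its normalization and to random masses *)

Section poisson_dirichlet_reversibility.
Context {R : realType}.
Local Notation RT := (measurableTypeR R).
Local Notation mu := (@lebesgue_measure R).
Variables (lam theta : R) (H : R -> R -> R).
Hypothesis lam0 : 0 <= lam.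
Hypothesis theta0 : 0 < theta.
Hypothesis homH : homogeneous_rate lam H.
Hypothesis supH : (rate_sup H < +oo)%E.
Implicit Types (z : Omega R) (Phi Psi : Omega R -> R).

Local Notation At := (normalized_generator lam (generator_theta H theta)).
Local Notation M := (fine (rate_sup H) + fine (rate_int (theta_rate theta H))).

Let hom2 := homogeneous_theta_rate theta0 homH.
Let int2 := theta_rate_int theta0 homH supH.

Let AtE Phi : measurable_fun setT Phi ->
  At Phi = normalized_generator lam (generator H (theta_rate theta H)) Phi.
Proof.
by move=> mPhi; apply/funext => z; rewrite /normalized_generator (generator_thetaE theta0 homH).
Qed.

Let measurable_At Phi : bounded_borel Phi -> measurable_fun setT (At Phi).
Proof.
by move=> b; rewrite AtE; [exact: (normalized_generator_measurable lam0 homH supH hom2 int2)|case: b].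
Qed.

Let At_bound Phi (C : R) : measurable_fun setT Phi -> (forall z, `|Phi z| <= C) ->
  forall z, `|At Phi z| <= M * C.
Proof.
move=> mPhi PhiC z; rewrite AtE//.
exact: (normalized_generator_bound lam0 homH supH hom2 int2).
Qed.

Let At_mass Phi (B : set R) : bounded_borel Phi -> measurable B ->
  At (fun z => \1_B (mass z) * Phi z) = (fun z => \1_B (mass z) * At Phi z).
Proof.
move=> [mPhi _] mB; rewrite !AtE//; first exact: normalized_generator_mass.
apply: measurable_funM => //.
by apply: (measurableT_comp (_ : measurable_fun setT (\1_B : RT -> R)) measurable_mass); exact: measurable_indic.
Qed.

(** All states reached by a jump from [z] have the mass of [z]. *)
Let At_local Phi Psi z : (forall z', mass z' = mass z -> Phi z' = Psi z') ->
  At Phi z = At Psi z.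
Proof.
move=> e; rewrite /normalized_generator /generator_theta; congr (_ * (_ * _ + _ * _)).
  by apply: eq_Rintegral => p /set_mem[/= p12 p1 p2]; rewrite !e// mass_merge.
apply: eq_Rintegral => i /set_mem/= zi; congr (_ * _).
apply: eq_Rintegral => u /set_mem/=; rewrite in_itv/= => /andP[u0 u1].
by rewrite !e// mass_split// mulr_ge0 ?(ltW u0) ?(ltW zi)//= ler_piMl ?(ltW u1) ?(ltW zi).
Qed.

(** Normalization is a dilation by a factor that depends on the state. Scaling handles the fixed
    factor given by [z], and on states of the same mass this factor is the right one. *)
Let At_normalize Phi z : measurable_fun setT Phi ->
  At Phi (normalize z) = At (Phi \o @normalize R) z.
Proof.
move=> mPhi; have m0 : 0 < (mass z)^-1 by rewrite invr_gt0 mass_gt0.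
rewrite normalizeP /oscale m0 (normalized_theta_scale theta homH)//.
by apply: At_local => z' mz' /=; rewrite normalizeP mz'.
Qed.

Section law.
Context d (W : measurableType d) (Q : probability W R) (Y : W -> Omega R).
Hypothesis mY : measurable_fun setT Y.
Hypothesis poissonY : poisson_process Q (@Xi R \o Y) (PD_intensity theta).

Lemma normalized_theta_sym Phi Psi : bounded_borel Phi -> bounded_borel Psi ->
  \int[Q]_w (Psi (Y w) * At Phi (Y w)) = \int[Q]_w (Phi (Y w) * At Psi (Y w)).
Proof.
move=> bPhi bPsi; rewrite (AtE (proj1 bPhi)) (AtE (proj1 bPsi)).
pose Y' : {mfun W >-> Omega R} := HB.pack Y (isMeasurableFun.Build _ _ _ _ _ mY).
apply: (normalized_generator_sym lam0 homH supH hom2 int2 mY) => //.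
exact: (pd_balance lam0 theta0 homH supH (poissonY : poisson_process Q (@Xi R \o Y') _)).
Qed.

Lemma normalized_theta_sym_normalize Phi Psi : bounded_borel Phi -> bounded_borel Psi ->
  \int[Q]_w (Psi (normalize (Y w)) * At Phi (normalize (Y w))) =
  \int[Q]_w (Phi (normalize (Y w)) * At Psi (normalize (Y w))).
Proof.
move=> [mPhi [C PhiC]] [mPsi [D PsiD]].
under eq_Rintegral do rewrite At_normalize//.
under [RHS]eq_Rintegral do rewrite At_normalize//.
apply: (@normalized_theta_sym (Phi \o @normalize R) (Psi \o @normalize R)); split.
- exact: (measurableT_comp mPhi measurable_normalize).
- by exists C => z; exact: PhiC.
- exact: (measurableT_comp mPsi measurable_normalize).
- by exists D => z; exact: PsiD.
Qed.

End law.

Lemma reversible_of_PD d (W : measurableType d) (P : probability W R)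
    (X : {RV P >-> Omega R}) (V : {RV P >-> R}) :
  PD theta (pushforward P X) -> (forall w, 0 < V w) -> independent P X V ->
  reversible lam (generator_theta H theta) (pushforward P (fun w => scale (V w) (X w))).
Proof.
move=> [dQ [WQ [Q [Y [mY poissonY XY]]]]] V0 XV.
have M0 : 0 <= M := rate_bound_ge0 lam0 homH supH hom2 int2.
have mX : measurable_fun setT X by exact: measurable_funPT.
(* The variable is retyped with values in [RT], the type on which [oscale] was shown to be jointly
   measurable. *)
have mV : measurable_fun setT (V : W -> RT).
  have mV0 : measurable_fun setT V by exact: measurable_funPT.
  by move=> _ B mB; exact: (mV0 measurableT B mB).
pose V' : {mfun W >-> RT} := HB.pack (V : W -> RT) (isMeasurableFun.Build _ _ _ _ _ mV).
have XV' : independent P X V' by move=> A1 A2 mA1 mA2; exact: XV.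
have mN : measurable_fun setT (@normalize R \o Y).
  exact: (measurableT_comp measurable_normalize mY).
pose N : {mfun WQ >-> Omega R} := HB.pack (@normalize R \o Y) (isMeasurableFun.Build _ _ _ _ _ mN).
pose X1 w := oscale (V w) (X w).
have X1E : X1 = fun w => scale (V w) (X w).
  by apply/funext => w; rewrite /X1 /oscale V0.
rewrite -X1E.
have mX1 : measurable_fun setT X1.
  apply: (measurableT_comp (measurable_oscale (R := R)) (_ : measurable_fun setT (fun w => (V w : RT, X w)))).
  exact: measurable_fun_pair.
(* [X] has the law of the normalized Poisson process, so bounded integrals may be computed with the
   latter. *)
have transfer (g : Omega R -> R) : bounded_borel g ->
    \int[P]_w g (X w) = \int[Q]_w g (normalize (Y w)).
  move=> [mg [C gC]]; congr fine.
  have mgE : measurable_fun setT (EFin \o g) by exact/measurable_EFinP.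
  have iP : P.-integrable setT (EFin \o (g \o X)).
    exact: (@bounded_integrable _ _ _ P setT _ C measurableT (measurableT_comp mg mX) (fun w => gC _)).
  have iQ : Q.-integrable setT (EFin \o (g \o N)).
    exact: (@bounded_integrable _ _ _ Q setT _ C measurableT (measurableT_comp mg mN) (fun w => gC _)).
  transitivity (\int[distribution P X]_z (g z)%:E)%E.
    by rewrite (integral_distribution (X := X) mgE iP).
  rewrite -[RHS](integral_distribution (X := N) mgE iQ).
  by apply: eq_measure_integral => A mA _; exact: XY.
apply: (reversible_of_symmetric M0 measurable_At At_bound At_mass mX1 (fun B _ => erefl)).
move=> Phi Psi bPhi bPsi.
have [[mPhi [C PhiC]] [mPsi [D PsiD]]] := (bPhi, bPsi).
have C0 : 0 <= C by exact: le_trans (PhiC point).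
have D0 : 0 <= D by exact: le_trans (PsiD point).
pose f (q : Omega R * RT) := oscale q.2 q.1.
have mf : measurable_fun setT f.
  apply: (measurableT_comp (measurable_oscale (R := R)) (_ : measurable_fun setT (fun q : Omega R * RT => (q.2, q.1)))).
  exact: measurable_fun_pair.
apply: (independent_Rintegral_eq (X := X) (V := V') XV'
  (f := fun q => Psi (f q) * At Phi (f q)) (g := fun q => Phi (f q) * At Psi (f q)) (C := M * (C * D))).
- by apply: measurable_funM; [exact: (measurableT_comp mPsi mf)|exact: (measurableT_comp (measurable_At bPhi) mf)].
- by apply: measurable_funM; [exact: (measurableT_comp mPhi mf)|exact: (measurableT_comp (measurable_At bPsi) mf)].
- by move=> q; rewrite normrM mulrA mulrC ler_pM// At_bound.
- move=> q; rewrite normrM [C * D]mulrC mulrA mulrC ler_pM// At_bound//.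
(* With [V] frozen, the dilation commutes with the operator and is absorbed into the test
   functions. *)
move=> w'; have v0 := V0 w'.
have mv : measurable_fun setT (oscale (V w')).
  apply: (measurableT_comp (measurable_oscale (R := R)) (_ : measurable_fun setT (fun z : Omega R => (V w' : RT, z)))).
  exact: measurable_fun_pair.
have bv F : bounded_borel F -> bounded_borel (F \o oscale (V w')).
  by move=> [mF [K FK]]; split; [exact: (measurableT_comp mF mv)|exists K => z; exact: FK].
have bAt F : bounded_borel F -> bounded_borel (At F).
  by move=> bF; split; [exact: measurable_At|case: bF => mF [K FK]; exists (M * K); exact: At_bound].
have AtV F z : bounded_borel F -> At F (oscale (V w') z) = At (F \o oscale (V w')) z.
  by move=> [mF _]; rewrite {1}/oscale v0 (normalized_theta_scale theta homH).
under eq_Rintegral do rewrite /f/= AtV//.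
under [RHS]eq_Rintegral do rewrite /f/= AtV//.
rewrite (transfer (fun z => (Psi \o oscale (V w')) z * At (Phi \o oscale (V w')) z)); last first.
  by apply: bounded_borelM; [exact: bv|exact/bAt/bv].
rewrite (transfer (fun z => (Phi \o oscale (V w')) z * At (Psi \o oscale (V w')) z)); last first.
  by apply: bounded_borelM; [exact: bv|exact/bAt/bv].
exact: (normalized_theta_sym_normalize mY poissonY (bv _ bPhi) (bv _ bPsi)).
Qed.

End poisson_dirichlet_reversibility.

Theorem theorem2p4 (R : realType) (lam : R) (lam_ge0 : 0 <= lam) :
  (forall (Hhat Hcheck : R -> R -> R),
    homogeneous_rate lam Hhat -> (0 < rate_sup Hhat < +oo)%E ->
    homogeneous_rate lam Hcheck -> (0 < rate_int Hcheck < +oo)%E ->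
    forall (d : measure_display) (W : measurableType d) (P : probability W R)
      (Z : {RV P >-> Omega R})
      (r1 : measurableTypeR R -> R)
      (r2 : measurableTypeR R * measurableTypeR R -> R)
      (P1 : R.-pker (measurableTypeR R) ~> config R)
      (P2 : R.-pker (measurableTypeR R * measurableTypeR R)%type ~> config R),
    correlation_function1 P Z r1 -> correlation_function2 P Z r2 ->
    palm1 P Z r1 P1 -> palm2 P Z r2 P2 ->
    {ae (@lebesgue_measure R \x @lebesgue_measure R)%E,
      forall z, quadrant R z -> forall U, measurable U ->
        ((coag_rate Hhat z.1 z.2 * r2 z)%:E * P2 z U =
         (frag_rate Hcheck z.1 z.2 * r1 ((z.1 : R) + (z.2 : R))%R)%:E * P1 ((z.1 : R) + (z.2 : R))%R U)%E} ->
    reversible lam (generator Hhat Hcheck) (pushforward P Z))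
  /\
  (forall (theta : R) (H : R -> R -> R), 0 < theta ->
    homogeneous_rate lam H -> (0 < rate_sup H < +oo)%E ->
    forall (d : measure_display) (W : measurableType d) (P : probability W R)
      (X : {RV P >-> Omega R}) (V : {RV P >-> R}),
    PD theta (pushforward P X) -> (forall w, 0 < V w) -> independent P X V ->
    reversible lam (generator_theta H theta)
      (pushforward P (fun w => scale (V w) (X w)))).
Proof.
split.
  move=> Hhat Hcheck hom1 /andP[_ sup1] hom2 /andP[_ int2] d W P Z r1 r2 P1 P2.
  exact: reversible_of_palm_balance.
move=> theta H theta0 homH /andP[_ supH] d W P X V.
exact: (reversible_of_PD lam_ge0 theta0 homH supH).
Qed.
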